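(* Let $\mathcal F$ be a foliation of even codimension $2q$ ($q\ge1$) on a manifold $M$. If there exists an adapted connection of $N\mathcal F$ which produces a projectable almost complex structure $\mathcal I_1$ of $N\hat{\mathcal F}$ on $\mathcal Z(\mathcal F)$, then there also exists a torsionless adapted connection of $N\mathcal F$ with the same property. A torsionless adapted connection whose structure $\mathcal I_1$ is projectable exists if and only if $\mathcal F$ is a transversally projective foliation.
   Context: All objects are $C^\infty$. $(M,\mathcal F)$ is a manifold of dimension $n=p+2q$ with a foliation $\mathcal F$ of codimension $2q$; $F=T\mathcal F\subset TM$, $N\mathcal F=TM/F$, $\pi_N:TM\to N\mathcal F$ is the projection, $\Gamma$ denotes sections. A vector field $X$ (on an open set) is foliated if $[X,Y]\in\Gamma F$ for all $Y\in\Gamma F$; a section of $N\mathcal F$ is foliated if locally it is $\pi_N X$ with $X$ foliated. An object is foliated (= projectable) if locally it is the lift of an object of the local slice spaces (local leaf spaces). An adapted (Bott) connection is a linear connection $\nabla$ on $N\mathcal F$ with $\nabla_Y(\pi_NX)=\pi_N[Y,X]$ for $Y\in\Gamma F$, $X\in\Gamma TM$. It is foliated (projectable) if $\nabla_X s$ is foliated whenever $X$ and $s$ are foliated. Its torsion is $T_\nabla(X,Y)=\nabla_X(\pi_NY)-\nabla_Y(\pi_NX)-\pi_N[X,Y]$; torsionless means $T_\nabla=0$. Transversal twistor space: $\mathcal Z(\mathcal F)=\{J\in End(N_x\mathcal F): J^2=-Id,\ x\in M\}$, with projection $Q:\mathcal Z(\mathcal F)\to M$. An adapted connection $\nabla$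 gives $T\mathcal Z(\mathcal F)=\mathcal H\oplus\mathcal V$, where $\mathcal V=\ker Q_*$ and $\mathcal H$ is the distribution of velocities of $\nabla$-parallel curves. The lifted foliation $\hat{\mathcal F}$ has as tangent space at $J$ the horizontal lift of $F_{Q(J)}$ (independent of the choice of adapted connection). One identifies $\mathcal V_J=\{A\in End(N_{Q(J)}\mathcal F): AJ+JA=0\}$, and $N\hat{\mathcal F}=T\mathcal Z(\mathcal F)/T\hat{\mathcal F}\cong Q^*N\mathcal F\oplus\mathcal V$ (via $\mathcal H/T\hat{\mathcal F}\cong Q^*N\mathcal F$). The connection $\nabla$ defines the complex structure $\mathcal I_1(v,A)=(Jv,J\circ A)$ (at $J$) of the bundle $N\hat{\mathcal F}$. $\mathcal I_1$ is ($\hat{\mathcal F}$-)projectable if it maps foliated local sections of $N\hat{\mathcal F}$ to foliated sections, i.e. it is locally the lift of an almost complex structure of the local slice spaces of $\hat{\mathcal F}$. A foliated $1$-form is a local pullback of a $1$-form of the slice spaces. $\mathcal F$ is transversally projective if there are an open covering $M=\bigcup_\alpha U_\alpha$ by $\mathcal F$-adapted coordinate neighborhoods and torsionless foliated connections $\nabla^\alpha$ on $N\mathcal F|_{U_\alpha}$ such that on $U_\alpha\cap U_\beta$ one has $\nabla^\beta_X(\pi_NY)-\nabla^\alpha_X(\pi_NY)=\phi_{\alpha\beta}(X)\pi_NY+\phi_{\alpha\beta}(Y)\pi_NX$ with foliated $1$-forms $\phi_{\alpha\beta}$. *)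

(* Defs.v *)
From HB Require Import structures.
From mathcomp Require Import all_boot all_order all_algebra.
From mathcomp Require Import all_classical all_reals all_analysis.

Set Implicit Arguments.
Unset Strict Implicit.
Unset Printing Implicit Defensive.

Import Order.TTheory GRing.Theory Num.Theory.
Import numFieldNormedType.Exports.
Local Open Scope classical_set_scope.
Local Open Scope ring_scope.

(* Conventions.
   - R^n is 'rV[R]_n; linear maps act on row vectors on the right, so the
     endomorphism J o A has matrix A *m J.
   - The leaf dimension is p and the codimension is k; a foliated chart takes
     values in R^(p + k), the last k coordinates (rsubmx) being the transverse
     ones.
   - Every point x has a preferred foliated chart chart_at x, and a vector of
     T_x M is represented by its components in that chart.  Since the chart is
     foliated, F_x = { v | rsubmx v = 0 }, N_x = T_x M / F_x is R^k and the
     projection T_x M -> N_x is rsubmx. *)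

Section Euclidean.
Context {R : realType} {V W : normedModType R}.

Definition smooth_on (U : set V) (f : V -> W) : Prop :=
  forall (vs : seq V) (x : V), U x ->
    differentiable (foldr (fun v (g : V -> W) => 'D_v g) f vs) x.

Definition vbracket (X Y : V -> V) (z : V) : V :=
  'D_(X z) Y z - 'D_(Y z) X z.
End Euclidean.

Record chart (R : realType) (T : topologicalType) (n : nat) := Chart {
  dom : set T ;
  cmap : T -> 'rV[R]_n ;
  cinv : 'rV[R]_n -> T ;
  dom_open : open dom ;
  img_open : open (cmap @` dom) ;
  cmapK : {in dom, cancel cmap cinv} ;
  cmap_cont : forall x, dom x -> {for x, continuous cmap} ;
  cinv_cont : forall z, (cmap @` dom) z -> {for z, continuous cinv} }.

Section Transitions.
Context {R : realType} {T : topologicalType} {p k : nat}.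
Implicit Types c d : chart R T (p + k).

Definition trans c d : 'rV[R]_(p + k) -> 'rV[R]_(p + k) := cmap d \o cinv c.

(* The second clause says that the transverse coordinates of d are locally
   functions of the transverse coordinates of c only. *)
Definition fol_compat c d : Prop :=
  let O := cmap c @` (dom c `&` dom d) in
  smooth_on O (trans c d) /\
  forall z, O z -> forall v : 'rV[R]_p,
    rsubmx ('D_(row_mx v 0) (trans c d) z) = 0.

(* Transverse Jacobian of the change of charts, for row vectors. *)
Definition tjac c d (z : 'rV[R]_(p + k)) : 'M[R]_k :=
  lin1_mx (fun w : 'rV[R]_k => rsubmx ('D_(row_mx 0 w) (trans c d) z)).
End Transitions.

Record foliated_manifold (R : realType) (p k : nat) := FoliatedManifold {
  pt :> topologicalType ;
  fol_hausdorff : hausdorff_space pt ;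
  fol_second_countable : @second_countable pt ;
  charts : set (chart R pt (p + k)) ;
  charts_cover : forall x : pt, exists c, charts c /\ dom c x ;
  charts_compat : forall c d, charts c -> charts d -> fol_compat c d ;
  charts_maximal : forall c,
    (forall d, charts d -> fol_compat c d /\ fol_compat d c) -> charts c }.

Section FoliatedGeometry.
Context {R : realType} {p k : nat} (M : foliated_manifold R p k).
Local Notation TV := 'rV[R]_(p + k).
Local Notation NV := 'rV[R]_k.
Local Notation chartM := (chart R (pt M) (p + k)).

Definition chart_at (x : M) : chartM := projT1 (cid (charts_cover x)).
Definition base (x : M) : TV := cmap (chart_at x) x.

(* Components in the chart c of a vector of T_x M, resp. matrix taking the
   components in chart_at x of a vector of N_x to those in c. *)
Definition tcoord (c : chartM) (x : M) (v : TV) : TV :=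
  'D_v (trans (chart_at x) c) (base x).
Definition nmx (c : chartM) (x : M) : 'M[R]_k := tjac (chart_at x) c (base x).

Definition smooth_fun (U : set M) (f : M -> R) : Prop :=
  forall c, charts (f := M) c ->
    smooth_on (cmap c @` (dom c `&` U)) (f \o cinv c).

Definition dfun (f : M -> R) (x : M) (v : TV) : R :=
  'D_v (f \o cinv (chart_at x)) (base x).

Definition tloc (c : chartM) (X : M -> TV) (z : TV) : TV :=
  tcoord c (cinv c z) (X (cinv c z)).
Definition nloc (c : chartM) (s : M -> NV) (z : TV) : NV :=
  s (cinv c z) *m nmx c (cinv c z).

Definition vfield (U : set M) (X : M -> TV) : Prop :=
  forall c, charts (f := M) c -> smooth_on (cmap c @` (dom c `&` U)) (tloc c X).
Definition nsection (U : set M) (s : M -> NV) : Prop :=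
  forall c, charts (f := M) c -> smooth_on (cmap c @` (dom c `&` U)) (nloc c s).

Definition piN (X : M -> TV) (x : M) : NV := rsubmx (X x).

Definition bracket (X Y : M -> TV) (x : M) : TV :=
  vbracket (tloc (chart_at x) X) (tloc (chart_at x) Y) (base x).

Definition leaf_field (U : set M) (Y : M -> TV) : Prop :=
  vfield U Y /\ forall x, U x -> rsubmx (Y x) = 0.

Definition foliated_field (U : set M) (X : M -> TV) : Prop :=
  vfield U X /\
  forall V Y, open V -> V `<=` U -> leaf_field V Y -> leaf_field V (bracket X Y).

Definition foliated_section (U : set M) (s : M -> NV) : Prop :=
  forall x, U x -> exists V X,
    [/\ open V, V x, V `<=` U, foliated_field V X &
        forall y, V y -> s y = piN X y].

(* nabla x v s is the covariant derivative of s at x in the direction v.  The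
   axioms force it to depend only on the germ of s at x: apply the Leibniz rule
   to the indicator function of a neighbourhood of x. *)
Definition covderiv := forall x : M, TV -> (M -> NV) -> NV.

Definition is_connection (U : set M) (nabla : covderiv) : Prop :=
  [/\ forall x s (a : R) v w, U x ->
        nabla x (a *: v + w) s = a *: nabla x v s + nabla x w s,
      forall V x v s t, open V -> V `<=` U -> V x ->
        nsection V s -> nsection V t ->
        nabla x v (fun y => s y + t y) = nabla x v s + nabla x v t,
      forall V x v f s, open V -> V `<=` U -> V x ->
        smooth_fun V f -> nsection V s ->
        nabla x v (fun y => f y *: s y) =
          dfun f x v *: s x + f x *: nabla x v s
    & forall V X s, open V -> V `<=` U -> vfield V X -> nsection V s ->
        nsection V (fun x => nabla x (X x) s) ].

Definition adapted_connection (U : set M) (nabla : covderiv) : Prop :=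
  is_connection U nabla /\
  forall V X Y, open V -> V `<=` U -> vfield V X -> leaf_field V Y ->
    forall x, V x -> nabla x (Y x) (piN X) = piN (bracket Y X) x.

Definition foliated_connection (U : set M) (nabla : covderiv) : Prop :=
  adapted_connection U nabla /\
  forall V X s, open V -> V `<=` U -> foliated_field V X ->
    foliated_section V s -> foliated_section V (fun x => nabla x (X x) s).

Definition torsion (nabla : covderiv) (X Y : M -> TV) (x : M) : NV :=
  nabla x (X x) (piN Y) - nabla x (Y x) (piN X) - piN (bracket X Y) x.

Definition torsionless (U : set M) (nabla : covderiv) : Prop :=
  forall V X Y, open V -> V `<=` U -> vfield V X -> vfield V Y ->
    forall x, V x -> torsion nabla X Y x = 0.

(* The slice space is an open subset S of R^k, the submersion onto it is the
   transverse part of a foliated chart, and g is the covector field on S which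
   is pulled back. *)
Definition foliated_form (U : set M) (phi : M -> TV -> R) : Prop :=
  forall x, U x -> exists V c (S : set NV) (g : NV -> 'cV[R]_k),
    [/\ open V, V x & V `<=` U `&` dom c] /\
    [/\ charts (f := M) c, open S, smooth_on S g &
        forall y, V y -> S (rsubmx (cmap c y)) /\
          forall v, phi y v =
            (rsubmx (tcoord c y v) *m g (rsubmx (cmap c y))) 0 0].

Definition transversally_projective : Prop :=
  exists (I : Type) (c : I -> chartM) (nabla : I -> covderiv)
         (phi : I -> I -> M -> TV -> R),
    [/\ forall i, charts (f := M) (c i),
        forall x : M, exists i, dom (c i) x,
        forall i, foliated_connection (dom (c i)) (nabla i) /\
                  torsionless (dom (c i)) (nabla i)
      & forall i j, let U := dom (c i) `&` dom (c j) in
          foliated_form U (phi i j) /\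
          forall V X Y, open V -> V `<=` U -> vfield V X -> vfield V Y ->
            forall x, V x ->
              nabla j x (X x) (piN Y) - nabla i x (X x) (piN Y) =
              phi i j x (X x) *: piN Y x + phi i j x (Y x) *: piN X x].

(* Total space of the bundle End(N): a pair (x, J) is the endomorphism of N_x
   with matrix J in chart_at x.  The twistor space Z is a submanifold of it; in
   a chart of M, End(N) is an open subset of R^(p+k) x M_k(R) and Z is the set
   of pairs (z, K) with K *m K = -1.  A tangent vector of End(N) at (x, J) is
   represented by its components in the trivialization given by chart_at x. *)
Local Notation EN := (pt M * 'M[R]_k)%type.
Local Notation TE := ('rV[R]_(p + k) * 'M[R]_k)%type.

Definition twistor : set EN := [set z | z.2 *m z.2 = - 1%:M].

Definition etrans (c d : chartM) (zK : TE) : TE :=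
  (trans c d zK.1, invmx (tjac c d zK.1) *m zK.2 *m tjac c d zK.1).

Definition ebase (z : EN) : TE := (base z.1, z.2).
Definition echart (c : chartM) (z : EN) : TE := etrans (chart_at z.1) c (ebase z).
Definition einv (c : chartM) (zK : TE) : EN :=
  let x := cinv c zK.1 in (x, nmx c x *m zK.2 *m invmx (nmx c x)).

Definition eopen (O : set EN) : Prop :=
  forall c, charts (f := M) c -> open (echart c @` [set z | O z /\ dom c z.1]).

Definition ecoord (c : chartM) (z : EN) (u : TE) : TE :=
  'D_u (etrans (chart_at z.1) c) (ebase z).
Definition eloc (c : chartM) (X : EN -> TE) (zK : TE) : TE :=
  ecoord c (einv c zK) (X (einv c zK)).

Definition ebracket (X Y : EN -> TE) (z : EN) : TE :=
  let c := chart_at z.1 in vbracket (eloc c X) (eloc c Y) (ebase z).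

(* Tangent space of the fibre of Z through J. *)
Definition vertical (J A : 'M[R]_k) : Prop := A *m J + J *m A = 0.

(* Vector fields on the open subset Z `&` O of Z are given as (restrictions of)
   smooth fields on an open set O of End(N) that are tangent to Z along Z. *)
Definition zfield (O : set EN) (X : EN -> TE) : Prop :=
  (forall c, charts (f := M) c ->
     smooth_on (echart c @` [set z | O z /\ dom c z.1]) (eloc c X)) /\
  forall z, O z -> twistor z -> vertical z.2 (X z).2.

(* The i-th row of the connection matrix is nabla_v e_i, where (e_i) is the
   frame of N given by the transverse coordinates of chart_at x. *)
Definition nframe (x : M) (i : 'I_k) (y : M) : NV :=
  delta_mx 0 i *m invmx (nmx (chart_at x) y).
Definition conn_mx (nabla : covderiv) (x : M) (v : TV) : 'M[R]_k :=
  \matrix_i nabla x v (nframe x i).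

Definition velocity (g : R -> EN) (t : R) : TE :=
  'D_1 (fun s => echart (chart_at (g t).1) (g s)) t.

(* A curve t |-> (x t, J t) in Z is parallel if the covariant derivative of J
   along x, for the connection induced on End(N), vanishes.  On rows,
   (nabla_v J) s = nabla_v (s J) - (nabla_v s) J, whence the formula. *)
Definition parallel_curve (nabla : covderiv) (e : R) (g : R -> EN) : Prop :=
  let I := [set t : R | `|t| < e] in
  [/\ forall t, I t -> twistor (g t),
      forall c, charts (f := M) c ->
        let O := [set t | I t /\ dom c (g t).1] in
        open O /\ smooth_on O (fun t => echart c (g t))
    & forall t, I t ->
        let u := velocity g t in
        let w := conn_mx nabla (g t).1 u.1 in
        u.2 + (g t).2 *m w - w *m (g t).2 = 0].

Definition horizontal (nabla : covderiv) (z : EN) : set TE :=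
  [set u | exists (e : R) (g : R -> EN),
     [/\ 0 < e, parallel_curve nabla e g, g 0 = z & velocity g 0 = u]].

Definition lifted_leaf (nabla : covderiv) (z : EN) : set TE :=
  [set u | horizontal nabla z u /\ rsubmx u.1 = 0].

Definition zleaf_field (nabla : covderiv) (O : set EN) (Y : EN -> TE) : Prop :=
  zfield O Y /\ forall z, O z -> twistor z -> lifted_leaf nabla z (Y z).

Definition zfoliated_field (nabla : covderiv) (O : set EN) (X : EN -> TE) : Prop :=
  zfield O X /\
  forall O' Y, eopen O' -> O' `<=` O -> zleaf_field nabla O' Y ->
    forall z, O' z -> twistor z -> lifted_leaf nabla z (ebracket X Y z).

(* The fibre of the normal bundle of the lifted foliation at z = (x, J) is
   identified with N_x (+) V_J: the vector u = h + (0, A) of T_z Z, with h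
   horizontal and A vertical, projects to (pi_N (Q_* u), A), and Q_* u = u.1. *)
Definition zproj (nabla : covderiv) (z : EN) (u : TE) (wA : NV * 'M[R]_k) : Prop :=
  [/\ wA.1 = rsubmx u.1, vertical z.2 wA.2 &
      horizontal nabla z (u.1, u.2 - wA.2)].

Definition zfoliated_section (nabla : covderiv) (O : set EN)
    (s : EN -> NV * 'M[R]_k) : Prop :=
  forall z, O z -> twistor z -> exists O' X,
    [/\ eopen O', O' z, O' `<=` O, zfoliated_field nabla O' X &
        forall y, O' y -> twistor y -> zproj nabla y (X y) (s y)].

Definition I1 (z : EN) (wA : NV * 'M[R]_k) : NV * 'M[R]_k :=
  (wA.1 *m z.2, wA.2 *m z.2).

Definition I1_projectable (nabla : covderiv) : Prop :=
  forall O s, eopen O -> zfoliated_section nabla O s ->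
    zfoliated_section nabla O (fun z => I1 z (s z)).
End FoliatedGeometry.

(* Main.v *)
(* In a foliated chart let G(w) be the matrix of the connection in the transverse
   direction w; adaptedness says that leaf directions contribute nothing.  A
   field on the twistor space is foliated iff, along Z, its derivatives in leaf
   directions are tangent to the lifted leaves.  Hence I_1 is projectable iff
   the derivative Om(w) of G(w) in every leaf direction satisfies
     [K, Om(w)] K = [K, Om(w K)]   for all K with K^2 = -1.
   Evaluating this at enough K gives v Om(w) + w Om(v) = h(v) w + h(w) v with h
   linear, and v Om(w) = h(v) w + h(w) v is conversely sufficient.  So the
   condition survives symmetrization, and for a torsionless connection it says
   that Om is pure trace.  Removing the trace of G in each chart then gives
   foliated torsionless connections which are projectively related.  Conversely,
   if the G_i are foliated and projectively related, the leaf derivative of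
   sum th_i G_i, for a partition of unity (th_i), is sum (D th_i) (G_i - G_0),
   which is pure trace. *)
Require Import Defs.
From HB Require Import structures.
From mathcomp Require Import all_boot all_order all_algebra.
From mathcomp Require Import all_classical all_reals all_analysis.
From mathcomp Require Import perm ring lra.

Set Implicit Arguments.
Unset Strict Implicit.
Unset Printing Implicit Defensive.

Import Order.TTheory GRing.Theory Num.Theory.
Import numFieldNormedType.Exports.
Local Open Scope classical_set_scope.
Local Open Scope ring_scope.

(* Failing conversions diverge once derivatives and coordinate changes unfold. *)
Local Opaque derive.

(** * Smooth maps between normed spaces *)

(** Origin of the commutator condition: the field with constant components (w, 0) in a chart is
    foliated, and its class in the normal bundle is (w, [K, G(w)]). The image of this class under
    I_1 is represented by a field with fibre component [K, G(w)] K - [K, G(w K)], and the leaf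
    derivative of that at fixed K has to vanish. Three obstacles shape the development. Horizontal
    vectors are velocities of parallel curves, so describing them by a linear equation takes the
    solution of a linear differential equation. Fields on the twistor space are fields on End(N)
    constrained only where K^2 = -1, so the components of a leaf field may be differentiated only
    along curves inside that quadric. Vectors are read in preferred charts that jump from point to
    point, so every pointwise notion is carried to one fixed chart before it is differentiated. The
    constant 1/(k + 1) in the trace correction is explained by the matrix of v |-> h(v) w + h(w) v:
    its scalar part has trace k h(w), its rank-one part has trace h(w). *)

Section ScaleBilinear.
Context {R : realType} (W : normedModType R).

(** Scalar multiplication as a bundled bilinear map: the product rule [diffZ_fun] is the
    differential of this map composed with a pair of functions. *)
Definition scale_fun (a : R) (w : W) : W := a *: w.

Lemma scale_fun_bilinear : bilinear_for
  (GRing.Scale.Law.clone _ _ *:%R _) (GRing.Scale.Law.clone _ _ *:%R _) scale_fun.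
Proof.
split=> [w a u v|a b u v]; rewrite /scale_fun /=; first by rewrite scalerDl scalerA.
by rewrite scalerDr !scalerA mulrC.
Qed.

HB.instance Definition _ :=
  bilinear_isBilinear.Build R R W W _ _ scale_fun scale_fun_bilinear.
End ScaleBilinear.

Section Smooth.
Context {R : realType}.

(** Finite dimension in the form in which it acts here: expansion with continuous coefficients. It
    makes linear maps continuous and turns a derivative in a moving direction into a finite sum of
    derivatives in fixed directions. As a class it is inferred for matrices, products and [R]. *)
Class fin_basis (W : normedModType R) : Prop := FinBasis {
  ex_fin_basis : exists (I : finType) (e : I -> W) (l : I -> {linear W -> R}),
    (forall i, continuous (l i)) /\ forall w, w = \sum_i l i w *: e i }.

Lemma continuous_coord_mx m n i j :
  continuous (fun N : 'M[R]_(m, n) => N i j : R).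
Proof. by move=> N; apply: coord_continuous. Qed.

Global Instance fin_basis_mx m n : fin_basis 'M[R]_(m, n).
Proof.
have lin (ij : 'I_m * 'I_n) : linear (fun N : 'M[R]_(m, n) => N ij.1 ij.2 : R).
  by move=> a u v; rewrite !mxE.
pose l ij : {linear 'M[R]_(m, n) -> R} :=
  HB.pack (fun N : 'M[R]_(m, n) => N ij.1 ij.2 : R)
    (GRing.isLinear.Build _ _ _ _ _ (lin ij)).
split; exists ('I_m * 'I_n)%type, (fun ij => delta_mx ij.1 ij.2), l; split.
  by move=> ij; exact: continuous_coord_mx.
move=> w; rewrite [LHS]matrix_sum_delta.
by rewrite pair_bigA.
Qed.

Global Instance fin_basis_real : fin_basis R.
Proof.
split; exists unit, (fun _ => 1), (fun _ => idfun); split.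
  by move=> _ x; exact: cvg_id.
by move=> w; rewrite big_const card_unit /= addr0 [RHS]mulr1.
Qed.

Global Instance fin_basis_prod (V W : normedModType R) :
  fin_basis V -> fin_basis W -> fin_basis (V * W)%type.
Proof.
move=> [[I [e [l [cl le]]]]] [[J [f [m [cm mf]]]]].
pose b (k : I + J) : (V * W)%type := match k with inl i => (e i, 0) | inr j => (0, f j) end.
pose n0 (k : I + J) : (V * W)%type -> R :=
  match k with inl i => l i \o fst | inr j => m j \o snd end.
have lin k : linear (n0 k).
  by case: k => i a u v /=; rewrite linearP.
pose n k : {linear (V * W)%type -> R} :=
  HB.pack (n0 k) (GRing.isLinear.Build _ _ _ _ _ (lin k)).
split; exists (I + J)%type, b, n; split.
  by case=> i x; apply: continuous_comp; [exact: cvg_fst|exact: cl|exact: cvg_snd|exact: cm].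
case=> v w; rewrite big_sumType /=.
rewrite [v in LHS]le [w in LHS]mf.
have E (a : R) (x : V) (y : W) : a *: (x, y) = (a *: x, a *: y) by [].
have E2 (x x' : V) (y y' : W) : (x, y) + (x', y') = (x + x', y + y') by [].
under eq_bigr do rewrite E scaler0.
under [X in _ = _ + X]eq_bigr do rewrite E scaler0.
have S1 (F : I -> V) : \sum_i (F i, 0 : W) = (\sum_i F i, 0).
  by elim/big_rec2: _ => // i x y _ ->; rewrite E2 addr0.
have S2 (F : J -> W) : \sum_i (0 : V, F i) = (0, \sum_i F i).
  by elim/big_rec2: _ => // i x y _ ->; rewrite E2 addr0.
by rewrite S1 S2 E2 addr0 add0r.
Qed.

Definition Dseq (V W : normedModType R) (f : V -> W) (vs : seq V) : V -> W :=
  foldr (fun v (g : V -> W) => 'D_v g) f vs.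

(** [smooth_on] cut off at order n, so that closure properties go by induction on n. The induction
    runs through [CnS], which peels off the derivative taken first. *)
Definition Cn (V W : normedModType R) n (U : set V) (f : V -> W) : Prop :=
  forall vs x, (size vs <= n)%N -> U x -> differentiable (Dseq f vs) x.

Lemma smooth_onC (V W : normedModType R) (U : set V) (f : V -> W) :
  smooth_on U f <-> forall n, Cn n U f.
Proof.
split=> [h n vs x _ Ux|h vs x Ux]; first exact: h.
exact: (h (size vs)).
Qed.

Lemma CnS (V W : normedModType R) n (U : set V) (f : V -> W) :
  Cn n.+1 U f <-> (forall x, U x -> differentiable f x) /\
                  forall v, Cn n U ('D_v f).
Proof.
split=> [h|[h1 h2] vs x].
  split=> [x Ux|v vs x sv Ux]; first exact: (h [::]).
  have := h (rcons vs v) x; rewrite size_rcons /Dseq foldr_rcons; exact.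
case/lastP: vs => [|vs v] sv Ux; first exact: h1.
by rewrite /Dseq foldr_rcons; apply: h2 => //; move: sv; rewrite size_rcons.
Qed.

Lemma Cn0 (V W : normedModType R) (U : set V) (f : V -> W) :
  Cn 0 U f <-> (forall x, U x -> differentiable f x).
Proof.
split=> [h x Ux|h [|//] x _ Ux]; first exact: (h [::]).
exact: h.
Qed.

Lemma CnW (V W : normedModType R) n (U : set V) (f : V -> W) :
  Cn n.+1 U f -> Cn n U f.
Proof. by move=> h vs x sv; apply: h; apply: leqW. Qed.

Lemma differentiableI (V W : normedModType R) (f : V -> W)
    (df : {linear V -> W}) x : continuous df ->
  (forall e : R, 0 < e ->
     \forall h \near (0 : V), `|f (h + x) - f x - df h| <= e * `|h|) ->
  differentiable f x /\ 'd f x = df :> (V -> W).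
Proof.
move=> cdf H.
have E : f \o shift x = cst (f x) + df +o_ (0 : V) id.
  by apply/eqaddoP => e e0; near do rewrite /= opprD addrA; exact: H.
by have D := diff_unique cdf E; split => //; apply/diff_locallyP; rewrite D.
Unshelve. all: by end_near. Qed.

Lemma differentiable_near (V W : normedModType R) (f g : V -> W) x :
  (\near x, f x = g x) -> differentiable f x -> differentiable g x.
Proof.
move=> fg df.
(* [g - f] vanishes near x, so it is differentiable there with differential 0. *)
have -> : g = f + (g - f) by apply/funext => y /=; rewrite !fctE addrC subrK.
apply: differentiableD => //.
have cz : continuous (\0 : {linear V -> W}).
  by move=> y; exact: (@cst_continuous V W 0).
suff : differentiable (g - f) x /\ 'd (g - f) x = (\0 : {linear V -> W}) :> (V -> W) by case.
apply: differentiableI => // e e0; rewrite !fctE -(nbhs_singleton fg) subrr.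
have : \forall y \near (0 : V), f (y + x) = g (y + x).
  by move: fg; rewrite (near_shift 0 x); apply: filterS => y /=; rewrite subr0.
by apply: filterS => y /= ->; rewrite /= !subrr normr0 mulr_ge0 // ltW.
Qed.

Lemma Dseq_eq (V W : normedModType R) (U : set V) (f g : V -> W) vs :
  open U -> (forall x, U x -> f x = g x) ->
  forall x, U x -> Dseq f vs x = Dseq g vs x.
Proof.
move=> oU fg; elim: vs => //= v vs IH x Ux; apply: near_eq_derive.
by apply: filterS (open_nbhs_nbhs (conj oU Ux)) => y; apply: IH.
Qed.

Lemma Cn_eq (V W : normedModType R) n (U : set V) (f g : V -> W) :
  open U -> (forall x, U x -> f x = g x) -> Cn n U f -> Cn n U g.
Proof.
move=> oU fg h vs x sv Ux; apply: differentiable_near (h vs x sv Ux).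
by apply: filterS (open_nbhs_nbhs (conj oU Ux)) => y; apply: Dseq_eq.
Qed.

Lemma derive_lin_comp (V W Z : normedModType R) (f : V -> W)
    (L : {linear W -> Z}) x v :
  continuous L -> differentiable f x -> 'D_v (L \o f) x = L ('D_v f x).
Proof.
move=> cL df; have dL : differentiable L (f x) by exact: linear_differentiable.
rewrite deriveE; last exact: differentiable_comp.
by rewrite diff_comp //= diff_lin // deriveE.
Qed.

Lemma Cn_lin (V W Z : normedModType R) n (U : set V) (f : V -> W)
    (L : {linear W -> Z}) :
  open U -> continuous L -> Cn n U f -> Cn n U (L \o f).
Proof.
move=> oU cL; elim: n f => [|n IH] f.
  move=> /Cn0 h; apply/Cn0 => x Ux.
  by apply: differentiable_comp; [exact: h|exact: linear_differentiable].
move=> /CnS[h1 h2]; apply/CnS; split => [x Ux|v].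
  by apply: differentiable_comp; [exact: h1|exact: linear_differentiable].
apply: (Cn_eq oU _ (IH _ (h2 v))) => x Ux /=.
by rewrite derive_lin_comp //; exact: h1.
Qed.

Lemma CnD (V W : normedModType R) n (U : set V) (f g : V -> W) :
  open U -> Cn n U f -> Cn n U g -> Cn n U (fun x => f x + g x).
Proof.
move=> oU; elim: n f g => [|n IH] f g.
  move=> /Cn0 h /Cn0 k; apply/Cn0 => x Ux; apply: differentiableD; [exact: h|exact: k].
move=> /CnS[h1 h2] /CnS[k1 k2]; apply/CnS; split => [x Ux|v].
  by apply: differentiableD; [exact: h1|exact: k1].
apply: (Cn_eq oU _ (IH _ _ (h2 v) (k2 v))) => x Ux /=.
by rewrite deriveD //; apply: diff_derivable; [exact: h1|exact: k1].
Qed.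

Lemma Cn_cst (V W : normedModType R) n (U : set V) (a : W) :
  open U -> Cn n U (fun=> a).
Proof.
move=> oU; elim: n a => [|n IH] a; first by apply/Cn0 => x _; exact: differentiable_cst.
apply/CnS; split => [x _|v]; first exact: differentiable_cst.
by apply: (Cn_eq oU _ (IH 0)) => x Ux /=; rewrite derive_cst.
Qed.

Lemma diffZ_fun (V W : normedModType R) (k : V -> R) (f : V -> W) x :
  differentiable k x -> differentiable f x ->
  differentiable (fun y => k y *: f y) x /\
  forall v, 'D_v (fun y => k y *: f y) x = 'D_v k x *: f x + k x *: 'D_v f x.
Proof.
move=> dk df.
pose s := @scale_fun R W.
have cs : continuous (fun p : (R * W)%type => s p.1 p.2).
  by move=> p; apply: cvgZ; [exact: cvg_fst|exact: cvg_snd].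
have dp : differentiable (fun y => (k y, f y)) x by exact: differentiable_pair.
have ds := differentiable_bilin (k x, f x) cs.
have dc : differentiable ((fun p : (R * W)%type => s p.1 p.2) \o (fun y => (k y, f y))) x.
  exact: differentiable_comp.
split=> [|v]; first exact: dc.
rewrite (deriveE v dc) diff_comp //= diff_bilin //= diff_pair //=.
by rewrite addrC -!deriveE.
Qed.

Lemma CnZ (V W : normedModType R) n (U : set V) (k : V -> R) (f : V -> W) :
  open U -> Cn n U k -> Cn n U f -> Cn n U (fun x => k x *: f x).
Proof.
move=> oU; elim: n k f => [|n IH] k f.
  move=> /Cn0 h /Cn0 g; apply/Cn0 => x Ux.
  exact: (diffZ_fun (h _ Ux) (g _ Ux)).1.
move=> ck cf; have [h1 h2] := (CnS _ _ _).1 ck; have [g1 g2] := (CnS _ _ _).1 cf.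
apply/CnS; split => [x Ux|v]; first exact: (diffZ_fun (h1 _ Ux) (g1 _ Ux)).1.
have := CnD oU (IH _ _ (h2 v) (CnW cf)) (IH _ _ (CnW ck) (g2 v)).
by apply: (Cn_eq oU) => x Ux /=; rewrite (diffZ_fun (h1 _ Ux) (g1 _ Ux)).2.
Qed.

Lemma Cn_sum (V W : normedModType R) n (U : set V) (I : Type) (r : seq I)
    (P : pred I) (f : I -> V -> W) :
  open U -> (forall i, Cn n U (f i)) -> Cn n U (fun x => \sum_(i <- r | P i) f i x).
Proof.
move=> oU h; elim: r => [|i r IH].
  apply: (@Cn_eq V W n U (fun=> 0)) => [//|x _|]; last exact: Cn_cst.
  by rewrite big_nil.
case Pi : (P i).
  by apply: (Cn_eq oU _ (CnD oU (h i) IH)) => x _; rewrite big_cons Pi.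
by apply: (Cn_eq oU _ IH) => x _; rewrite big_cons Pi.
Qed.

Lemma derive_comp (V W Z : normedModType R) (f : V -> W) (g : W -> Z) x v :
  differentiable f x -> differentiable g (f x) ->
  'D_v (g \o f) x = 'D_('D_v f x) g (f x).
Proof.
move=> df dg; rewrite deriveE; last exact: differentiable_comp.
by rewrite diff_comp //= -!deriveE.
Qed.

(** In the chain rule the direction ['D_v f x] moves with x, so it is expanded in a basis: a
    derivative of [g \o f] becomes a sum of coordinates of ['D_v f] times maps ['D_(e i) g \o f], to
    which the induction hypothesis applies. *)
Lemma Cn_comp (V W Z : normedModType R) n (U : set V) (O : set W)
    (f : V -> W) (g : W -> Z) : fin_basis W ->
  open U -> open O -> (forall x, U x -> O (f x)) ->
  Cn n U f -> Cn n O g -> Cn n U (g \o f).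
Proof.
move=> [[I [e [l [cl el]]]]] oU oO UO; elim: n g => [|n IH] g.
  move=> /Cn0 h /Cn0 k; apply/Cn0 => x Ux; apply: differentiable_comp; [exact: h|].
  by apply: k; exact: UO.
move=> cf cg; have [h1 h2] := (CnS _ _ _).1 cf; have [k1 k2] := (CnS _ _ _).1 cg.
apply/CnS; split => [x Ux|v].
  by apply: differentiable_comp; [exact: h1|apply: k1; exact: UO].
have C : Cn n U (fun x => \sum_i l i ('D_v f x) *: (('D_(e i) g) \o f) x).
  apply: Cn_sum => // i; apply: (CnZ oU); last by apply: IH; [exact: CnW|exact: k2].
  exact: (Cn_lin oU (cl i) (h2 v)).
apply: (Cn_eq oU _ C) => x Ux /=.
have dg : differentiable g (f x) by apply: k1; exact: UO.
rewrite derive_comp //; last exact: h1.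
rewrite [RHS]deriveE // [X in _ = 'd _ _ X]el linear_sum; apply: eq_bigr => i _.
by rewrite [RHS]linearZ /= -deriveE.
Qed.

(** The germ form of [smooth_on], one neighbourhood serving all orders. Charts are compared near a
    point, so most later statements use this form. *)
Definition smooth_at (V W : normedModType R) (f : V -> W) (x : V) : Prop :=
  \forall y \near x, forall vs, differentiable (Dseq f vs) y.

Lemma smooth_atP (V W : normedModType R) (f : V -> W) x :
  smooth_at f x <-> exists2 U, open_nbhs x U & smooth_on U f.
Proof.
split=> [|[U [oU Ux] sU]].
  rewrite /smooth_at -near_simpl nbhsE => -[U oU h]; exists U => // vs y Uy.
  exact: (h y Uy vs).
by apply: filterS (open_nbhs_nbhs (conj oU Ux)) => y Uy vs; exact: sU.
Qed.

Lemma smooth_onP (V W : normedModType R) (U : set V) (f : V -> W) :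
  open U -> (smooth_on U f <-> forall x, U x -> smooth_at f x).
Proof.
move=> oU; split=> [h x Ux|h vs x Ux]; first by apply/smooth_atP; exists U.
by have := nbhs_singleton (h x Ux); exact.
Qed.

Lemma smooth_atC (V W : normedModType R) (f : V -> W) x :
  smooth_at f x <-> exists2 U, open_nbhs x U & forall n, Cn n U f.
Proof.
by split=> [/smooth_atP|] [U ? h]; [|apply/smooth_atP]; exists U => //; apply/smooth_onC.
Qed.

Lemma smooth_at_diff (V W : normedModType R) (f : V -> W) x :
  smooth_at f x -> differentiable f x.
Proof. by move=> /nbhs_singleton /(_ [::]). Qed.

Lemma smooth_at_cont (V W : normedModType R) (f : V -> W) x :
  smooth_at f x -> {for x, continuous f}.
Proof. by move=> /smooth_at_diff; exact: differentiable_continuous. Qed.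

Lemma smooth_at_near (V W : normedModType R) (f : V -> W) x :
  smooth_at f x -> \forall y \near x, smooth_at f y.
Proof.
move=> /smooth_atP[U oU sU]; apply: filterS (open_nbhs_nbhs oU) => y Uy.
by apply/smooth_atP; exists U => //; split => //; case: oU.
Qed.

Lemma smooth_at_eq (V W : normedModType R) (f g : V -> W) x :
  (\near x, f x = g x) -> smooth_at f x -> smooth_at g x.
Proof.
rewrite -near_simpl nbhsE => -[Q [oO Ox] fg] /smooth_atC[U [oU Ux] h].
apply/smooth_atC; exists (U `&` Q); first by split; [exact: openI|].
move=> n; apply: (@Cn_eq V W n _ f) => [|y [_ Oy]|]; [exact: openI|exact: fg|].
by move=> vs y sv [Uy _]; apply: h sv _.
Qed.

Lemma smooth_at_derive (V W : normedModType R) (f : V -> W) x v :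
  smooth_at f x -> smooth_at ('D_v f) x.
Proof.
move=> h; rewrite /smooth_at; near=> y => vs.
by have := near h y _ (rcons vs v); rewrite /Dseq foldr_rcons; apply.
Unshelve. all: by end_near. Qed.

Lemma smooth_at_cst (V W : normedModType R) (a : W) (x : V) :
  smooth_at (fun=> a) x.
Proof.
apply/smooth_atC; exists setT; first by split; [exact: openT|].
by move=> n; apply: Cn_cst; exact: openT.
Qed.

Lemma smooth_at_linear (V W Z : normedModType R) (L : {linear W -> Z})
    (f : V -> W) x :
  continuous L -> smooth_at f x -> smooth_at (fun y => L (f y)) x.
Proof.
move=> cL /smooth_atC[U [oU Ux] h]; apply/smooth_atC; exists U => // n.
exact: Cn_lin.
Qed.

Lemma smooth_atD (V W : normedModType R) (f g : V -> W) x :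
  smooth_at f x -> smooth_at g x -> smooth_at (fun y => f y + g y) x.
Proof.
move=> /smooth_atC[U [oU Ux] h] /smooth_atC[Q [oO Ox] k].
have oI : open (U `&` Q) by exact: openI.
apply/smooth_atC; exists (U `&` Q) => // n; apply: CnD => //.
  by move=> vs y sv [Uy _]; apply: h sv _.
by move=> vs y sv [_ Oy]; apply: k sv _.
Qed.

Lemma smooth_atZ (V W : normedModType R) (k : V -> R) (g : V -> W) x :
  smooth_at k x -> smooth_at g x -> smooth_at (fun y => k y *: g y) x.
Proof.
move=> /smooth_atC[U [oU Ux] h] /smooth_atC[Q [oO Ox] l].
have oI : open (U `&` Q) by exact: openI.
apply/smooth_atC; exists (U `&` Q) => // n; apply: CnZ => //.
  by move=> vs y sv [Uy _]; apply: h sv _.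
by move=> vs y sv [_ Oy]; apply: l sv _.
Qed.

Lemma smooth_at_scale (V W : normedModType R) (k : R) (g : V -> W) x :
  smooth_at g x -> smooth_at (fun y => k *: g y) x.
Proof. by apply: smooth_atZ; exact: smooth_at_cst. Qed.

Lemma smooth_atN (V W : normedModType R) (g : V -> W) x :
  smooth_at g x -> smooth_at (fun y => - g y) x.
Proof.
move=> /(smooth_at_scale (-1)); apply: smooth_at_eq.
by apply: nearW => y; rewrite scaleN1r.
Qed.

Lemma smooth_atB (V W : normedModType R) (f g : V -> W) x :
  smooth_at f x -> smooth_at g x -> smooth_at (fun y => f y - g y) x.
Proof. by move=> h /smooth_atN; exact: smooth_atD. Qed.

Lemma smooth_at_sum (V W : normedModType R) (I : Type) (r : seq I)
    (P : pred I) (f : I -> V -> W) x :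
  (forall i, P i -> smooth_at (f i) x) ->
  smooth_at (fun y => \sum_(i <- r | P i) f i y) x.
Proof.
move=> h; elim: r => [|i r IH].
  apply: smooth_at_eq (smooth_at_cst (0 : W) x).
  by apply: nearW => y; rewrite big_nil.
case Pi : (P i).
  apply: smooth_at_eq (smooth_atD (h i Pi) IH).
  by apply: nearW => y; rewrite big_cons Pi.
by apply: smooth_at_eq IH; apply: nearW => y; rewrite big_cons Pi.
Qed.

Lemma smooth_atM (V : normedModType R) (f g : V -> R) x :
  smooth_at f x -> smooth_at g x -> smooth_at (fun y => f y * g y) x.
Proof. exact: smooth_atZ. Qed.

Lemma smooth_at_prod (V : normedModType R) (I : Type) (r : seq I)
    (P : pred I) (f : I -> V -> R) x :
  (forall i, P i -> smooth_at (f i) x) ->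
  smooth_at (fun y => \prod_(i <- r | P i) f i y) x.
Proof.
move=> h; elim: r => [|i r IH].
  apply: smooth_at_eq (smooth_at_cst (1 : R) x).
  by apply: nearW => y; rewrite big_nil.
case Pi : (P i).
  apply: smooth_at_eq (smooth_atM (h i Pi) IH).
  by apply: nearW => y; rewrite big_cons Pi.
by apply: smooth_at_eq IH; apply: nearW => y; rewrite big_cons Pi.
Qed.

Lemma smooth_at_comp (V W Z : normedModType R) {bW : fin_basis W}
    (f : V -> W) (g : W -> Z) x :
  smooth_at f x -> smooth_at g (f x) -> smooth_at (fun y => g (f y)) x.
Proof.
move=> sf /smooth_atC[Q oO k]; have cf := smooth_at_cont sf.
have [W' [oW' W'x] WO] : exists2 W', open_nbhs x W' & W' `<=` f @^-1` Q.
  by have := cf _ (open_nbhs_nbhs oO); rewrite nbhsE => -[W' ? ?]; exists W'.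
have /smooth_atC[U [oU Ux] h] := sf.
have oI : open (U `&` W') by exact: openI.
apply/smooth_atC; exists (U `&` W') => // n.
apply: (@Cn_comp V W Z n _ Q f g) => //; first by case: oO.
  by move=> y [_ Wy]; exact: WO.
by move=> vs y sv [Uy _]; apply: h sv _.
Qed.

Lemma smooth_at_id (V : normedModType R) (x : V) : smooth_at (fun y => y) x.
Proof.
apply: (@smooth_at_eq V V (fun y => (\0 : {linear V -> V}) y + y)).
  by apply: nearW => y; rewrite add0r.
rewrite /smooth_at; apply: nearW => y; case/lastP => [|vs v] /=.
  by apply: differentiableD; [exact: (@differentiable_cst _ V V 0)|exact: ex_diff].
rewrite /Dseq foldr_rcons.
have -> : 'D_v (fun y : V => (\0 : {linear V -> V}) y + y) = fun=> v.
  apply/funext => z; rewrite (_ : (fun y => _) = id) ?derive_id //.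
  by apply/funext => u; rewrite /= add0r.
exact: (nbhs_singleton (smooth_at_cst v y)).
Qed.

End Smooth.

(** * Calculus in finite dimension: bilinear maps, matrices, inverses *)

Section FinDim.
Context {R : realType}.

Lemma fin_basis_continuous (W Z : normedModType R) {bW : fin_basis W}
    (L : {linear W -> Z}) : continuous L.
Proof.
case: bW => [[I [e [l [cl el]]]]].
have -> : (L : W -> Z) = fun w => \sum_i l i w *: L (e i).
  by apply/funext => w; rewrite [w in LHS]el linear_sum; apply: eq_bigr => i _; rewrite linearZ.
move=> w; apply: cvg_big => [|i _]; first exact: add_continuous.
by apply: cvgZ; [exact: cl|exact: cvg_cst].
Qed.

Lemma smooth_at_lin (V W Z : normedModType R) {bW : fin_basis W}
    (L : W -> Z) (f : V -> W) x :
  linear L -> smooth_at f x -> smooth_at (fun y => L (f y)) x.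
Proof.
move=> lL; pose K : {linear W -> Z} := HB.pack L (GRing.isLinear.Build _ _ _ _ _ lL).
by apply: (@smooth_at_linear R V W Z K); exact: fin_basis_continuous.
Qed.

Lemma derive_lin (V W Z : normedModType R) {bW : fin_basis W}
    (L : W -> Z) (f : V -> W) x v :
  linear L -> differentiable f x -> 'D_v (fun y => L (f y)) x = L ('D_v f x).
Proof.
move=> lL; pose K : {linear W -> Z} := HB.pack L (GRing.isLinear.Build _ _ _ _ _ lL).
by apply: (@derive_lin_comp R V W Z f K); exact: fin_basis_continuous.
Qed.

Lemma derive_fD (V W : normedModType R) (f g : V -> W) x v :
  differentiable f x -> differentiable g x ->
  'D_v (fun y => f y + g y) x = 'D_v f x + 'D_v g x.
Proof. by move=> df dg; apply: (@deriveD _ _ _ f g); exact: diff_derivable. Qed.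

Lemma derive_fB (V W : normedModType R) (f g : V -> W) x v :
  differentiable f x -> differentiable g x ->
  'D_v (fun y => f y - g y) x = 'D_v f x - 'D_v g x.
Proof. by move=> df dg; apply: (@deriveB _ _ _ f g); exact: diff_derivable. Qed.

Lemma derive_fZ (V W : normedModType R) (a : R) (f : V -> W) x v :
  differentiable f x -> 'D_v (fun y => a *: f y) x = a *: 'D_v f x.
Proof. by move=> df; apply: (@deriveZ _ _ _ f); exact: diff_derivable. Qed.

Lemma derive_self (W Z : normedModType R) {bW : fin_basis W} (L : W -> Z) x v :
  linear L -> 'D_v L x = L v.
Proof.
move=> lL; have := @derive_lin W W Z bW L id x v lL.
by rewrite derive_id; apply; exact: ex_diff.
Qed.

Lemma derive_dirP (V W : normedModType R) (f : V -> W) x a u v :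
  differentiable f x -> 'D_(a *: u + v) f x = a *: 'D_u f x + 'D_v f x.
Proof. by move=> df; rewrite !deriveE // linearP. Qed.

Lemma derive_dir_linear (V W : normedModType R) (f : V -> W) x :
  differentiable f x -> linear (fun v => 'D_v f x).
Proof. by move=> df a u v; exact: derive_dirP. Qed.

Lemma derive_dirD (V W : normedModType R) (f : V -> W) x u v :
  differentiable f x -> 'D_(u + v) f x = 'D_u f x + 'D_v f x.
Proof. by move=> df; rewrite !deriveE // linearD. Qed.

Lemma derive_dirZ (V W : normedModType R) (f : V -> W) x a u :
  differentiable f x -> 'D_(a *: u) f x = a *: 'D_u f x.
Proof. by move=> df; rewrite !deriveE // linearZ. Qed.

Lemma derive_dirN (V W : normedModType R) (f : V -> W) x u :
  differentiable f x -> 'D_(- u) f x = - 'D_u f x.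
Proof. by move=> df; rewrite !deriveE // linearN. Qed.

(** In a basis ['D_(X y) f y] is a sum of products. The product rule separates the derivatives of
    the coefficients from those of the functions, and the latter add up to the derivative of
    ['D_(X x) f], with the direction frozen at x. *)
Lemma smooth_at_derive_dir (V W : normedModType R) {bV : fin_basis V}
    (f : V -> W) (X : V -> V) x :
  smooth_at f x -> smooth_at X x ->
  smooth_at (fun y => 'D_(X y) f y) x /\
  forall v, 'D_v (fun y => 'D_(X y) f y) x =
            'D_v ('D_(X x) f) x + 'D_('D_v X x) f x.
Proof.
move=> sf sX; case: bV (bV) => [[I [e [l [cl el]]]]] bV.
have sl i : smooth_at (fun y => l i (X y)) x by apply: smooth_at_linear.
have sd i := smooth_at_derive (e i) sf.
have E : \forall y \near x,
    \sum_i l i (X y) *: 'D_(e i) f y = 'D_(X y) f y.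
  apply: filterS (smooth_at_near sf) => y /smooth_at_diff dy.
  rewrite [RHS]deriveE // [X in 'd _ _ X]el linear_sum; apply: eq_bigr => i _.
  by rewrite linearZ /= deriveE.
split=> [|v].
  by apply: smooth_at_eq E _; apply: smooth_at_sum => i _; apply: smooth_atZ.
rewrite -(near_eq_derive v E).
have dt i : differentiable (fun y => l i (X y) *: 'D_(e i) f y) x.
  by apply: smooth_at_diff; apply: smooth_atZ.
have -> : (fun y => \sum_i l i (X y) *: 'D_(e i) f y) =
   \sum_i (fun y => l i (X y) *: 'D_(e i) f y) by apply/funext => y; rewrite fct_sumE.
have D (r : seq I) : differentiable (\sum_(i <- r) (fun y => l i (X y) *: 'D_(e i) f y)) x
   /\ 'D_v (\sum_(i <- r) (fun y => l i (X y) *: 'D_(e i) f y)) x =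
   \sum_(i <- r) 'D_v (fun y => l i (X y) *: 'D_(e i) f y) x.
  elim: r => [|i r [IH1 IH2]].
    rewrite !big_nil; split; last by rewrite (derive_cst (0 : W)).
    exact: (differentiable_cst (0 : W)).
  rewrite !big_cons; split; first exact: differentiableD.
  by rewrite deriveD ?IH2 //; exact: diff_derivable.
rewrite (D _).2.
have df := smooth_at_diff sf; have dX := smooth_at_diff sX.
transitivity (\sum_i (l i ('D_v X x) *: 'D_(e i) f x + l i (X x) *: 'D_v ('D_(e i) f) x)).
  apply: eq_bigr => i _.
  rewrite (diffZ_fun (smooth_at_diff (sl i)) (smooth_at_diff (sd i))).2.
  by rewrite -(derive_lin_comp v (cl i) dX).
rewrite big_split /= addrC; congr (_ + _); last first.
  rewrite [RHS]deriveE // [X in _ = 'd _ _ X]el linear_sum; apply: eq_bigr => i _.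
  by rewrite [RHS]linearZ /= -deriveE.
have E2 : \forall y \near x, \sum_i l i (X x) *: 'D_(e i) f y = 'D_(X x) f y.
  apply: filterS (smooth_at_near sf) => y /smooth_at_diff dy.
  rewrite [RHS]deriveE // [X in 'd _ _ X]el linear_sum; apply: eq_bigr => i _.
  by rewrite linearZ /= deriveE.
rewrite -(near_eq_derive v E2).
have -> : (fun y => \sum_i l i (X x) *: 'D_(e i) f y) =
   \sum_i (fun y => l i (X x) *: 'D_(e i) f y) by apply/funext => y; rewrite fct_sumE.
have D2 (r : seq I) : differentiable (\sum_(i <- r) (fun y => l i (X x) *: 'D_(e i) f y)) x
   /\ 'D_v (\sum_(i <- r) (fun y => l i (X x) *: 'D_(e i) f y)) x =
   \sum_(i <- r) l i (X x) *: 'D_v ('D_(e i) f) x.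
  elim: r => [|i r [IH1 IH2]].
    rewrite !big_nil; split; last by rewrite (derive_cst (0 : W)).
    exact: (differentiable_cst (0 : W)).
  have di : differentiable (fun y => l i (X x) *: 'D_(e i) f y) x.
    by apply: smooth_at_diff; apply: smooth_at_scale.
  rewrite !big_cons; split; first exact: differentiableD.
  rewrite deriveD ?IH2 //; try exact: diff_derivable.
  by congr (_ + _); apply: deriveZ; apply: diff_derivable; exact: smooth_at_diff.
by rewrite (D2 _).2.
Qed.

(** Expanding only the first argument in a basis leaves sums of a scalar function times a vector
    function, the case of [diffZ_fun]. *)
Lemma bilin_fin (U W Z : normedModType R) {bU : fin_basis U} {bW : fin_basis W}
    (V : normedModType R) (B : U -> W -> Z) (f : V -> U) (g : V -> W) x :
  (forall w, linear (B^~ w)) -> (forall u, linear (B u)) ->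
  differentiable f x -> differentiable g x ->
  differentiable (fun y => B (f y) (g y)) x /\
  forall v, 'D_v (fun y => B (f y) (g y)) x = B ('D_v f x) (g x) + B (f x) ('D_v g x).
Proof.
move=> lB1 lB2 df dg; case: (bU) => [[I [e [l [cl el]]]]].
pose LB w : {linear U -> Z} := HB.pack (B^~ w) (GRing.isLinear.Build _ _ _ _ _ (lB1 w)).
pose LC u : {linear W -> Z} := HB.pack (B u) (GRing.isLinear.Build _ _ _ _ _ (lB2 u)).
have Be u w : B u w = \sum_i l i u *: B (e i) w.
  rewrite -[LHS]/(LB w u) [u in LHS]el linear_sum; apply: eq_bigr => i _.
  by rewrite linearZ.
have -> : (fun y => B (f y) (g y)) = \sum_i (fun y => l i (f y) *: B (e i) (g y)).
  by apply/funext => y; rewrite fct_sumE Be.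
have dl i : differentiable (fun y => l i (f y)) x.
  apply: differentiable_comp => //; apply: linear_differentiable; exact: cl.
have dB i : differentiable (fun y => B (e i) (g y)) x.
  apply: (@differentiable_comp _ _ _ _ g (LC (e i))) => //.
  apply: linear_differentiable; exact: fin_basis_continuous.
have D v (r : seq I) : differentiable (\sum_(i <- r) (fun y => l i (f y) *: B (e i) (g y))) x
   /\ 'D_v (\sum_(i <- r) (fun y => l i (f y) *: B (e i) (g y))) x =
   \sum_(i <- r) (l i ('D_v f x) *: B (e i) (g x) + l i (f x) *: B (e i) ('D_v g x)).
  elim: r => [|i r [IH1 IH2]].
    rewrite !big_nil; split; last by rewrite (derive_cst (0 : Z)).
    exact: (differentiable_cst (0 : Z)).
  have di := diffZ_fun (dl i) (dB i).
  rewrite !big_cons; split; first by apply: differentiableD => //; exact: di.1.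
  rewrite deriveD ?IH2; try exact: diff_derivable; last by apply: diff_derivable; exact: di.1.
  rewrite di.2 (derive_lin_comp v (cl i) df) /=.
  by rewrite (derive_lin v (lB2 (e i)) dg).
split=> [|v]; first exact: (D 0 _).1.
by rewrite (D v _).2 big_split /= -!Be.
Qed.

Lemma smooth_at_bilin (U W Z : normedModType R) {bU : fin_basis U} {bW : fin_basis W}
    (V : normedModType R) (B : U -> W -> Z) (f : V -> U) (g : V -> W) x :
  (forall w, linear (B^~ w)) -> (forall u, linear (B u)) ->
  smooth_at f x -> smooth_at g x -> smooth_at (fun y => B (f y) (g y)) x.
Proof.
move=> lB1 lB2 sf sg; case: (bU) => [[I [e [l [cl el]]]]].
pose LB w : {linear U -> Z} := HB.pack (B^~ w) (GRing.isLinear.Build _ _ _ _ _ (lB1 w)).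
apply: (@smooth_at_eq _ _ _ (fun y => \sum_i l i (f y) *: B (e i) (g y))).
  apply: nearW => y.
  rewrite -[RHS]/(LB (g y) (f y)) [f y in RHS]el linear_sum; apply: eq_bigr => i _.
  by rewrite linearZ.
apply: smooth_at_sum => i _; apply: smooth_atZ; first exact: smooth_at_linear.
exact: smooth_at_lin.
Qed.

Lemma mulmx_linear1 m n q (B : 'M[R]_(n, q)) : linear (fun A : 'M[R]_(m, n) => A *m B).
Proof. by move=> a u v; rewrite mulmxDl scalemxAl. Qed.

Lemma mulmx_linear2 m n q (A : 'M[R]_(m, n)) : linear (fun B : 'M[R]_(n, q) => A *m B).
Proof. by move=> a u v; rewrite mulmxDr scalemxAr. Qed.

Lemma smooth_at_mulmx (V : normedModType R) m n q (f : V -> 'M[R]_(m, n))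
    (g : V -> 'M[R]_(n, q)) x :
  smooth_at f x -> smooth_at g x -> smooth_at (fun y => f y *m g y) x.
Proof.
apply: (@smooth_at_bilin _ _ _ _ _ V (fun A B => A *m B)).
  exact: mulmx_linear1.
exact: mulmx_linear2.
Qed.

Lemma derive_mulmx (V : normedModType R) m n q (f : V -> 'M[R]_(m, n))
    (g : V -> 'M[R]_(n, q)) x v :
  differentiable f x -> differentiable g x ->
  'D_v (fun y => f y *m g y) x = 'D_v f x *m g x + f x *m 'D_v g x.
Proof.
move=> df dg.
have [|||| _ ->] // := @bilin_fin _ _ _ (fin_basis_mx m n) (fin_basis_mx n q)
  V (fun A B => A *m B) f g x.
  exact: mulmx_linear1.
exact: mulmx_linear2.
Qed.

Lemma smooth_at_pair (V W Z : normedModType R) {bW : fin_basis W} {bZ : fin_basis Z}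
    (f : V -> W) (g : V -> Z) x :
  smooth_at f x -> smooth_at g x -> smooth_at (fun y => (f y, g y)) x.
Proof.
move=> sf sg.
have l1 : linear (fun w : W => (w, 0 : Z)).
  move=> a u v; rewrite -[RHS]/((a *: u + v, a *: 0 + 0) : W * Z).
  by rewrite scaler0 addr0.
have l2 : linear (fun w : Z => (0 : W, w)).
  move=> a u v; rewrite -[RHS]/((a *: 0 + 0, a *: u + v) : W * Z).
  by rewrite scaler0 addr0.
apply: smooth_at_eq (smooth_atD (smooth_at_lin l1 sf) (smooth_at_lin l2 sg)).
by apply: nearW => y; rewrite -[LHS]/((f y + 0, 0 + g y) : W * Z) addr0 add0r.
Qed.

Lemma fst_linear (W Z : normedModType R) : linear (fst : W * Z -> W).
Proof. by move=> a u v. Qed.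
Lemma snd_linear (W Z : normedModType R) : linear (snd : W * Z -> Z).
Proof. by move=> a u v. Qed.

Lemma derive_pair (V W Z : normedModType R) (f : V -> W) (g : V -> Z) x v :
  differentiable f x -> differentiable g x ->
  'D_v (fun y => (f y, g y)) x = ('D_v f x, 'D_v g x).
Proof.
move=> df dg; rewrite deriveE; last exact: differentiable_pair.
by rewrite diff_pair //= -!deriveE.
Qed.

Lemma rsubmx_linear m n q : linear (rsubmx : 'M[R]_(m, n + q) -> 'M[R]_(m, q)).
Proof. by move=> a u v; rewrite linearP. Qed.

Lemma entry_linear m n i j : linear (fun A : 'M[R]_(m, n) => A i j : R).
Proof. by move=> a u v; rewrite !mxE. Qed.

Lemma row_mx0_linear m n q : linear (fun B : 'M[R]_(m, q) => row_mx (0 : 'M[R]_(m, n)) B).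
Proof. by move=> a u v; rewrite scale_row_mx add_row_mx scaler0 addr0. Qed.

Lemma smooth_at_mx (V : normedModType R) m n (f : V -> 'M[R]_(m, n)) x :
  (forall i j, smooth_at (fun y => f y i j : R) x) -> smooth_at f x.
Proof.
move=> h; apply: (@smooth_at_eq _ _ _ (fun y => \sum_i \sum_j f y i j *: delta_mx i j)).
  by apply: nearW => y; rewrite -matrix_sum_delta.
apply: smooth_at_sum => i _; apply: smooth_at_sum => j _; apply: smooth_atZ => //.
exact: smooth_at_cst.
Qed.

Lemma smooth_at_entry (V : normedModType R) m n (f : V -> 'M[R]_(m, n)) x i j :
  smooth_at f x -> smooth_at (fun y => f y i j : R) x.
Proof. by apply: (@smooth_at_lin _ _ _ _ (fun A : 'M[R]_(m, n) => A i j : R)); exact: entry_linear. Qed.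

Lemma derive_entry (V : normedModType R) m n (f : V -> 'M[R]_(m, n)) x v i j :
  differentiable f x -> 'D_v (fun y => f y i j : R) x = 'D_v f x i j.
Proof. by apply: (@derive_lin _ _ _ _ (fun A : 'M[R]_(m, n) => A i j : R)); exact: entry_linear. Qed.

Lemma smooth_at_Rinv (a : R) : a != 0 -> smooth_at (fun x : R => x^-1) a.
Proof.
move=> a0; pose U : set R := [set x | x != 0].
have oU : open U by exact: open_neq.
apply/smooth_atC; exists U => // n; elim: n => [|n IH].
  by apply/Cn0 => x /eqP x0; apply: differentiable_Rinv; apply/eqP.
apply/CnS; split => [x /eqP x0|v]; first by apply: differentiable_Rinv; apply/eqP.
(* The derivative of the inverse is a polynomial in the inverse, so the induction on the order
   closes. *)
apply: (@Cn_eq _ _ _ n U (fun x => (- v) *: (x^-1 *: x^-1))) => //; last first.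
  by apply: CnZ => //; [exact: Cn_cst|exact: CnZ].
move=> x /= x0; rewrite deriveE ?diff_Rinv //; last exact: differentiable_Rinv.
by rewrite /= -[LHS]/(- v * (x^-1 * x^-1)) -[RHS]/(- x ^- 2 * v) expr2 invfM !mulNr mulrC.
Qed.

Lemma smooth_atV (V : normedModType R) (f : V -> R) x :
  smooth_at f x -> f x != 0 -> smooth_at (fun y => (f y)^-1) x.
Proof. by move=> sf fx; apply: smooth_at_comp sf _; exact: smooth_at_Rinv. Qed.

Lemma smooth_at_det (V : normedModType R) n (f : V -> 'M[R]_n) x :
  smooth_at f x -> smooth_at (fun y => \det (f y)) x.
Proof.
move=> sf; apply: smooth_at_sum => s _; apply: smooth_atM; first exact: smooth_at_cst.
by apply: smooth_at_prod => i _; exact: smooth_at_entry.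
Qed.

Lemma near_unitmx (V : topologicalType) n (f : V -> 'M[R]_n) x :
  {for x, continuous f} -> f x \in unitmx -> \forall y \near x, f y \in unitmx.
Proof.
move=> cf ux.
have cd : {for x, continuous (fun y => \det (f y))}.
  apply: continuous_comp => //.
  apply: smooth_at_cont; apply: smooth_at_det; exact: smooth_at_id.
have : \forall y \near x, \det (f y) != 0.
  have d0 : \det (f x) != 0 by rewrite -unitfE -unitmxE.
  exact: (cd _ (open_nbhs_nbhs (conj (open_neq (y := 0)) d0))).
by apply: filterS => y dy; rewrite unitmxE unitfE.
Qed.

Lemma smooth_at_invmx (V : normedModType R) n (f : V -> 'M[R]_n) x :
  smooth_at f x -> f x \in unitmx -> smooth_at (fun y => invmx (f y)) x.
Proof.
move=> sf ux.
apply: (@smooth_at_eq _ _ _ (fun y => (\det (f y))^-1 *: \adj (f y))).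
  by apply: filterS (near_unitmx (smooth_at_cont sf) ux) => y uy; rewrite /invmx uy.
apply: smooth_atZ.
  apply: smooth_atV; first exact: smooth_at_det.
  by rewrite -unitfE -unitmxE.
apply: smooth_at_mx => i j.
apply: (@smooth_at_eq _ _ _ (fun y => (-1) ^+ (j + i) * \det (row' j (col' i (f y))))).
  by apply: nearW => y; rewrite mxE.
apply: smooth_atM; first exact: smooth_at_cst.
apply: smooth_at_det; apply: smooth_at_mx => a b.
apply: smooth_at_eq (smooth_at_entry (lift j a) (lift i b) sf).
by apply: nearW => y; rewrite !mxE.
Qed.

(** Differentiate the product of the inverse with [f], which is constant near x because
    invertibility is an open condition. *)
Lemma derive_invmx (V : normedModType R) n (f : V -> 'M[R]_n) x v :
  smooth_at f x -> f x \in unitmx ->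
  'D_v (fun y => invmx (f y)) x = - (invmx (f x) *m 'D_v f x *m invmx (f x)).
Proof.
move=> sf ux; have si := smooth_at_invmx sf ux.
have E : \forall y \near x, invmx (f y) *m f y = 1%:M.
  by apply: filterS (near_unitmx (smooth_at_cont sf) ux) => y; exact: mulVmx.
have := near_eq_derive v E.
rewrite derive_cst derive_mulmx; [|exact: smooth_at_diff..].
move=> /eqP; rewrite addr_eq0 => /eqP /(congr1 (mulmx^~ (invmx (f x)))).
by rewrite mulmxK // mulNmx.
Qed.

End FinDim.

(** * Symmetry of second derivatives and the bracket of fields *)

Section Schwarz.
Context {R : realType}.

Lemma smooth_at_line (V W : normedModType R) (f : V -> W) (y u : V) (s : R) :
  differentiable f (y + s *: u) ->
  is_derive s 1 (fun t : R => f (y + t *: u)) ('D_u f (y + s *: u)).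
Proof.
move=> df.
have dl : differentiable (fun t : R => y + t *: u) s.
  by apply: differentiableD; [exact: differentiable_cst|exact: ex_diff].
have e : 'D_1 (fun t : R => y + t *: u) s = u.
  rewrite (@derive_fD _ _ _ (fun=> y) (fun t : R => t *: u)); [|exact: differentiable_cst|exact: ex_diff].
  by rewrite derive_cst add0r deriveE ?diff_val ?scale1r //; exact: ex_diff.
split; first by apply: diff_derivable; apply: (differentiable_comp dl).
by rewrite (derive_comp (1 : R) dl df) e.
Qed.

Lemma MVT_line (V : normedModType R) (f : V -> R) (y u : V) (h : R) :
  0 < h -> (forall s, 0 <= s <= h -> differentiable f (y + s *: u)) ->
  exists2 s, 0 <= s <= h & f (y + h *: u) - f y = h * 'D_u f (y + s *: u).
Proof.
move=> h0 df; pose g (t : R) := f (y + t *: u).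
have dg s : 0 <= s <= h -> is_derive s 1 g ('D_u f (y + s *: u)).
  by move=> /df; exact: smooth_at_line.
have [||s + E] := @MVT _ g (fun s => 'D_u f (y + s *: u)) 0 h h0.
- by move=> s; rewrite in_itv /= => /andP[a b]; apply: dg; rewrite !ltW.
- apply: derivable_within_continuous => s; rewrite in_itv /= => sI.
  by have [] := dg s sI.
rewrite in_itv /= => /andP[a b]; exists s; first by rewrite !ltW.
by move: E; rewrite /g scale0r addr0 subr0 mulrC.
Qed.

Lemma derive_translate (V W : normedModType R) (f : V -> W) (a x u : V) :
  differentiable f (x + a) ->
  differentiable (fun y => f (y + a)) x /\
  'D_u (fun y => f (y + a)) x = 'D_u f (x + a).
Proof.
move=> df; have dt : differentiable (fun y => y + a) x.
  by apply: differentiableD; [exact: ex_diff|exact: differentiable_cst].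
split; first exact: (differentiable_comp dt df).
rewrite (derive_comp u dt df) (@derive_fD _ _ _ (fun y => y) (fun=> a)) //.
by rewrite derive_id derive_cst addr0.
Qed.

(** Mean value theorem twice: along u for the increment g of f in direction v, then along v for
    ['D_u f]. The second difference is symmetric in u and v, which is what [derive_swap_real]
    exploits. *)
Lemma second_difference (V : normedModType R) (f : V -> R) (x u v : V) (h : R) :
  0 < h ->
  (forall s t, 0 <= s <= h -> 0 <= t <= h ->
     smooth_at f (x + s *: u + t *: v)) ->
  exists s t, [/\ 0 <= s <= h, 0 <= t <= h &
    f (x + h *: u + h *: v) - f (x + h *: u) - (f (x + h *: v) - f x) =
    h * (h * 'D_v ('D_u f) (x + s *: u + t *: v))].
Proof.
move=> h0 sf; have hh : 0 <= h <= h by rewrite lexx ltW.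
have oh : 0 <= (0 : R) <= h by rewrite lexx ltW.
pose g (y : V) := f (y + h *: v) - f y.
have dh s : 0 <= s <= h -> differentiable f (x + s *: u + h *: v).
  by move=> sI; apply: smooth_at_diff; exact: sf.
have d0 s : 0 <= s <= h -> differentiable f (x + s *: u).
  by move=> sI; apply: smooth_at_diff; have := sf s 0 sI oh; rewrite scale0r addr0.
have [|s sI E] := @MVT_line V g x u h h0.
  by move=> s sI; apply: differentiableB; [exact: (derive_translate u (dh s sI)).1|exact: d0].
have [|t tI E2] := @MVT_line V ('D_u f) (x + s *: u) v h h0.
  by move=> t tI; apply: smooth_at_diff; apply: smooth_at_derive; exact: sf.
exists s, t; split=> //.
rewrite -E2 -/(g (x + h *: u)) -/(g x) E; congr (_ * _).
have [d1 e1] := derive_translate u (dh s sI).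
by rewrite derive_fB ?e1 //; exact: d0.
Qed.

Lemma dist_le_half (a b c e : R) :
  `|a - c| < e / 2 -> `|b - c| < e / 2 -> `|a - b| <= e.
Proof.
rewrite [`|b - c|]distrC => h1 h2; rewrite -(subrKA c).
by apply: le_trans (ler_normD _ _) _; rewrite (splitr e) lerD // ltW.
Qed.

Lemma derive_swap_real (V : normedModType R) (f : V -> R) (x u v : V) :
  smooth_at f x -> 'D_u ('D_v f) x = 'D_v ('D_u f) x.
Proof.
move=> sf.
have c1 := smooth_at_cont (smooth_at_derive u (smooth_at_derive v sf)).
have c2 := smooth_at_cont (smooth_at_derive v (smooth_at_derive u sf)).
apply/eqP; rewrite -subr_eq0 -normr_le0; apply/ler_addgt0Pl => e e0; rewrite addr0.
have e2 : 0 < e / 2 by rewrite divr_gt0.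
have : \forall y \near x, [/\ smooth_at f y,
   `|'D_u ('D_v f) x - 'D_u ('D_v f) y| < e / 2 &
   `|'D_v ('D_u f) x - 'D_v ('D_u f) y| < e / 2].
  have n1 := smooth_at_near sf.
  have n2 := (cvgrPdist_lt _ _).1 c1 _ e2.
  have n3 := (cvgrPdist_lt _ _).1 c2 _ e2.
  apply: filterS3 n1 (n2 _) (n3 _) => y a b c; exact: And3 a b c.
move=> /nbhs_ballP[d /= d0 B].
(* Small enough for the whole parallelogram with sides h u and h v to stay in the ball of radius d;
   the summand 1 keeps the denominator positive. *)
pose h := d / (`|u| + `|v| + 1).
have k0 : 0 < `|u| + `|v| + 1 by rewrite ltr_wpDl // addr_ge0.
have h0 : 0 < h by rewrite divr_gt0.
have I s t : 0 <= s <= h -> 0 <= t <= h -> ball x d (x + s *: u + t *: v).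
  move=> /andP[s0 sh] /andP[t0 th]; rewrite -ball_normE /= -addrA opprD addrA subrr sub0r normrN.
  apply: le_lt_trans (ler_normD _ _) _; rewrite !normrZ !ger0_norm //.
  apply: (@le_lt_trans _ _ (h * (`|u| + `|v|))).
    by rewrite mulrDr lerD // ler_wpM2r.
  by rewrite /h mulrAC ltr_pdivrMr // ltr_pM2l // ltrDl.
have [s [t [sI tI E]]] := second_difference h0 (fun s t sI tI => let: And3 a _ _ := B _ (I s t sI tI) in a).
have I' t' s' : 0 <= t' <= h -> 0 <= s' <= h -> ball x d (x + t' *: v + s' *: u).
  by move=> ? ?; rewrite addrAC; exact: I.
have [t' [s' [tI' sI' E']]] := second_difference h0 (fun s t sI tI => let: And3 a _ _ := B _ (I' s t sI tI) in a).
have [_ _ B1] := B _ (I s t sI tI).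
have [_ B2 _] := B _ (I' t' s' tI' sI').
(* Both sides times h^2 are the same second difference. The two points differ, but at each of them
   the mixed derivatives are within e/2 of their values at x. *)
have EE : 'D_u ('D_v f) (x + t' *: v + s' *: u) = 'D_v ('D_u f) (x + s *: u + t *: v).
  have hn : h != 0 by rewrite gt_eqF.
  have aux (a b c w : R) : a - c - (b - w) = a - b - (c - w) by ring.
  have C : x + h *: v + h *: u = x + h *: u + h *: v by rewrite addrAC.
  move: E'; rewrite C => E'; move: E E'.
  generalize ('D_u ('D_v f) (x + t' *: v + s' *: u)) ('D_v ('D_u f) (x + s *: u + t *: v)).
  move=> a b E E'; have : h * (h * a) = h * (h * b) by rewrite -E -E'; exact: aux.
  by move=> /(mulfI hn) /(mulfI hn).
rewrite EE in B2; exact: (dist_le_half B2 B1).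
Qed.

Lemma derive_swap (V W : normedModType R) {bW : fin_basis W} (f : V -> W) (x u v : V) :
  smooth_at f x -> 'D_u ('D_v f) x = 'D_v ('D_u f) x.
Proof.
move=> sf; case: (bW) => [[I [e [l [cl el]]]]].
have H w w' i : l i ('D_w ('D_w' f) x) = 'D_w ('D_w' (fun y => l i (f y))) x.
  rewrite -(derive_lin_comp w (cl i) (smooth_at_diff (smooth_at_derive w' sf))).
  apply: near_eq_derive; apply: filterS (smooth_at_near sf) => y sy.
  exact: (esym (derive_lin_comp w' (cl i) (smooth_at_diff sy))).
have K i : l i ('D_u ('D_v f) x) = l i ('D_v ('D_u f) x).
  by rewrite !H; apply: derive_swap_real; exact: smooth_at_linear.
by rewrite [LHS]el [RHS]el; apply: eq_bigr => i _; rewrite K.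
Qed.

(* Both brackets differ from the bracket of the components by second
   derivatives of the change of coordinates, which cancel by symmetry. *)
Lemma vbracket_push (V W : normedModType R) {bV : fin_basis V} {bW : fin_basis W}
    (tau : V -> W) (X Y : V -> V) (X' Y' : W -> W) x :
  smooth_at tau x -> smooth_at X x -> smooth_at Y x ->
  smooth_at X' (tau x) -> smooth_at Y' (tau x) ->
  (\forall y \near x, X' (tau y) = 'D_(X y) tau y) ->
  (\forall y \near x, Y' (tau y) = 'D_(Y y) tau y) ->
  vbracket X' Y' (tau x) = 'D_(vbracket X Y x) tau x.
Proof.
move=> st sX sY sX' sY' eX eY; rewrite /vbracket.
have dt := smooth_at_diff st.
rewrite (nbhs_singleton eX) (nbhs_singleton eY).
rewrite -(derive_comp _ dt (smooth_at_diff sY')) -(derive_comp _ dt (smooth_at_diff sX')).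
rewrite (near_eq_derive _ eY) (near_eq_derive _ eX).
rewrite (smooth_at_derive_dir st sY).2 (smooth_at_derive_dir st sX).2.
rewrite (derive_swap (Y x) (X x) st).
by rewrite derive_dirD // derive_dirN // opprD addrACA subrr add0r.
Qed.

Lemma smooth_at_vbracket (V : normedModType R) {bV : fin_basis V} (X Y : V -> V) x :
  smooth_at X x -> smooth_at Y x -> smooth_at (vbracket X Y) x.
Proof.
move=> sX sY; apply: smooth_atB.
  exact: (smooth_at_derive_dir sY sX).1.
exact: (smooth_at_derive_dir sX sY).1.
Qed.

Lemma derive0_line_eq (V W : normedModType R) {bW : fin_basis W} (f : V -> W) (y u : V) :
  (forall s : R, 0 <= s <= 1 -> differentiable f (y + s *: u) /\ 'D_u f (y + s *: u) = 0) ->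
  f (y + u) = f y.
Proof.
move=> H; case: (bW) => [[I [e [l [cl el]]]]].
rewrite [LHS]el [RHS]el; apply: eq_bigr => i _.
suff -> : l i (f (y + u)) = l i (f y) by [].
have [||s sI] := @MVT_line V (fun y => l i (f y)) y u 1 => //.
  move=> s /H[d _]; apply: differentiable_comp => //.
  by apply: linear_differentiable; exact: cl.
have [d D] := H s sI.
rewrite (derive_lin_comp u (cl i) d) D linear0 mulr0 scale1r => /eqP.
by rewrite subr_eq0 => /eqP.
Qed.

End Schwarz.

(** * Linear differential equations *)

Section LinearODE.
Context {R : realType}.

Lemma antiderivative (g : R -> R) (M : R) : 0 < M -> continuous g ->
  exists G : R -> R, G 0 = 0 /\ forall x : R, `|x| < M -> is_derive x 1 G (g x).
Proof.
move=> M0 cg; pose mu := @lebesgue_measure R.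
(* Starting the integral at [- M] puts every x of the interval to the right of the lower bound;
   subtracting [F 0] normalizes afterwards. *)
pose F x := (\int[mu]_(t in `[- M, x]) g t)%R.
have ig : mu.-integrable `[- M, M] (EFin \o g).
  apply: continuous_compact_integrable; first exact: segment_compact.
  by apply: continuous_subspaceT => x; exact: cg.
have dF (x : R) : `|x| < M -> is_derive x 1 F (g x).
  rewrite ltr_norml => /andP[x1 x2].
  have [d e] := continuous_FTC1_closed x2 ig x1 (cg x); split; first exact: d.
  by rewrite -derive1E; exact: e.
clearbody F; exists (fun x => F x - F 0); split; first by rewrite subrr.
move=> x xM; have d := (dF x xM).
have dd : differentiable F x by apply/derivable1_diffP; exact: (@ex_derive _ _ _ _ _ _ _ d).
have dc : differentiable (fun _ : R => F 0) x by exact: differentiable_cst.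
split; first by apply: diff_derivable; exact: differentiableB dd dc.
by rewrite (derive_fB (1 : R) dd dc) derive_cst subr0; exact: (@derive_val _ _ _ _ _ _ _ d).
Qed.

Lemma antiderivative_mx n (g : R -> 'M[R]_n) (M : R) : 0 < M -> continuous g ->
  exists G : R -> 'M[R]_n, G 0 = 0 /\
    forall x : R, `|x| < M -> differentiable G x /\ 'D_1 G x = g x.
Proof.
move=> M0 cg.
have ex ij : {G : R -> R | G 0 = 0 /\ forall x : R, `|x| < M -> is_derive x 1 G (g x ij.1 ij.2)}.
  apply: cid; apply: antiderivative => // x.
  exact: (continuous_comp (cg x) (@coord_continuous _ _ _ _ _ _)).
exists (fun x => \matrix_(i, j) sval (ex (i, j)) x); split.
  by apply/matrixP => i j; rewrite !mxE; case: (svalP (ex (i, j))).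
move=> x xM.
have dG : derivable (fun x => \matrix_(i, j) sval (ex (i, j)) x) x 1.
  apply/derivable_mxP => i j; have [_ /(_ x xM)[d _]] := svalP (ex (i, j)).
  by have -> : (fun y => (\matrix_(i, j) sval (ex (i, j)) y) i j) = sval (ex (i, j))
    by apply/funext => y; rewrite mxE.
split; first exact/derivable1_diffP.
rewrite derive_mx //; apply/matrixP => i j; rewrite mxE.
have [_ /(_ x xM)[_ <-]] := svalP (ex (i, j)).
by congr ('D_1 _ x); apply/funext => y; rewrite mxE.
Qed.

Lemma mx_norm_leP m n (A : 'M[R]_(m, n)) (K : R) : 0 <= K ->
  (forall i j, `|A i j| <= K) -> `|A| <= K.
Proof.
move=> K0 h; rewrite [leLHS]/Num.Def.normr /= mx_normrE.
by apply: bigmax_le => // -[i j] _; exact: h.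
Qed.

Lemma mx_norm_entry m n (A : 'M[R]_(m, n)) i j : `|A i j| <= `|A|.
Proof.
rewrite [leRHS]/Num.Def.normr /= mx_normrE.
exact: (le_bigmax _ (fun ij : 'I_m * 'I_n => `|A ij.1 ij.2|) (i, j)).
Qed.

(** The norm of a matrix is its largest entry in absolute value, and an entry of the product is a
    sum of n products, whence the dimension factor. *)
Lemma mx_norm_mul n (A B : 'M[R]_n) : `|A *m B| <= n%:R * (`|A| * `|B|).
Proof.
apply: mx_norm_leP => [|i j]; first by rewrite !mulr_ge0.
rewrite mxE; apply: le_trans (ler_norm_sum _ _ _) _.
rewrite mulr_natl -[X in _ *+ X]card_ord -sumr_const; apply: ler_sum => k _.
by rewrite normrM ler_pM // mx_norm_entry.
Qed.

Lemma differentiable_entry (V : normedModType R) m n (f : V -> 'M[R]_(m, n)) x i j :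
  differentiable f x -> differentiable (fun y => f y i j : R) x.
Proof.
by move=> d; apply: (differentiable_comp d (differentiable_coord (f x) i j)).
Qed.

Lemma mx_lipschitz n (G : R -> 'M[R]_n) (r K : R) : 0 <= K ->
  (forall x : R, `|x| <= r -> differentiable G x /\ `|'D_1 G x| <= K) ->
  forall s t : R, `|s| <= r -> `|t| <= r -> `|G t - G s| <= K * `|t - s|.
Proof.
move=> K0 dG.
have H (s t : R) : s < t -> `|s| <= r -> `|t| <= r -> `|G t - G s| <= K * `|t - s|.
  move=> st sr tr; apply: mx_norm_leP => [|i j]; first by rewrite mulr_ge0.
  have st0 : 0 < t - s by rewrite subr_gt0.
  have I u : 0 <= u <= t - s -> `|s + u *: (1 : R)| <= r.
    move=> /andP[u0 us]; rewrite [u *: _]mulr1 ler_norml.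
    move: sr tr; rewrite !ler_norml; lra.
  have [|u uI] := @MVT_line R R (fun x => G x i j) s 1 (t - s) st0.
    by move=> u /I /dG[d _]; exact: differentiable_entry.
  have [d D] := dG _ (I u uI).
  have C : s + (t - s) *: (1 : R) = t by rewrite [_ *: _]mulr1 addrC subrK.
  rewrite derive_entry // C => E.
  rewrite !mxE E normrM mulrC ler_wpM2r //.
  exact: le_trans (mx_norm_entry _ _ _) D.
move=> s t sr tr; case: (ltgtP s t) => [st|ts|->].
- exact: H.
- by rewrite distrC [`|t - s|]distrC; exact: H.
- by rewrite !subrr !normr0 mulr0.
Qed.

(** The intervals of centre a m and radius e m = 2 / 2^m are nested, since e m = e (m + 1) + 2^-m.
    The supremum of their left ends lies in all of them, which gives the rate as well as the
    limit. *)
Lemma geometric_limit (a : nat -> R) :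
  (forall m, `|a m.+1 - a m| <= 2^-1 ^+ m) ->
  exists l, forall m, `|l - a m| <= 2 * 2^-1 ^+ m.
Proof.
move=> h; pose e (m : nat) : R := 2 * 2^-1 ^+ m.
have eS m : e m = e m.+1 + 2^-1 ^+ m by rewrite /e exprS mulrA mulfV // mul1r mulr_natl.
have up N m : (N <= m)%N -> a N - e N <= a m - e m /\ a m + e m <= a N + e N.
  elim: m => [|m IH]; first by rewrite leqn0 => /eqP ->.
  rewrite leq_eqVlt => /orP[/eqP -> //|]; rewrite ltnS => /IH[].
  by move: (h m); rewrite ler_norml (eS m) => /andP[]; lra.
have e0 m : 0 <= e m by rewrite mulr_ge0 // exprn_ge0 // invr_ge0.
have cmp m N : a m - e m <= a N + e N.
  have := e0 m; have := e0 N; case: (leqP m N) => [/up|/ltnW/up] [A B]; lra.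
pose S := [set a m - e m | m in [set: nat]].
have hs : has_sup S.
  split; first by exists (a 0%N - e 0%N); exists 0%N.
  by exists (a 0%N + e 0%N) => _ [m _ <-]; exact: cmp.
exists (sup S) => m; rewrite ler_norml -/(e m); apply/andP; split.
  have := ub_le_sup hs.2 (imageT (fun m => a m - e m) m); lra.
have : sup S <= a m + e m by apply: ge_sup => [|_ [N _ <-]]; [exact: hs.1|exact: cmp].
lra.
Qed.

(** Retraction of the line onto [-r, r]. Composing with it makes the Picard integrand continuous on
    all of R, as [antiderivative] asks. *)
Definition clamp (r t : R) : R := Num.max (- r) (Num.min t r).

Lemma clamp_id r t : `|t| <= r -> clamp r t = t.
Proof.
rewrite ler_norml => /andP[a b]; rewrite /clamp.
by rewrite (min_idPl b) (max_idPr a).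
Qed.

Lemma clamp_le r t : 0 <= r -> `|clamp r t| <= r.
Proof.
move=> r0; rewrite ler_norml /clamp le_max lexx /= ge_max ge_min lexx orbT andbT.
by rewrite ge0_cp.
Qed.

Lemma clamp_continuous r : continuous (clamp r).
Proof.
move=> t.
apply: (@continuous_max R R (fun=> - r) ((fun s : R => s) \min (fun=> r))).
  exact: cvg_cst.
by apply: continuous_min; [exact: cvg_id|exact: cvg_cst].
Qed.

Lemma smooth_at_fst (V W Z : normedModType R) {bW : fin_basis W} {bZ : fin_basis Z}
    (f : V -> W * Z) x : smooth_at f x -> smooth_at (fun y => (f y).1) x.
Proof. by apply: (@smooth_at_lin R V (W * Z)%type W _ fst f); exact: fst_linear. Qed.

Lemma smooth_at_snd (V W Z : normedModType R) {bW : fin_basis W} {bZ : fin_basis Z}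
    (f : V -> W * Z) x : smooth_at f x -> smooth_at (fun y => (f y).2) x.
Proof. by apply: (@smooth_at_lin R V (W * Z)%type Z _ snd f); exact: snd_linear. Qed.

Lemma continuous_dist (V W : normedModType R) (f : V -> W) x (e : R) :
  {for x, continuous f} -> 0 < e ->
  exists2 d : R, 0 < d & forall y, `|y - x| < d -> `|f y - f x| < e.
Proof.
move=> cf e0; have /nbhs_ballP[d /= d0 B] := cf _ (nbhsx_ballx (f x) e e0).
exists d => // y yx; have : ball x d y by rewrite -ball_normE /= distrC.
by move=> /B; rewrite /= -ball_normE /= distrC.
Qed.

Lemma dist_continuous (V W : normedModType R) (f : V -> W) x :
  (forall e : R, 0 < e ->
     exists2 d : R, 0 < d & forall y, `|y - x| < d -> `|f y - f x| < e) ->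
  {for x, continuous f}.
Proof.
move=> h; apply/cvgrPdist_lt => e /h[d d0 B].
apply: filterS (nbhsx_ballx x d d0) => y; rewrite -ball_normE /= distrC => /B.
by rewrite distrC.
Qed.

Lemma continuous_mulmx (T : topologicalType) n (f g : T -> 'M[R]_n) t :
  {for t, continuous f} -> {for t, continuous g} ->
  {for t, continuous (fun y => f y *m g y)}.
Proof.
move=> cf cg.
have cp : {for t, continuous (fun y => (f y, g y))} by exact: (cvg_pair cf cg).
have cm : {for (f t, g t), continuous (fun p : 'M[R]_n * 'M[R]_n => p.1 *m p.2)}.
  apply: smooth_at_cont; apply: smooth_at_mulmx.
    by apply: smooth_at_fst; exact: smooth_at_id.
  by apply: smooth_at_snd; exact: smooth_at_id.
exact: continuous_comp cp cm.
Qed.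

Lemma Cn_mulmx (V : normedModType R) n m (U : set V) (f g : V -> 'M[R]_m) :
  open U -> Cn n U f -> Cn n U g -> Cn n U (fun y => f y *m g y).
Proof.
move=> oU cf cg.
have ce (h : V -> 'M[R]_m) i j : Cn n U h -> Cn n U (fun y => h y i j : R).
  have lin : linear (fun A : 'M[R]_m => A i j : R) by exact: entry_linear.
  pose L : {linear 'M[R]_m -> R} := HB.pack (fun A : 'M[R]_m => A i j : R)
    (GRing.isLinear.Build _ _ _ _ _ lin).
  by apply: (@Cn_lin R V _ _ n U h L) => //; exact: fin_basis_continuous.
apply: (@Cn_eq _ _ _ n U (fun y => \sum_i \sum_j (\sum_k f y i k * g y k j) *: delta_mx i j)) => //.
  move=> y _; rewrite [RHS]matrix_sum_delta; apply: eq_bigr => i _; apply: eq_bigr => j _.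
  by rewrite mxE.
apply: Cn_sum => // i; apply: Cn_sum => // j; apply: CnZ => //; last exact: Cn_cst.
by apply: Cn_sum => // k; apply: (@CnZ R V R) => //; exact: ce.
Qed.

(* Picard iteration on an interval short enough for the integral operator to
   be a contraction with factor 1/2. *)
Lemma linear_ode n (w : R -> 'M[R]_n) (e0 : R) : 0 < e0 ->
  (forall t : R, `|t| < e0 -> smooth_at w t) ->
  exists (e : R) (P : R -> 'M[R]_n), [/\ 0 < e, e <= e0, P 0 = 1%:M &
    forall t : R, `|t| < e ->
      [/\ P t \in unitmx, smooth_at P t & 'D_1 P t = w t *m P t]].
Proof.
move=> e00 sw.
(* C bounds w on [-M, M], and M is so small that integration over this interval contracts by 1/2;
   the dimension factor comes from [mx_norm_mul]. *)
have [C [C0 [M [M0 Me wC MC]]]] : exists C : R, 0 < C /\ exists M : R,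
    [/\ 0 < M, M < e0, forall t : R, `|t| <= M -> `|w t| <= C & n.+1%:R * C * M <= 2^-1].
  exists (`|w 0| + 1); split; first by rewrite ltr_wpDl.
  have c0 : {for (0 : R), continuous w}.
    by apply: smooth_at_cont; apply: sw; rewrite normr0.
  have [d d0 B] := continuous_dist c0 ltr01.
  set C := `|w 0| + 1; have C0 : 0 < C by rewrite ltr_wpDl.
  have k0 : 0 < n.+1%:R * C + 1 by rewrite ltr_wpDl // mulr_ge0 // ltW.
  pose M := Num.min (Num.min (d / 2) (e0 / 2)) (2^-1 / (n.+1%:R * C + 1)).
  have M0 : 0 < M by rewrite !lt_min !divr_gt0.
  have M1 : M <= d / 2 by rewrite /M !ge_min lexx.
  have M2 : M <= e0 / 2 by rewrite /M !ge_min lexx orbT.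
  have M3 : M <= 2^-1 / (n.+1%:R * C + 1) by rewrite /M !ge_min lexx !orbT.
  exists M; split=> //; first by lra.
    move=> t tM; have /B wt : `|t - 0| < d by rewrite subr0; lra.
    rewrite /C -[w t](subrK (w 0)).
    by apply: le_trans (ler_normD _ _) _; rewrite addrC lerD2l ltW.
  apply: (@le_trans _ _ ((n.+1%:R * C + 1) * M)).
    by apply: ler_wpM2r; [exact: ltW|rewrite lerDl].
  by rewrite mulrC -ler_pdivlMr.
pose r := M / 2.
have r0 : 0 < r by rewrite divr_gt0.
have rM : r < M by rewrite /r; lra.
pose wt t := w (clamp r t).
have cwt : continuous wt.
  move=> t; apply: continuous_comp; first exact: clamp_continuous.
  apply: smooth_at_cont; apply: sw; apply: le_lt_trans (clamp_le _ (ltW r0)) _.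
  by lra.
have wtC t : `|wt t| <= C.
  by apply: wC; apply: le_trans (clamp_le _ (ltW r0)) (ltW rM).
(* The Picard operator as a total function: an f that is not continuous is sent to itself, a default
   that the iterates never meet. Because time is clamped, the equation is the intended one only for
   |t| <= r. *)
have I (f : R -> 'M[R]_n) : {g : R -> 'M[R]_n | (forall t : R, `|t| < M -> {for t, continuous f}) ->
    [/\ g 0 = 1%:M, (forall t : R, `|t| < M -> {for t, continuous g}) &
     forall t : R, `|t| < M -> differentiable g t /\ 'D_1 g t = wt t *m f (clamp r t)]}.
  apply: cid; case: (pselect (forall t : R, `|t| < M -> {for t, continuous f})); last by exists f.
  move=> cf; have cI : continuous (fun t => wt t *m f (clamp r t)).
    have cc : continuous (fun t => f (clamp r t)).
      move=> t; apply: continuous_comp; first exact: clamp_continuous.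
      by apply: cf; apply: le_lt_trans (clamp_le _ (ltW r0)) _.
    by move=> t; apply: continuous_mulmx; [exact: cwt|exact: cc].
  have [G [G0 dG]] := antiderivative_mx M0 cI.
  have dG1 (t : R) : `|t| < M -> differentiable (fun t => 1%:M + G t) t /\
      'D_1 (fun t => 1%:M + G t) t = wt t *m f (clamp r t).
    move=> /dG[d D]; split; first by apply: differentiableD => //; exact: differentiable_cst.
    by rewrite derive_fD // ?derive_cst ?add0r //; exact: differentiable_cst.
  exists (fun t => 1%:M + G t) => _; split; [by rewrite G0 addr0| |exact: dG1].
  by move=> t /dG1[d _]; exact: differentiable_continuous.
have nC0 : 0 <= n.+1%:R * C by rewrite mulr_ge0 // ltW.
have mulC t (A : 'M[R]_n) K : `|A| <= K -> `|wt t *m A| <= n.+1%:R * C * K.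
  move=> AK; apply: le_trans (mx_norm_mul _ _) _; rewrite -mulrA.
  by rewrite ler_pM ?mulr_ge0 ?ler_nat // ler_pM.
pose T f := sval (I f).
pose S := fix S N := if N is N'.+1 then T (S N') else fun=> 1%:M.
have cS N (t : R) : `|t| < M -> {for t, continuous (S N)}.
  elim: N t => [|N IH] t tM; first exact: cvg_cst.
  by have [_ c _] := svalP (I (S N)) IH; exact: c.
have S0 N : S N 0 = 1%:M.
  by case: N => [//|N]; have [] := svalP (I (S N)) (cS N).
have dS N (t : R) : `|t| < M -> differentiable (S N.+1) t /\ 'D_1 (S N.+1) t = wt t *m S N (clamp r t).
  by have [_ _ d] := svalP (I (S N)) (cS N); exact: d.
have tr (t : R) : `|t| <= r -> `|t| < M by move=> tr; apply: le_lt_trans tr rM.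
have z0 : `|(0 : R)| <= r by rewrite normr0 ltW.
have small (t : R) : `|t| <= r -> n.+1%:R * C * `|t| <= 2^-1.
  move=> h; apply: le_trans MC; rewrite ler_wpM2l //; apply: le_trans h (ltW rM).
have one : `|1%:M : 'M[R]_n| <= 1.
  by apply: mx_norm_leP => // i j; rewrite mxE; case: eqP => _; rewrite ?normr1 ?normr0.
(* Consecutive iterates agree at 0, and the derivative of their difference is controlled by the
   previous difference; the mean value theorem on |t| <= r gains the factor 1/2. *)
have step N (t : R) : `|t| <= r -> `|S N.+1 t - S N t| <= 2^-1 ^+ N.
  elim: N t => [|N IH] t ht.
    have -> : S 0%N t = S 1%N 0 by rewrite S0.
    rewrite expr0.
    have L : forall x : R, `|x| <= r -> differentiable (S 1%N) x /\ `|'D_1 (S 1%N) x| <= n.+1%:R * C * 1.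
      by move=> x /tr xM; have [d ->] := dS 0%N x xM; split=> //; apply: mulC.
    have K0 : 0 <= n.+1%:R * C * 1 by rewrite mulr1.
    have := mx_lipschitz K0 L z0 ht; rewrite S0 subr0 mulr1 => h.
    by apply: le_trans h _; apply: le_trans (small _ ht) _; rewrite invf_le1 // ler1n.
  pose G x := S N.+2 x - S N.+1 x.
  have L : forall x : R, `|x| <= r -> differentiable G x /\ `|'D_1 G x| <= n.+1%:R * C * 2^-1 ^+ N.
    move=> x xr; have [d1 e1] := dS N.+1 x (tr _ xr); have [d2 e2] := dS N x (tr _ xr).
    split; first exact: differentiableB.
    rewrite /G derive_fB // e1 e2 -mulmxBr; apply: mulC; apply: IH.
    exact: clamp_le (ltW r0).
  have K0 : 0 <= n.+1%:R * C * 2^-1 ^+ N by rewrite mulr_ge0 // exprn_ge0 // invr_ge0.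
  have := mx_lipschitz K0 L z0 ht; rewrite /G !S0 subrr !subr0 => h.
  by apply: le_trans h _; rewrite mulrAC exprS ler_wpM2r ?small //.
have lim t : {A : 'M[R]_n | forall m, `|A - S m (clamp r t)| <= 2 * 2^-1 ^+ m}.
  apply: cid.
  have cl := clamp_le t (ltW r0).
  have ex i j : {l : R | forall m, `|l - S m (clamp r t) i j| <= 2 * 2^-1 ^+ m}.
    apply: cid; apply: geometric_limit => m.
    have := le_trans (mx_norm_entry (S m.+1 (clamp r t) - S m (clamp r t)) i j) (step m _ cl).
    by rewrite !mxE.
  exists (\matrix_(i, j) sval (ex i j)) => m; apply: mx_norm_leP => [|i j].
    by rewrite mulr_ge0 // exprn_ge0 // invr_ge0.
  by rewrite !mxE; exact: (svalP (ex i j)).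
pose P t := sval (lim t).
have PS t m : `|P t - S m (clamp r t)| <= 2 * 2^-1 ^+ m by exact: (svalP (lim t)).
have geo (x y c : R) : (forall m : nat, x <= y + c * 2^-1 ^+ m) -> x <= y.
  move=> h.
  have cv : (fun m : nat => y + c * 2^-1 ^+ m) @ \oo --> y + c * 0.
    apply: cvgD; first exact: cvg_cst.
    apply: cvgM; first exact: cvg_cst.
    by apply: cvg_expr; rewrite ger0_norm ?invr_ge0 // invf_lt1 // ltr1n.
  rewrite mulr0 addr0 in cv.
  rewrite -(cvg_lim _ cv) //; apply: limr_ge; first by apply/cvg_ex; exists y.
  by apply: nearW.
have PB t : `|P t| <= 3.
  have := PS t 0%N; rewrite expr0 mulr1 /= => h.
  rewrite -[P t](subrK 1%:M); apply: le_trans (ler_normD _ _) _; lra.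
(* From |P| <= 3 = 1 + 2 and |P - S N| <= 2. A bound common to all iterates gives them a common
   Lipschitz constant, which passes to the limit P and makes it continuous. *)
have SB N (t : R) : `|t| <= r -> `|S N t| <= 5.
  move=> h; have := PS t N; rewrite (clamp_id h) distrC => h2.
  rewrite -[S N t](subrK (P t)); apply: le_trans (ler_normD _ _) _.
  have : 2 * 2^-1 ^+ N <= (2 : R).
    by rewrite ger_pMr // exprn_ile1 // ?invr_ge0 // invf_le1 // ler1n.
  have := PB t; lra.
have K50 : 0 <= n.+1%:R * C * 5 by rewrite mulr_ge0.
have PL (s t : R) : `|P t - P s| <= n.+1%:R * C * 5 * `|clamp r t - clamp r s|.
  apply: (geo _ _ 2) => m.
  have h1 := PS t m.+1; have h2 := PS s m.+1.
  have L : forall x : R, `|x| <= r -> differentiable (S m.+1) x /\ `|'D_1 (S m.+1) x| <= n.+1%:R * C * 5.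
    move=> x xr; have [d e] := dS m x (tr _ xr); split=> //.
    by rewrite e; apply: mulC; apply: SB; exact: clamp_le (ltW r0).
  have h3 := mx_lipschitz K50 L (clamp_le s (ltW r0)) (clamp_le t (ltW r0)).
  have e3 : 2 * 2^-1 ^+ m = 2 * 2^-1 ^+ m.+1 + 2 * 2^-1 ^+ m.+1 :> R.
    by rewrite exprS mulrA mulfV // mul1r mulr_natl.
  rewrite e3; move: h1 h2 h3; set A := S _ (clamp r t); set B := S _ (clamp r s).
  rewrite [`|P s - B|]distrC => h1 h2 h3.
  have -> : P t - P s = (P t - A) + ((A - B) + (B - P s)) by rewrite subrKA subrKA.
  have n1 := ler_normD (P t - A) ((A - B) + (B - P s)).
  have n2 := ler_normD (A - B) (B - P s).
  by lra.
have cP (t : R) : `|t| < M -> {for t, continuous P}.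
  move=> _; apply: dist_continuous => e ep.
  have k0 : 0 < n.+1%:R * C * 5 + 1 by rewrite ltr_wpDl.
  have [d d0 B] := continuous_dist (clamp_continuous (r := r) (x := t)) (divr_gt0 ep k0).
  exists d => // s /B; rewrite ltr_pdivlMr // mulrC => h; apply: le_lt_trans (PL t s) _.
  by apply: le_lt_trans h; rewrite ler_wpM2r // lerDl.
(* Applying the operator once more to the continuous P yields a differentiable function; since it
   equals P on [-r, r], it solves the equation there. *)
pose Q := T P.
have [Q0 _ dQ] := svalP (I P) cP; rewrite -/(T P) -/Q in Q0 dQ.
have QP (t : R) : `|t| <= r -> Q t = P t.
  move=> h; apply/eqP; rewrite -subr_eq0 -normr_le0; apply: (geo _ _ 2) => m; rewrite add0r.
  pose G x := Q x - S m.+1 x.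
  have L : forall x : R, `|x| <= r -> differentiable G x /\ `|'D_1 G x| <= n.+1%:R * C * (2 * 2^-1 ^+ m).
    move=> x xr; have [d1 e1] := dQ x (tr _ xr); have [d2 e2] := dS m x (tr _ xr).
    split; first exact: differentiableB.
    rewrite /G derive_fB // e1 e2 -mulmxBr; apply: mulC.
    by have := PS (clamp r x) m; rewrite (clamp_id (clamp_le x (ltW r0))).
  have K0 : 0 <= n.+1%:R * C * (2 * 2^-1 ^+ m) by rewrite mulr_ge0 // mulr_ge0 // exprn_ge0 // invr_ge0.
  have := mx_lipschitz K0 L z0 h; rewrite /G Q0 S0 subrr !subr0 => h1.
  have := PS t m.+1; rewrite (clamp_id h) => h2.
  rewrite -[Q t](subrK (S m.+1 t)) -addrA; apply: le_trans (ler_normD _ _) _.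
  have e3 : 2 * 2^-1 ^+ m = 2^-1 ^+ m + 2^-1 ^+ m :> R by rewrite mulr_natl.
  rewrite e3 lerD //; last first.
    by rewrite distrC; apply: le_trans h2 _; rewrite exprS mulrA mulfV // mul1r.
  apply: le_trans h1 _; rewrite mulrAC.
  apply: (@le_trans _ _ (2^-1 * (2 * 2^-1 ^+ m))).
    by rewrite ler_wpM2r ?small // mulr_ge0 // exprn_ge0 // invr_ge0.
  by rewrite mulrA mulVf // mul1r.
have dQ' (t : R) : `|t| < r -> differentiable Q t /\ 'D_1 Q t = w t *m Q t.
  move=> h; have h' := ltW h; have [d e] := dQ t (tr _ h'); split=> //.
  by rewrite e /wt (clamp_id h') QP.
pose U : set R := ball (0 : R) r.
have oU : open U by exact: ball_open.
have UE t : U t <-> `|t| < r by rewrite /U /ball /= sub0r normrN.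
(* Bootstrapping: the derivative w Q is as regular as Q, so each order gives the next. *)
have CnQ m : Cn m U Q.
  elim: m => [|m IH]; first by apply/Cn0 => t /UE /dQ' [].
  apply/CnS; split=> [t /UE /dQ' []//|v].
  have cw : Cn m U w.
    suff : smooth_on U w by move=> /smooth_onC.
    apply/smooth_onP => // t /UE ht; apply: sw; apply: lt_trans ht _; lra.
  have := CnZ oU (@Cn_cst _ _ _ m U (v : R) oU) (Cn_mulmx oU cw IH).
  apply: Cn_eq => // t /UE /dQ' [d <-].
  by have := derive_dirZ (v : R) (1 : R) d; rewrite [_ *: 1]mulr1 => <-.
have cQ0 : {for 0, continuous Q}.
  by apply: differentiable_continuous; case: (dQ' 0) => //; rewrite normr0.
have uQ0 : Q 0 \in unitmx by rewrite Q0 unitmx1.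
(* Invertibility near 0 comes from continuity of the determinant, at the price of a last shrinking
   of the interval. *)
have /nbhs_ballP[d /= d0 B] := near_unitmx cQ0 uQ0.
have mr : Num.min d r <= r by rewrite ge_min lexx orbT.
have md : Num.min d r <= d by rewrite ge_min lexx.
exists (Num.min d r), Q; split=> //; first by rewrite lt_min d0 r0.
  by apply: le_trans mr _; lra.
move=> t ht; have htr := lt_le_trans ht mr; have htd := lt_le_trans ht md; split.
- by apply: B; rewrite /ball /= sub0r normrN.
- by apply/smooth_atC; exists U => //; split=> //; apply/UE.
- by have [] := dQ' t htr.
Qed.

End LinearODE.

(** * Bump functions *)

Section Bump.
Context {R : realType}.

(** The usual cutoff is n = 0. The powers of 1/x are there because the derivatives of the members of
    this family are combinations of members ([derive_flat_fun]), so that smoothness follows by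
    induction on the order for all n at once. *)
Definition flat_fun (n : nat) (x : R) : R :=
  if 0 < x then x^-1 ^+ n * expR (- x^-1) else 0.

Lemma flat_fun_ge0 n x : 0 <= flat_fun n x.
Proof.
rewrite /flat_fun; case: ifP => // x0.
by rewrite mulr_ge0 ?expR_ge0 // exprn_ge0 // invr_ge0 ltW.
Qed.

(** A quadratic bound forces the derivative at 0 to vanish. It comes from exp y = exp(y/m)^m >=
    (y/m)^m at y = 1/x, with m = n + 2 so that two powers of x are left over. *)
Lemma flat_fun_le n x : flat_fun n x <= n.+2%:R ^+ n.+2 * x ^+ 2.
Proof.
rewrite /flat_fun; case: ifP => x0; last by rewrite mulr_ge0 // ?sqr_ge0 // exprn_ge0.
set y := x^-1; have y0 : 0 < y by rewrite invr_gt0.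
have -> : x = y^-1 by rewrite invrK.
set m := n.+2; have m0 : 0 < m%:R :> R by rewrite ltr0n.
have e1 : expR y = expR (y / m%:R) ^+ m.
  by rewrite -expRM_natl mulrC divfK // gt_eqF.
have h : (y / m%:R) ^+ m <= expR y.
  rewrite e1; apply: lerXn2r; rewrite ?nnegrE ?expR_ge0 ?divr_ge0 ?(ltW y0) //.
  by apply: le_trans (expR_ge1Dx _); rewrite lerDr.
rewrite expRN ler_pdivrMr ?expR_gt0 // [y^-1 ^+ 2]exprVn mulrAC.
rewrite ler_pdivlMr ?exprn_gt0 // -exprD addn2 -/m mulrC.
by rewrite -ler_pdivrMr ?exprn_gt0 // -expr_div_n.
Qed.

Lemma derive_invX n (x v : R) : x != 0 ->
  differentiable (fun y : R => y^-1 ^+ n) x /\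
  'D_v (fun y : R => y^-1 ^+ n) x = - (n%:R * x^-1 ^+ n.+1 * v).
Proof.
move=> x0; elim: n => [|n [d D]].
  by split; [exact: differentiable_cst|rewrite derive_cst !mul0r oppr0].
have d1 : differentiable (fun y : R => y^-1) x by exact: differentiable_Rinv.
have E : (fun y : R => y^-1 ^+ n.+1) = (fun y : R => y^-1 *: y^-1 ^+ n).
  by apply/funext => y; rewrite exprS.
have [d' D'] := diffZ_fun d1 d; rewrite E; split; first exact: d'.
have sc (a b : R) : a *: b = a * b by [].
rewrite D' D deriveE // diff_Rinv //= !sc -exprVn -natr1 !exprS; ring.
Qed.

Lemma derive_flat_fun n (x v : R) :
  differentiable (flat_fun n) x /\
  'D_v (flat_fun n) x = v * (flat_fun n.+2 x - n%:R * flat_fun n.+1 x).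
Proof.
case: (ltgtP x 0) => [x0|x0|->].
- have E : \forall y \near x, 0 = flat_fun n y.
    by near=> y; rewrite /flat_fun ltNge ltW //=; near: y; exact: lt_nbhsl.
  split; first by apply: differentiable_near E _; exact: differentiable_cst.
  rewrite -(near_eq_derive v E) (derive_cst (0 : R)) /flat_fun.
  by rewrite ltNge (ltW x0) /= mulr0 subrr mulr0.
- have E : \forall y \near x, y^-1 ^+ n * expR (- y^-1) = flat_fun n y.
    by near=> y; rewrite /flat_fun ifT //; near: y; exact: lt_nbhsr.
  have xn : x != 0 by rewrite gt_eqF.
  have [dX DX] := derive_invX n v xn.
  have [d1 DI] : differentiable (fun y : R => y^-1) x /\
      'D_v (fun y : R => y^-1) x = - (1 * x^-1 ^+ 2 * v).
    exact: (derive_invX 1 v xn).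
  have dN : differentiable (fun y : R => - y^-1) x by exact: differentiableN.
  have dE : differentiable (@expR R) (- x^-1) by apply/derivable1_diffP; exact: derivable_expR.
  have dexp : differentiable (fun y : R => expR (- y^-1)) x by exact: (differentiable_comp dN dE).
  have [D1 D2] := diffZ_fun dX dexp.
  split; first exact: differentiable_near E D1.
  rewrite -(near_eq_derive v E).
  rewrite (D2 v) (derive_comp v dN dE).
  rewrite (@deriveN _ _ _ (fun y : R => y^-1)); last by exact: diff_derivable.
  rewrite DX DI.
  have -> u : 'D_u (@expR R) (- x^-1) = u * expR (- x^-1).
    have eD : 'D_1 (@expR R) (- x^-1) = expR (- x^-1).
      exact: (congr1 (@^~ (- x^-1)) (@derive_expR R)).
    have := derive_dirZ (u : R) (1 : R) dE; rewrite [_ *: 1]mulr1 eD; exact.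
  have sc (a b : R) : a *: b = a * b by [].
  by rewrite /flat_fun x0 !sc !exprS; ring.
have f0 m : flat_fun m 0 = 0 by rewrite /flat_fun ltxx.
have cz : continuous (\0 : {linear R -> R}).
  by move=> y; exact: (@cst_continuous R R 0).
have [|d D] := @differentiableI R R R (flat_fun n) \0 0 cz.
  move=> e e0; set C := n.+2%:R ^+ n.+2 : R.
  have C0 : 0 < C by rewrite exprn_gt0.
  have ec : 0 < e / C by rewrite divr_gt0.
  apply: filterS (nbhsx_ballx (0 : R) (e / C) ec) => h.
  rewrite -ball_normE /= sub0r normrN => hh.
  rewrite addr0 f0 !subr0 ger0_norm ?flat_fun_ge0 //.
  apply: le_trans (flat_fun_le _ _) _; rewrite -/C -real_normK ?num_real // expr2 mulrA.
  by rewrite ler_wpM2r // mulrC -ler_pdivlMr // ltW.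
by split=> //; rewrite deriveE // D !f0 mulr0 subrr mulr0.
Unshelve. all: by end_near. Qed.

Lemma smooth_flat_fun n (x : R) : smooth_at (flat_fun n) x.
Proof.
apply/smooth_atC; exists setT => [|m]; first by split; [exact: openT|].
elim: m n {x} => [|m IH] n; first by apply/Cn0 => x _; exact: (derive_flat_fun n x 0).1.
apply/CnS; split=> [x _|v]; first exact: (derive_flat_fun n x 0).1.
have oT : open [set: R] by exact: openT.
have c a : Cn m [set: R] (fun _ : R => a : R) by exact: Cn_cst.
apply: (@Cn_eq _ _ _ m setT (fun x => v *: (flat_fun n.+2 x + (- n%:R) *: flat_fun n.+1 x))) => //.
  by move=> x _; rewrite (derive_flat_fun n x v).2 -mulNr.
by apply: CnZ => //; apply: CnD => //; apply: CnZ.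
Qed.

Lemma flat_fun0_gt0 (x : R) : (0 < flat_fun 0 x) = (0 < x).
Proof.
rewrite /flat_fun; case: ifP => x0; last by rewrite ltxx.
by rewrite expr0 mul1r expR_gt0.
Qed.

Lemma flat_fun0_le0 (x : R) : x <= 0 -> flat_fun 0 x = 0.
Proof. by rewrite /flat_fun leNgt => /negbTE ->. Qed.

Lemma bump_rV n (a : 'rV[R]_n) (U : set 'rV[R]_n) : open U -> U a ->
  exists (b : 'rV[R]_n -> R) (K : set 'rV[R]_n),
    [/\ forall z, smooth_at b z, forall z, 0 <= b z & 0 < b a] /\
    [/\ compact K, K `<=` U & forall z, ~ K z -> b z = 0].
Proof.
move=> oU Ua; have /nbhs_ballP[d /= d0 B] := open_nbhs_nbhs (conj oU Ua).
pose e := d / 2; have e0 : 0 < e by rewrite divr_gt0.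
(* The norm of row vectors is the maximum norm, which is not smooth. The Euclidean ball q <= e^2
   lies in its closed ball of radius e = d/2, hence inside the open ball of radius d. *)
pose q (z : 'rV[R]_n) := \sum_i (z 0 i - a 0 i) ^+ 2.
have sq z : smooth_at q z.
  apply: smooth_at_sum => i _; apply: smooth_atM.
    apply: smooth_atB; last exact: smooth_at_cst.
    by apply: smooth_at_entry; exact: smooth_at_id.
  apply: smooth_atB; last exact: smooth_at_cst.
  by apply: smooth_at_entry; exact: smooth_at_id.
pose K := [set z | q z <= e ^+ 2].
have KB z : K z -> `|z - a| <= e.
  move=> Kz; apply: mx_norm_leP => [|i j]; first exact: ltW.
  rewrite !mxE ord1 -(@ler_pXn2r _ 2) ?nnegrE ?normr_ge0 ?(ltW e0) //.
  rewrite real_normK ?num_real //; apply: le_trans Kz.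
  rewrite /q (bigD1 j) //= lerDl; apply: sumr_ge0 => k _; exact: sqr_ge0.
exists (fun z => flat_fun 0 (e ^+ 2 - q z)), K; split; split.
- move=> z; apply: (smooth_at_comp (g := flat_fun 0)); last exact: smooth_flat_fun.
  by apply: smooth_atB; [exact: smooth_at_cst|exact: sq].
- by move=> z; exact: flat_fun_ge0.
- rewrite flat_fun0_gt0 subr_gt0 /q big1 ?exprn_gt0 // => i _.
  by rewrite subrr expr0n.
- apply: bounded_closed_compact.
    exists (`|a| + e); split; first exact: num_real.
    move=> M hM z /KB h; apply: le_trans (ltW hM).
    by rewrite -[z](subrK a); apply: le_trans (ler_normD _ _) _; rewrite addrC lerD2l.
  rewrite /K; have -> : [set z | q z <= e ^+ 2] = q @^-1` [set x | x <= e ^+ 2] by [].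
  apply: closed_comp => [z _|]; last exact: closed_le.
  exact: smooth_at_cont.
- move=> z /KB h; apply: B; rewrite -ball_normE /= distrC.
  by apply: le_lt_trans h _; rewrite /e; lra.
- move=> z Kz; apply: flat_fun0_le0; rewrite subr_le0 ltW // ltNge.
  by apply/negP.
Qed.

End Bump.

Local Opaque row_mx lsubmx rsubmx.

(** * Foliated charts *)

Lemma smooth_at_ext (R : realType) (V W : normedModType R) (f g : V -> W) x :
  f =1 g -> smooth_at f x -> smooth_at g x.
Proof. by move=> /funext ->. Qed.

Lemma rsubmxD (R : realType) m n q (A B : 'M[R]_(m, n + q)) :
  rsubmx (A + B) = rsubmx A + rsubmx B.
Proof. exact: linearD. Qed.

Section Charts.
Context {R : realType} {p k : nat} (M : foliated_manifold R p k).
Local Notation TV := 'rV[R]_(p + k).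
Local Notation NV := 'rV[R]_k.
Local Notation chartM := (chart R (pt M) (p + k)).
Implicit Types (c d e : chartM) (x y : M).

Lemma chart_at_charts x : charts (f := M) (chart_at x).
Proof. by rewrite /chart_at; case: (cid (charts_cover x)) => c []. Qed.

Lemma chart_at_dom x : dom (chart_at x) x.
Proof. by rewrite /chart_at; case: (cid (charts_cover x)) => c []. Qed.

Lemma cinvK c x : dom c x -> cinv c (cmap c x) = x.
Proof. by move=> cx; apply: cmapK; rewrite inE. Qed.

Lemma near_chart c x (P : M -> Prop) : dom c x -> (\forall y \near x, P y) ->
  \forall z \near cmap c x, exists y, [/\ z = cmap c y, dom c y & P y].
Proof.
move=> cx nP.
have im : (cmap c @` dom c) (cmap c x) by exists x.
have n1 : \forall z \near cmap c x, (cmap c @` dom c) z.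
  by apply: open_nbhs_nbhs; split=> //; exact: img_open.
have nP' : nbhs (cinv c (cmap c x)) P by rewrite cinvK.
have n2 : \forall z \near cmap c x, P (cinv c z) by exact: (cinv_cont im nP').
by apply: filterS2 n1 n2 => _ [y cy <-]; rewrite cinvK // => Py; exists y.
Qed.

Lemma near_dom c x : dom c x -> \forall y \near x, dom c y.
Proof. by move=> cx; apply: open_nbhs_nbhs; split=> //; exact: dom_open. Qed.

Lemma near_cmap c x (P : TV -> Prop) : dom c x -> (\forall z \near cmap c x, P z) ->
  \forall y \near x, P (cmap c y).
Proof. by move=> cx nP; have := cmap_cont cx nP. Qed.

Lemma open_chart_image c (U : set M) : open U -> open (cmap c @` (dom c `&` U)).
Proof.
move=> oU; rewrite openE => z [x [cx Ux] <-].
have := near_chart cx (open_nbhs_nbhs (conj oU Ux)).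
by apply: filterS => _ [y [-> cy Uy]]; exists y.
Qed.

Lemma smooth_on_chart (W : normedModType R) c (U : set M) (F : TV -> W) : open U ->
  smooth_on (cmap c @` (dom c `&` U)) F <->
  forall x, dom c x -> U x -> smooth_at F (cmap c x).
Proof.
move=> oU; rewrite smooth_onP; last exact: open_chart_image.
by split=> [h x cx Ux|h z [x [cx Ux] <-]]; [apply: h; exists x|exact: h].
Qed.

Lemma transE c d x : dom c x -> trans c d (cmap c x) = cmap d x.
Proof. by move=> cx; rewrite /trans /= cinvK. Qed.

Lemma tlocE c X x : dom c x -> tloc c X (cmap c x) = tcoord c x (X x).
Proof. by move=> cx; rewrite /tloc cinvK. Qed.

Lemma nlocE c s x : dom c x -> nloc c s (cmap c x) = s x *m nmx c x.
Proof. by move=> cx; rewrite /nloc cinvK. Qed.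

Lemma mul_lin1_mx m n (f : 'rV[R]_m -> 'rV[R]_n) u : linear f -> u *m lin1_mx f = f u.
Proof.
move=> lf; pose g : {linear 'rV[R]_m -> 'rV[R]_n} :=
  HB.pack f (GRing.isLinear.Build _ _ _ _ _ lf).
exact: (mul_rV_lin1 g).
Qed.

Lemma tcoordE c x v : tcoord c x v = 'D_v (trans (chart_at x) c) (cmap (chart_at x) x).
Proof. by []. Qed.

Lemma nmxE c x : nmx c x = tjac (chart_at x) c (cmap (chart_at x) x).
Proof. by []. Qed.

Lemma mul_tjac c d z (w : NV) :
  differentiable (trans c d) z ->
  w *m tjac c d z = rsubmx ('D_(row_mx 0 w) (trans c d) z).
Proof.
move=> dt; rewrite /tjac mul_lin1_mx // => a u v.
have -> : row_mx 0 (a *: u + v) = a *: row_mx 0 u + row_mx 0 v :> 'rV[R]_(p + k).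
  by rewrite scale_row_mx add_row_mx scaler0 addr0.
by rewrite (derive_dirP _ _ _ dt) linearP.
Qed.

Lemma tjac_entry c d z i j :
  tjac c d z i j = rsubmx ('D_(row_mx 0 (delta_mx 0 i)) (trans c d) z) 0 j.
Proof. by rewrite /tjac mxE. Qed.

Lemma nloc_piN_E c X z : nloc c (piN X) z = rsubmx (X (cinv c z)) *m nmx c (cinv c z).
Proof. by []. Qed.

Lemma tloc_E c X z : tloc c X z = tcoord c (cinv c z) (X (cinv c z)).
Proof. by []. Qed.

Lemma near_trans c d e x : dom c x -> dom d x ->
  \forall z \near cmap c x, trans d e (trans c d z) = trans c e z.
Proof.
move=> cx dx; apply: filterS (near_chart cx (near_dom dx)) => _ [y [-> cy dy]].
by rewrite !transE.
Qed.

Local Opaque trans tjac nmx tcoord tloc nloc.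

Lemma near_trans_id c x : dom c x -> \forall z \near cmap c x, trans c c z = z.
Proof.
move=> cx; apply: filterS (near_chart cx (near_dom cx)) => _ [y [-> cy _]].
by rewrite transE.
Qed.

Lemma smooth_trans c d x : charts (f := M) c -> charts (f := M) d ->
  dom c x -> dom d x -> smooth_at (trans c d) (cmap c x).
Proof.
move=> hc hd cx dx; have [s _] := charts_compat hc hd.
by move/(smooth_on_chart _ _ (dom_open d)): s; apply.
Qed.

Lemma derive_trans_comp c d e x v : charts (f := M) c -> charts (f := M) d ->
  charts (f := M) e -> dom c x -> dom d x -> dom e x ->
  'D_('D_v (trans c d) (cmap c x)) (trans d e) (cmap d x) =
  'D_v (trans c e) (cmap c x).
Proof.
move=> hc hd he cx dx ex.
rewrite -(near_eq_derive v (near_trans e cx dx)) -(transE d cx).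
have s1 := smooth_at_diff (smooth_trans hc hd cx dx).
rewrite (@derive_comp _ _ _ _ (trans c d) (trans d e)) //.
by rewrite transE //; apply: smooth_at_diff; exact: smooth_trans.
Qed.

Lemma derive_trans_id c x v : dom c x -> 'D_v (trans c c) (cmap c x) = v.
Proof. by move=> cx; rewrite (near_eq_derive v (near_trans_id cx)) derive_id. Qed.

(** The inverse of [tcoord c x], from components in c back to components in the preferred chart. *)
Definition tvec c x (v : TV) : TV := 'D_v (trans c (chart_at x)) (cmap c x).

Lemma tcoord_trans c d x v : charts (f := M) c -> charts (f := M) d ->
  dom c x -> dom d x ->
  'D_(tcoord c x v) (trans c d) (cmap c x) = tcoord d x v.
Proof.
move=> hc hd cx dx; rewrite tcoordE derive_trans_comp //.
  exact: chart_at_charts.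
exact: chart_at_dom.
Qed.

Lemma tcoord_at x v : tcoord (chart_at x) x v = v.
Proof. by rewrite tcoordE derive_trans_id //; exact: chart_at_dom. Qed.

Lemma tcoordK c x : charts (f := M) c -> dom c x -> cancel (tcoord c x) (tvec c x).
Proof.
move=> hc cx v; rewrite /tvec tcoord_trans ?tcoord_at //.
  exact: chart_at_charts.
exact: chart_at_dom.
Qed.

Lemma tvecK c x : charts (f := M) c -> dom c x -> cancel (tvec c x) (tcoord c x).
Proof.
move=> hc cx v; rewrite /tvec tcoordE derive_trans_comp ?derive_trans_id //.
  exact: chart_at_charts.
exact: chart_at_dom.
Qed.

Lemma tvec_linear c x : charts (f := M) c -> dom c x -> linear (tvec c x).
Proof.
move=> hc cx; apply: derive_dir_linear; apply: smooth_at_diff.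
by apply: smooth_trans => //; [exact: chart_at_charts|exact: chart_at_dom].
Qed.

Lemma derive_trans_leaf c d x (a : 'rV[R]_p) : charts (f := M) c -> charts (f := M) d ->
  dom c x -> dom d x -> rsubmx ('D_(row_mx a 0) (trans c d) (cmap c x)) = 0.
Proof.
move=> hc hd cx dx; have [_ h] := charts_compat hc hd.
by apply: h; exists x.
Qed.

(** Leaf directions stay leaf directions under a change of foliated charts, so only the transverse
    part of v contributes. This is what makes [tjac] a cocycle although it ignores half of the
    Jacobian. *)
Lemma rsubmx_derive_trans c d x v : charts (f := M) c -> charts (f := M) d ->
  dom c x -> dom d x ->
  rsubmx ('D_v (trans c d) (cmap c x)) = rsubmx v *m tjac c d (cmap c x).
Proof.
move=> hc hd cx dx; have dt := smooth_at_diff (smooth_trans hc hd cx dx).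
rewrite -[v in LHS]hsubmxK.
have -> : row_mx (lsubmx v) (rsubmx v) = row_mx (lsubmx v) 0 + row_mx 0 (rsubmx v).
  by rewrite add_row_mx addr0 add0r.
rewrite (derive_dirD _ _ dt) rsubmxD [X in X + _](derive_trans_leaf (lsubmx v) hc hd cx dx).
by rewrite add0r (mul_tjac _ dt).
Qed.

Lemma tjac_comp c d e x : charts (f := M) c -> charts (f := M) d ->
  charts (f := M) e -> dom c x -> dom d x -> dom e x ->
  tjac c d (cmap c x) *m tjac d e (cmap d x) = tjac c e (cmap c x).
Proof.
move=> hc hd he cx dx ex; apply/row_matrixP => i; rewrite !rowE mulmxA.
rewrite -[delta_mx 0 i](row_mxKr (0 : 'rV[R]_p)).
set v := row_mx _ _.
rewrite -(rsubmx_derive_trans v hc hd cx dx) -(rsubmx_derive_trans _ hd he dx ex).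
by rewrite (derive_trans_comp _ hc hd he cx dx ex) (rsubmx_derive_trans v hc he cx ex).
Qed.

Lemma tjac_id c x : charts (f := M) c -> dom c x -> tjac c c (cmap c x) = 1%:M.
Proof.
move=> hc cx; apply/row_matrixP => i; rewrite !rowE mulmx1.
rewrite -[delta_mx 0 i](row_mxKr (0 : 'rV[R]_p)).
by rewrite -(rsubmx_derive_trans _ hc hc cx cx) derive_trans_id.
Qed.

Lemma tjacV c d x : charts (f := M) c -> charts (f := M) d -> dom c x -> dom d x ->
  tjac c d (cmap c x) \in unitmx /\ invmx (tjac c d (cmap c x)) = tjac d c (cmap d x).
Proof.
move=> hc hd cx dx.
have e : tjac c d (cmap c x) *m tjac d c (cmap d x) = 1%:M.
  by rewrite tjac_comp // tjac_id.
have [u _] := mulmx1_unit e; split=> //.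
by rewrite -[LHS]mulmx1 -e mulmxA mulVmx // mul1mx.
Qed.

Lemma smooth_tjac c d x : charts (f := M) c -> charts (f := M) d ->
  dom c x -> dom d x -> smooth_at (tjac c d) (cmap c x).
Proof.
move=> hc hd cx dx; apply: smooth_at_mx => i j.
apply: (@smooth_at_ext _ _ _ (fun z => rsubmx ('D_(row_mx 0 (delta_mx 0 i)) (trans c d) z) 0 j)).
  by move=> z; rewrite tjac_entry.
apply: smooth_at_entry; apply: smooth_at_lin; first exact: rsubmx_linear.
by apply: smooth_at_derive; exact: smooth_trans.
Qed.

Lemma nmx_trans c d x : charts (f := M) c -> charts (f := M) d -> dom c x -> dom d x ->
  nmx d x = nmx c x *m tjac c d (cmap c x).
Proof.
move=> hc hd cx dx; rewrite !nmxE tjac_comp //.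
  exact: chart_at_charts.
exact: chart_at_dom.
Qed.

Lemma nmx_unit c x : charts (f := M) c -> dom c x -> nmx c x \in unitmx.
Proof. by move=> hc cx; rewrite nmxE; case: (tjacV (chart_at_charts x) hc (chart_at_dom x) cx). Qed.

Lemma nmx_at x : nmx (chart_at x) x = 1%:M.
Proof. by rewrite nmxE; exact: tjac_id (chart_at_charts x) (chart_at_dom x). Qed.

Lemma rsubmx_tcoord c x v : charts (f := M) c -> dom c x ->
  rsubmx (tcoord c x v) = rsubmx v *m nmx c x.
Proof.
by move=> hc cx; rewrite tcoordE nmxE rsubmx_derive_trans //; [exact: chart_at_charts|exact: chart_at_dom].
Qed.

Lemma rsubmx_tvec c x v : charts (f := M) c -> dom c x ->
  rsubmx (tvec c x v) = rsubmx v *m invmx (nmx c x).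
Proof.
move=> hc cx; rewrite -[v in RHS](tvecK hc cx) rsubmx_tcoord // mulmxK //.
exact: nmx_unit.
Qed.

Lemma tloc_trans c d X x : charts (f := M) c -> charts (f := M) d -> dom c x -> dom d x ->
  \forall z \near cmap c x, tloc d X (trans c d z) = 'D_(tloc c X z) (trans c d) z.
Proof.
move=> hc hd cx dx; apply: filterS (near_chart cx (near_dom dx)) => _ [y [-> cy dz]].
by rewrite (transE d cy) !(tlocE X cy, tlocE X dz) (tcoord_trans _ hc hd cy dz).
Qed.

Lemma smooth_tloc c d X x : charts (f := M) c -> charts (f := M) d -> dom c x -> dom d x ->
  smooth_at (tloc c X) (cmap c x) -> smooth_at (tloc d X) (cmap d x).
Proof.
move=> hc hd cx dx sX.
have st := smooth_trans hd hc dx cx.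
have e : trans d c (cmap d x) = cmap c x by rewrite (transE c dx).
apply: (@smooth_at_eq _ _ _ (fun w => (fun z => 'D_(tloc c X z) (trans c d) z) (trans d c w))).
  apply: filterS (near_chart dx (near_dom cx)) => _ [y [-> dy cw]].
  by rewrite (transE c dy) !(tlocE X dy, tlocE X cw) (tcoord_trans _ hc hd cw dy).
apply: (@smooth_at_comp _ _ _ _ _ (trans d c) (fun z => 'D_(tloc c X z) (trans c d) z)).
  exact: st.
by rewrite e; apply: (smooth_at_derive_dir _ sX).1; exact: smooth_trans.
Qed.

Lemma smooth_nloc c d s x : charts (f := M) c -> charts (f := M) d -> dom c x -> dom d x ->
  smooth_at (nloc c s) (cmap c x) -> smooth_at (nloc d s) (cmap d x).
Proof.
move=> hc hd cx dx ss.
have st := smooth_trans hd hc dx cx.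
have e : trans d c (cmap d x) = cmap c x by rewrite (transE c dx).
apply: (@smooth_at_eq _ _ _ (fun w => (fun z => nloc c s z *m tjac c d z) (trans d c w))).
  apply: filterS (near_chart dx (near_dom cx)) => _ [y [-> dy cw]].
  by rewrite (transE c dy) !(nlocE s dy, nlocE s cw) (nmx_trans hc hd cw dy) mulmxA.
apply: (@smooth_at_comp _ _ _ _ _ (trans d c) (fun z => nloc c s z *m tjac c d z)).
  exact: st.
by rewrite e; apply: smooth_at_mulmx; [exact: ss|exact: smooth_tjac].
Qed.

Lemma smooth_floc c d (f : M -> R) x : charts (f := M) c -> charts (f := M) d ->
  dom c x -> dom d x ->
  smooth_at (f \o cinv c) (cmap c x) -> smooth_at (f \o cinv d) (cmap d x).
Proof.
move=> hc hd cx dx sf.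
have st := smooth_trans hd hc dx cx.
apply: (@smooth_at_eq _ _ _ (fun w => (f \o cinv c) (trans d c w))).
  apply: filterS (near_chart dx (near_dom cx)) => _ [y [-> dy cw]].
  by rewrite /= (transE c dy) !(cinvK dy, cinvK cw).
by apply: (@smooth_at_comp _ _ _ _ _ (trans d c) (f \o cinv c)); [exact: st|rewrite (transE c dx)].
Qed.

Lemma vfieldP (U : set M) X : open U ->
  (vfield U X <-> forall x, U x -> exists c,
     [/\ charts (f := M) c, dom c x & smooth_at (tloc c X) (cmap c x)]).
Proof.
move=> oU; split=> [h x Ux|h c hc].
  exists (chart_at x); split; [exact: chart_at_charts|exact: chart_at_dom|].
  have /(smooth_on_chart _ _ oU) := h _ (chart_at_charts x).
  by apply=> //; exact: chart_at_dom.
apply/smooth_on_chart => // x cx /h[d [hd dx sd]]; exact: smooth_tloc sd.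
Qed.

Lemma nsectionP (U : set M) s : open U ->
  (nsection U s <-> forall x, U x -> exists c,
     [/\ charts (f := M) c, dom c x & smooth_at (nloc c s) (cmap c x)]).
Proof.
move=> oU; split=> [h x Ux|h c hc].
  exists (chart_at x); split; [exact: chart_at_charts|exact: chart_at_dom|].
  have /(smooth_on_chart _ _ oU) := h _ (chart_at_charts x).
  by apply=> //; exact: chart_at_dom.
apply/smooth_on_chart => // x cx /h[d [hd dx sd]]; exact: smooth_nloc sd.
Qed.

Lemma smooth_funP (U : set M) f : open U ->
  (smooth_fun U f <-> forall x, U x -> exists c,
     [/\ charts (f := M) c, dom c x & smooth_at (f \o cinv c) (cmap c x)]).
Proof.
move=> oU; split=> [h x Ux|h c hc].
  exists (chart_at x); split; [exact: chart_at_charts|exact: chart_at_dom|].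
  have /(smooth_on_chart _ _ oU) := h _ (chart_at_charts x).
  by apply=> //; exact: chart_at_dom.
apply/smooth_on_chart => // x cx /h[d [hd dx sd]]; exact: smooth_floc sd.
Qed.

Lemma vfield_smooth (U : set M) X c x : open U -> vfield U X -> U x ->
  charts (f := M) c -> dom c x -> smooth_at (tloc c X) (cmap c x).
Proof. by move=> oU h Ux hc cx; move/(smooth_on_chart _ _ oU): (h _ hc); apply. Qed.

Lemma nsection_smooth (U : set M) s c x : open U -> nsection U s -> U x ->
  charts (f := M) c -> dom c x -> smooth_at (nloc c s) (cmap c x).
Proof. by move=> oU h Ux hc cx; move/(smooth_on_chart _ _ oU): (h _ hc); apply. Qed.

Lemma smooth_fun_smooth (U : set M) f c x : open U -> smooth_fun U f -> U x ->
  charts (f := M) c -> dom c x -> smooth_at (f \o cinv c) (cmap c x).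
Proof. by move=> oU h Ux hc cx; move/(smooth_on_chart _ _ oU): (h _ hc); apply. Qed.

(** [bracket] is computed at each point in the preferred chart of that point, a choice that varies
    without any continuity. By [vbracket_push] it can be computed in one fixed chart, where it may
    be differentiated. *)
Lemma tcoord_bracket c X Y x : charts (f := M) c -> dom c x ->
  smooth_at (tloc c X) (cmap c x) -> smooth_at (tloc c Y) (cmap c x) ->
  tcoord c x (bracket X Y x) = vbracket (tloc c X) (tloc c Y) (cmap c x).
Proof.
move=> hc cx sX sY; set a := chart_at x.
have ha : charts (f := M) a by exact: chart_at_charts.
have ax : dom a x by exact: chart_at_dom.
have saX : smooth_at (tloc a X) (cmap a x) by exact: smooth_tloc sX.
have saY : smooth_at (tloc a Y) (cmap a x) by exact: smooth_tloc sY.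
rewrite tcoordE /bracket -/a /base -/a -(transE c ax).
have e := transE c ax.
apply/esym; apply: vbracket_push.
- exact: smooth_trans ha hc ax cx.
- exact: saX.
- exact: saY.
- by rewrite e.
- by rewrite e.
- exact: tloc_trans ha hc ax cx.
- exact: tloc_trans ha hc ax cx.
Qed.

Lemma smooth_bracket c X Y x : charts (f := M) c -> dom c x ->
  smooth_at (tloc c X) (cmap c x) -> smooth_at (tloc c Y) (cmap c x) ->
  smooth_at (tloc c (bracket X Y)) (cmap c x).
Proof.
move=> hc cx sX sY; apply: smooth_at_eq (smooth_at_vbracket sX sY).
have n : \forall z \near cmap c x, smooth_at (tloc c X) z /\ smooth_at (tloc c Y) z.
  by apply: filterS2 (smooth_at_near sX) (smooth_at_near sY) => z.
apply: filterS2 n (near_chart cx (near_dom cx)) => z [sXz sYz] [y [ey cy _]].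
by move: sXz sYz; rewrite ey (tlocE _ cy) => a b; rewrite (tcoord_bracket hc cy a b).
Qed.

Lemma vfield_bracket (U : set M) X Y : open U -> vfield U X -> vfield U Y ->
  vfield U (bracket X Y).
Proof.
move=> oU vX vY; apply/vfieldP => // x Ux; exists (chart_at x).
have h := chart_at_charts x; have d := chart_at_dom x.
by split=> //; apply: smooth_bracket => //; apply: (vfield_smooth oU).
Qed.

(** The vector fields, and below the sections of N, with constant components in the chart c: the
    test objects on which connections and brackets are evaluated. They are smooth on [dom c]. *)
Definition cfield c (v : TV) (y : M) : TV := tvec c y v.
Definition csec c (w : NV) (y : M) : NV := w *m invmx (nmx c y).

Lemma cfieldE c v y : cfield c v y = tvec c y v.
Proof. by []. Qed.

Lemma csecE c w y : csec c w y = w *m invmx (nmx c y).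
Proof. by []. Qed.

Lemma near_tloc_cfield c v x : charts (f := M) c -> dom c x ->
  \forall z \near cmap c x, tloc c (cfield c v) z = v.
Proof.
move=> hc cx; apply: filterS (near_chart cx (near_dom cx)) => _ [y [-> cy _]].
by rewrite tlocE // /cfield tvecK.
Qed.

Lemma near_nloc_csec c w x : charts (f := M) c -> dom c x ->
  \forall z \near cmap c x, nloc c (csec c w) z = w.
Proof.
move=> hc cx; apply: filterS (near_chart cx (near_dom cx)) => _ [y [-> cy _]].
by rewrite nlocE // /csec mulmxKV // nmx_unit.
Qed.

Lemma vfield_cfield c v : charts (f := M) c -> vfield (dom c) (cfield c v).
Proof.
move=> hc; apply/vfieldP; first exact: dom_open.
move=> x cx; exists c; split=> //; apply: smooth_at_eq (smooth_at_cst v _).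
by apply: filterS (near_tloc_cfield v hc cx) => z ->.
Qed.

Lemma nsection_csec c w : charts (f := M) c -> nsection (dom c) (csec c w).
Proof.
move=> hc; apply/nsectionP; first exact: dom_open.
move=> x cx; exists c; split=> //; apply: smooth_at_eq (smooth_at_cst w _).
by apply: filterS (near_nloc_csec w hc cx) => z ->.
Qed.

Lemma piN_cfield c v x : charts (f := M) c -> dom c x ->
  piN (cfield c v) x = csec c (rsubmx v) x.
Proof. by move=> hc cx; rewrite /piN /cfield rsubmx_tvec. Qed.

Lemma nloc_piN c X z : charts (f := M) c -> dom c (cinv c z) ->
  nloc c (piN X) z = rsubmx (tloc c X z).
Proof. by move=> hc cz; rewrite nloc_piN_E tloc_E rsubmx_tcoord. Qed.

Lemma vfieldS (U V : set M) X : V `<=` U -> vfield U X -> vfield V X.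
Proof.
move=> VU h c hc vs z [x [cx Vx] <-]; apply: (h c hc); exists x => //.
by split=> //; exact: VU.
Qed.

Lemma nsectionS (U V : set M) s : V `<=` U -> nsection U s -> nsection V s.
Proof.
move=> VU h c hc vs z [x [cx Vx] <-]; apply: (h c hc); exists x => //.
by split=> //; exact: VU.
Qed.

Lemma smooth_funS (U V : set M) f : V `<=` U -> smooth_fun U f -> smooth_fun V f.
Proof.
move=> VU h c hc vs z [x [cx Vx] <-]; apply: (h c hc); exists x => //.
by split=> //; exact: VU.
Qed.

Lemma leaf_fieldS (U V : set M) Y : V `<=` U -> leaf_field U Y -> leaf_field V Y.
Proof. by move=> VU [v h]; split; [exact: vfieldS v|move=> x /VU; exact: h]. Qed.

Lemma nsection_piN (U : set M) X : open U -> vfield U X -> nsection U (piN X).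
Proof.
move=> oU vX; apply/nsectionP => // x Ux; exists (chart_at x).
have h := chart_at_charts x; have d := chart_at_dom x; split=> //.
apply: (@smooth_at_eq _ _ _ (fun z => rsubmx (tloc (chart_at x) X z))).
  by apply: filterS (near_chart d (near_dom d)) => _ [y [-> cy _]]; rewrite nloc_piN // cinvK.
by apply: smooth_at_lin; [exact: rsubmx_linear|exact: (vfield_smooth oU vX)].
Qed.

Lemma leaf_rsubmx_tcoord c x v : charts (f := M) c -> dom c x ->
  (rsubmx (tcoord c x v) = 0) <-> (rsubmx v = 0).
Proof.
move=> hc cx; rewrite rsubmx_tcoord //; split=> [h|->]; last by rewrite mul0mx.
by rewrite -[LHS](mulmxK (nmx_unit hc cx)) h mul0mx.
Qed.

Lemma row_mx_leaf (v : TV) : rsubmx v = 0 -> v = row_mx (lsubmx v) 0.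
Proof. by move=> h; rewrite -[LHS]hsubmxK h. Qed.

Lemma leaf_field_cfield c a : charts (f := M) c ->
  leaf_field (dom c) (cfield c (row_mx a 0)).
Proof.
move=> hc; split; first exact: vfield_cfield.
by move=> x cx; rewrite rsubmx_tvec // row_mxKr mul0mx.
Qed.

End Charts.

Local Opaque trans tjac nmx tcoord tloc nloc.

(** * Connection matrices *)

Lemma add_sub_cancel (V : zmodType) (a b u v : V) : a + u - (b + v) - (a - b) = u - v.
Proof. by rewrite opprD addrACA [a - b + _]addrC addrK. Qed.

Section Connections.
Context {R : realType} {p k : nat} (M : foliated_manifold R p k).
Local Notation TV := 'rV[R]_(p + k).
Local Notation NV := 'rV[R]_k.
Local Notation chartM := (chart R (pt M) (p + k)).
Implicit Types (c d e : chartM) (x y : M) (nabla : covderiv M).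

Lemma dfun_chart c (f : M -> R) x v : charts (f := M) c -> dom c x ->
  smooth_at (f \o cinv c) (cmap c x) ->
  dfun f x v = 'D_(tcoord c x v) (f \o cinv c) (cmap c x).
Proof.
move=> hc cx sf; set a := chart_at x.
have ha : charts (f := M) a by exact: chart_at_charts.
have ax : dom a x by exact: chart_at_dom.
have e := transE c ax.
have st := smooth_trans ha hc ax cx.
rewrite tcoordE -/a.
have d2 : differentiable (f \o cinv c) (trans a c (cmap a x)).
  by rewrite e; exact: smooth_at_diff.
rewrite -[X in _ = 'D_ _ _ X]e -(derive_comp v (smooth_at_diff st) d2).
apply: near_eq_derive; apply: filterS (near_chart ax (near_dom cx)) => _ [y [-> ay cy]].
by rewrite /= (transE c ay) (cinvK ay) (cinvK cy).
Qed.

Lemma smooth_fun_cst_near (V : set M) (f : M -> R) (a : R) : open V ->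
  (forall x, V x -> f x = a) -> smooth_fun V f /\ forall x v, V x -> dfun f x v = 0.
Proof.
move=> oV h.
have n x c : V x -> dom c x -> \forall z \near cmap c x, (f \o cinv c) z = a.
  move=> Vx cx; apply: filterS (near_chart cx (open_nbhs_nbhs (conj oV Vx))) => _ [y [-> cy Vy]].
  by rewrite /= (cinvK cy) h.
split=> [|x v Vx].
  apply/smooth_funP => // x Vx; exists (chart_at x).
  split; [exact: chart_at_charts|exact: chart_at_dom|].
  apply: smooth_at_eq (smooth_at_cst a _).
  by apply: filterS (n x _ Vx (chart_at_dom x)) => z ->.
by rewrite /dfun /base (near_eq_derive v (n x _ Vx (chart_at_dom x))) derive_cst.
Qed.

Lemma connection_local nabla (U V : set M) x v s t : is_connection U nabla ->
  open V -> V `<=` U -> V x -> nsection V s -> nsection V t ->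
  (forall y, V y -> s y = t y) -> nabla x v s = nabla x v t.
Proof.
move=> [_ _ lei _] oV VU Vx ss st e.
pose f y : R := (`[< V y >])%:R.
have f1 y : V y -> f y = 1 by move=> Vy; rewrite /f asboolT.
have [sf df] := smooth_fun_cst_near oV f1.
have E : (fun y => f y *: s y) = (fun y => f y *: t y).
  apply/funext => y; have [Vy|nVy] := pselect (V y); first by rewrite e.
  by rewrite /f asboolF // !scale0r.
have := lei V x v f s oV VU Vx sf ss; rewrite E (lei V x v f t oV VU Vx sf st).
by rewrite (df x v Vx) (f1 x Vx) !scale0r !scale1r !add0r.
Qed.

Lemma nsection0 (V : set M) : open V -> nsection V (fun _ => 0).
Proof.
move=> oV; apply/nsectionP => // x Vx; exists (chart_at x).
split; [exact: chart_at_charts|exact: chart_at_dom|].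
apply: smooth_at_eq (smooth_at_cst (0 : NV) _).
apply: filterS (near_chart (chart_at_dom x) (near_dom (chart_at_dom x))) => _ [y [-> cy _]].
by rewrite (nlocE _ cy) mul0mx.
Qed.

Lemma nsectionD (V : set M) s t : open V -> nsection V s -> nsection V t ->
  nsection V (fun y => s y + t y).
Proof.
move=> oV ss st; apply/nsectionP => // x Vx; exists (chart_at x).
have hc := chart_at_charts x; have cx := chart_at_dom x; split=> //.
apply: smooth_at_eq (smooth_atD (nsection_smooth oV ss Vx hc cx) (nsection_smooth oV st Vx hc cx)).
apply: filterS (near_chart cx (near_dom cx)) => _ [y [-> cy _]].
by rewrite !(nlocE _ cy) mulmxDl.
Qed.

Lemma nsectionZ (V : set M) f s : open V -> smooth_fun V f -> nsection V s ->
  nsection V (fun y => f y *: s y).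
Proof.
move=> oV sf ss; apply/nsectionP => // x Vx; exists (chart_at x).
have hc := chart_at_charts x; have cx := chart_at_dom x; split=> //.
apply: smooth_at_eq (smooth_atZ (smooth_fun_smooth oV sf Vx hc cx) (nsection_smooth oV ss Vx hc cx)).
apply: filterS (near_chart cx (near_dom cx)) => _ [y [-> cy _]].
by rewrite /= !(nlocE _ cy) (cinvK cy) scalemxAl.
Qed.

Lemma nsection_sum (V : set M) (I : Type) (r : seq I) (s : I -> M -> NV) : open V ->
  (forall i, nsection V (s i)) -> nsection V (fun y => \sum_(i <- r) s i y).
Proof.
move=> oV h; elim: r => [|i r IH].
  have -> : (fun y : M => \sum_(i <- [::]) s i y) = fun=> 0 by apply/funext => y; rewrite big_nil.
  exact: nsection0.
have -> : (fun y : M => \sum_(i <- i :: r) s i y) = fun y => s i y + \sum_(i <- r) s i y.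
  by apply/funext => y; rewrite big_cons.
exact: nsectionD.
Qed.

Lemma connection_sum nabla (U V : set M) x v (I : Type) (r : seq I) (s : I -> M -> NV) :
  is_connection U nabla -> open V -> V `<=` U -> V x ->
  (forall i, nsection V (s i)) ->
  nabla x v (fun y => \sum_(i <- r) s i y) = \sum_(i <- r) nabla x v (s i).
Proof.
move=> [_ add lei _] oV VU Vx h; elim: r => [|i r IH].
  rewrite big_nil.
  have -> : (fun y : M => \sum_(i <- [::]) s i y) = fun y => (0 : R) *: (0 : NV).
    by apply/funext => y; rewrite big_nil scaler0.
  have [sf df] := @smooth_fun_cst_near V (fun=> 0) 0 oV (fun _ _ => erefl).
  have := lei V x v (fun=> 0) (fun=> 0) oV VU Vx sf (nsection0 oV).
  by rewrite [dfun _ _ _ *: _]scaler0 [X in _ + X]scale0r addr0.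
have -> : (fun y : M => \sum_(i <- i :: r) s i y) = fun y => s i y + \sum_(i <- r) s i y.
  by apply/funext => y; rewrite big_cons.
rewrite big_cons -IH; apply: (add _ _ _ _ _ oV VU Vx (h i)).
exact: nsection_sum.
Qed.

Definition cmx nabla c x (v : TV) : 'M[R]_k :=
  \matrix_i (nabla x v (csec c (delta_mx 0 i)) *m nmx c x).

Lemma row_cmx nabla c x v i :
  row i (cmx nabla c x v) = nabla x v (csec c (delta_mx 0 i)) *m nmx c x.
Proof. by apply/rowP => j; rewrite !mxE. Qed.

Lemma conn_mxE nabla x v : conn_mx nabla x v = cmx nabla (chart_at x) x v.
Proof. by apply/row_matrixP => i; rewrite row_cmx rowK nmx_at mulmx1. Qed.

(** The formula nabla s = ds + s G. The section agrees with its frame expansion only on the domain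
    of c, so [connection_local] is applied before the Leibniz rule. *)
Lemma connectionE nabla (U V : set M) c x v s : is_connection U nabla ->
  open V -> V `<=` U -> V x -> nsection V s -> charts (f := M) c -> dom c x ->
  nabla x v s *m nmx c x =
  'D_(tcoord c x v) (nloc c s) (cmap c x) + (s x *m nmx c x) *m cmx nabla c x v.
Proof.
move=> cn oV VU Vx ss hc cx.
have [lin add lei sm] := cn.
pose V' := V `&` dom c.
have oV' : open V' by apply: openI => //; exact: dom_open.
have V'x : V' x by [].
have V'V : V' `<=` V by move=> y [].
have V'c : V' `<=` dom c by move=> y [].
have V'U : V' `<=` U by move=> y /V'V /VU.
have ss' := nsectionS V'V ss.
pose f i y : R := (s y *m nmx c y) 0 i.
have fl i : f i \o cinv c = (fun z => nloc c s z 0 i) by [].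
have sf0 i y : V' y -> smooth_at (f i \o cinv c) (cmap c y).
  move=> V'y; rewrite fl; apply: smooth_at_entry.
  by apply: (nsection_smooth oV' ss') => //; case: V'y.
have sf i : smooth_fun V' (f i).
  by apply/smooth_funP => // y V'y; exists c; split; [|case: V'y|exact: sf0].
have se i : nsection V' (csec c (delta_mx 0 i)).
  by apply: nsectionS V'c _; exact: nsection_csec.
have sfe i : nsection V' (fun y => f i y *: csec c (delta_mx 0 i) y) by exact: nsectionZ.
have E : nabla x v s = nabla x v (fun y => \sum_i f i y *: csec c (delta_mx 0 i) y).
  apply: (connection_local v cn oV' V'U V'x ss').
    exact: (nsection_sum (index_enum 'I_k) oV' sfe).
  move=> y [_ cy]; rewrite -[LHS](mulmxK (nmx_unit hc cy)).
  rewrite [s y *m nmx c y]row_sum_delta mulmx_suml; apply: eq_bigr => i _.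
  by rewrite -scalemxAl.
rewrite E (connection_sum v (index_enum 'I_k) cn oV' V'U V'x sfe).
rewrite mulmx_suml.
transitivity (\sum_i ('D_(tcoord c x v) (nloc c s) (cmap c x) 0 i *: delta_mx 0 i +
   (s x *m nmx c x) 0 i *: row i (cmx nabla c x v))).
  apply: eq_bigr => i _.
  rewrite (lei V' x v (f i) _ oV' V'U V'x (sf i) (se i)) mulmxDl -!scalemxAl row_cmx.
  rewrite /csec mulmxKV ?nmx_unit //.
  rewrite (dfun_chart v hc cx (sf0 i x V'x)) fl derive_entry //.
  by apply: smooth_at_diff; exact: (nsection_smooth oV' ss').
rewrite big_split /= -row_sum_delta; congr (_ + _).
by rewrite [RHS]mulmx_sum_row.
Qed.

Lemma cmx_linear nabla (U : set M) c x : is_connection U nabla -> U x ->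
  linear (cmx nabla c x).
Proof.
move=> [lin _ _ _] Ux a u v; apply/row_matrixP => i.
by rewrite linearP /= !row_cmx lin // mulmxDl -scalemxAl.
Qed.

(** The connection matrix G as a function on the image of the chart, with the direction also in
    chart components. Leafwise derivatives of the connection are derivatives of this function in z
    at fixed u. *)
Definition lcmx nabla c (u : TV) (z : TV) : 'M[R]_k :=
  cmx nabla c (cinv c z) (tvec c (cinv c z) u).

Lemma lcmxE nabla c u x : dom c x -> lcmx nabla c u (cmap c x) = cmx nabla c x (tvec c x u).
Proof. by move=> cx; rewrite /lcmx cinvK. Qed.

Lemma cmx_lcmx nabla c x v : charts (f := M) c -> dom c x ->
  cmx nabla c x v = lcmx nabla c (tcoord c x v) (cmap c x).
Proof. by move=> hc cx; rewrite lcmxE // tcoordK. Qed.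

Lemma lcmx_linear nabla (U : set M) c x : is_connection U nabla -> U x ->
  charts (f := M) c -> dom c x -> linear (fun u => lcmx nabla c u (cmap c x)).
Proof.
move=> cn Ux hc cx a u v; rewrite !(lcmxE _ _ cx).
by rewrite (tvec_linear hc cx) (cmx_linear c cn Ux).
Qed.

Lemma smooth_lcmx nabla (U : set M) c x u : is_connection U nabla -> open U ->
  U x -> charts (f := M) c -> dom c x -> smooth_at (lcmx nabla c u) (cmap c x).
Proof.
move=> [_ _ _ sm] oU Ux hc cx; apply: smooth_at_mx => i j.
pose V := U `&` dom c.
have oV : open V by apply: openI => //; exact: dom_open.
have VU : V `<=` U by move=> y [].
have Vc : V `<=` dom c by move=> y [].
have vX : vfield V (cfield c u) by apply: vfieldS Vc _; exact: vfield_cfield.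
have ss : nsection V (csec c (delta_mx 0 i)) by apply: nsectionS Vc _; exact: nsection_csec.
have sn := sm V (cfield c u) (csec c (delta_mx 0 i)) oV VU vX ss.
have Vx : V x by [].
apply: smooth_at_eq (smooth_at_entry 0 j (nsection_smooth oV sn Vx hc cx)).
apply: filterS (near_chart cx (near_dom cx)) => _ [y [-> cy _]].
by rewrite (nlocE _ cy) (lcmxE _ _ cy) [RHS]mxE.
Qed.

Lemma smooth_lcmx_app nabla (U : set M) c x (u : TV -> TV) : is_connection U nabla -> open U ->
  U x -> charts (f := M) c -> dom c x -> smooth_at u (cmap c x) ->
  smooth_at (fun z => lcmx nabla c (u z) z) (cmap c x).
Proof.
move=> cn oU Ux hc cx su.
pose g z := \sum_j u z 0 j *: lcmx nabla c (delta_mx 0 j) z.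
apply: (@smooth_at_eq _ _ _ g).
  apply: filterS (near_chart cx (open_nbhs_nbhs (conj oU Ux))) => _ [y [-> cy Uy]].
  rewrite /g [u _ in RHS]row_sum_delta.
  have L := lcmx_linear cn Uy hc cy.
  pose LL : {linear TV -> 'M[R]_k} := HB.pack (fun u => lcmx nabla c u (cmap c y))
     (GRing.isLinear.Build _ _ _ _ _ L).
  rewrite -[RHS]/(LL (\sum_j u (cmap c y) 0 j *: delta_mx 0 j)) linear_sum.
  by apply: eq_bigr => j _; rewrite linearZ.
apply: smooth_at_sum => j _; apply: smooth_atZ; first exact: smooth_at_entry.
exact: (smooth_lcmx _ cn oU Ux hc cx).
Qed.

(** Constant fields of the chart commute, so the Bott condition applied to a constant leaf field and
    to constant lifts of the frame gives 0. *)
Lemma adapted_cmx nabla (U : set M) c x v : adapted_connection U nabla -> open U ->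
  U x -> charts (f := M) c -> dom c x -> rsubmx v = 0 -> cmx nabla c x v = 0.
Proof.
move=> [cn ad] oU Ux hc cx v0.
pose V := U `&` dom c.
have oV : open V by apply: openI => //; exact: dom_open.
have VU : V `<=` U by move=> y [].
have Vc : V `<=` dom c by move=> y [].
have Vx : V x by [].
have t0 : rsubmx (tcoord c x v) = 0 by apply/leaf_rsubmx_tcoord.
pose a := lsubmx (tcoord c x v).
pose Y := cfield c (row_mx a 0).
have lY : leaf_field V Y by apply: leaf_fieldS Vc _; exact: leaf_field_cfield.
have Yx : Y x = v by rewrite /Y /cfield /a -(row_mx_leaf t0) tcoordK.
apply/row_matrixP => i; rewrite row_cmx row0.
pose X := cfield c (row_mx 0 (delta_mx 0 i)).
have vX : vfield V X by apply: vfieldS Vc _; exact: vfield_cfield.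
have ss : nsection V (csec c (delta_mx 0 i)) by apply: nsectionS Vc _; exact: nsection_csec.
have -> : nabla x v (csec c (delta_mx 0 i)) = nabla x v (piN X).
  apply: (connection_local v cn oV VU Vx ss).
    exact: nsection_piN.
  by move=> y [_ cy]; rewrite piN_cfield // row_mxKr.
rewrite -Yx (ad V X Y oV VU vX lY x Vx) /piN.
have [vY _] := lY.
have sX := vfield_smooth oV vX Vx hc cx.
have sY := vfield_smooth oV vY Vx hc cx.
have d0 u w : 'D_w (tloc c (cfield c u)) (cmap c x) = 0.
  by rewrite (near_eq_derive w (near_tloc_cfield u hc cx)) derive_cst.
have E1 : 'D_(tloc c Y (cmap c x)) (tloc c X) (cmap c x) = 0 by exact: d0.
have E2 : 'D_(tloc c X (cmap c x)) (tloc c Y) (cmap c x) = 0 by exact: d0.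
clear Yx; clearbody X Y.
rewrite -(rsubmx_tcoord _ hc cx) (tcoord_bracket hc cx sY sX) /vbracket E1 E2.
by rewrite subrr linear0.
Qed.

Lemma adapted_lcmx nabla (U : set M) c x u u' : adapted_connection U nabla -> open U ->
  U x -> charts (f := M) c -> dom c x -> rsubmx u = rsubmx u' ->
  lcmx nabla c u (cmap c x) = lcmx nabla c u' (cmap c x).
Proof.
move=> ad oU Ux hc cx e; have [cn _] := ad.
have L := lcmx_linear cn Ux hc cx.
have -> : u = 1 *: (u - u') + u' by rewrite scale1r subrK.
rewrite L scale1r lcmxE // (adapted_cmx ad oU Ux hc cx) ?add0r //.
rewrite rsubmx_tvec // -[rsubmx (u - u')]/(rsubmx (u - u')).
have -> : rsubmx (u - u') = 0 by rewrite linearB /= e subrr.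
by rewrite mul0mx.
Qed.

(** The derivatives of the components of X and Y cancel against the bracket; what is left is
    tensorial, the skew part of the connection matrix. *)
Lemma torsionE nabla (U V : set M) c x X Y : is_connection U nabla ->
  open V -> V `<=` U -> V x -> vfield V X -> vfield V Y ->
  charts (f := M) c -> dom c x ->
  torsion nabla X Y x *m nmx c x =
  (rsubmx (Y x) *m nmx c x) *m cmx nabla c x (X x) -
  (rsubmx (X x) *m nmx c x) *m cmx nabla c x (Y x).
Proof.
move=> cn oV VU Vx vX vY hc cx.
have sX := vfield_smooth oV vX Vx hc cx.
have sY := vfield_smooth oV vY Vx hc cx.
rewrite /torsion !mulmxBl.
rewrite (connectionE (X x) cn oV VU Vx (nsection_piN oV vY) hc cx).
rewrite (connectionE (Y x) cn oV VU Vx (nsection_piN oV vX) hc cx).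
rewrite /piN -(rsubmx_tcoord (bracket X Y x) hc cx) (tcoord_bracket hc cx sX sY) /vbracket.
have D Z v : smooth_at (tloc c Z) (cmap c x) ->
  'D_v (nloc c (fun x => rsubmx (Z x))) (cmap c x) = rsubmx ('D_v (tloc c Z) (cmap c x)).
  move=> sZ; rewrite -(derive_lin v (@rsubmx_linear _ _ _ _) (smooth_at_diff sZ)).
  apply: near_eq_derive; apply: filterS (near_chart cx (near_dom cx)) => _ [y [-> cy _]].
  by rewrite (nlocE _ cy) (tlocE _ cy) rsubmx_tcoord.
rewrite (D Y _ sY) (D X _ sX) (tlocE X cx) (tlocE Y cx).
have -> A B : rsubmx (A - B) = rsubmx A - rsubmx B :> NV by exact: linearB.
exact: add_sub_cancel.
Qed.

Lemma torsionless_lcmx nabla (U : set M) c x (u v : TV) : is_connection U nabla -> open U ->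
  U x -> charts (f := M) c -> dom c x -> torsionless U nabla ->
  rsubmx v *m lcmx nabla c u (cmap c x) = rsubmx u *m lcmx nabla c v (cmap c x).
Proof.
move=> cn oU Ux hc cx tl.
pose V := U `&` dom c.
have oV : open V by apply: openI => //; exact: dom_open.
have VU : V `<=` U by move=> y [].
have Vc : V `<=` dom c by move=> y [].
have Vx : V x by [].
have vF w : vfield V (cfield c w) by apply: vfieldS Vc _; exact: vfield_cfield.
have e w : rsubmx (cfield c w x) *m nmx c x = rsubmx w.
  by rewrite (rsubmx_tvec _ hc cx) mulmxKV // nmx_unit.
have := torsionE cn oV VU Vx (vF u) (vF v) hc cx.
rewrite (tl V _ _ oV VU (vF u) (vF v) x Vx) mul0mx (e u) (e v).
rewrite (lcmxE nabla u cx) (lcmxE nabla v cx).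
by move=> /esym /eqP; rewrite subr_eq0 => /eqP.
Qed.

Lemma lcmx_torsionless nabla (U : set M) : is_connection U nabla -> open U ->
  (forall x, U x -> exists c, [/\ charts (f := M) c, dom c x & forall u v : TV,
     rsubmx v *m lcmx nabla c u (cmap c x) = rsubmx u *m lcmx nabla c v (cmap c x)]) ->
  torsionless U nabla.
Proof.
move=> cn oU h V X Y oV VU vX vY x Vx.
have [c [hc cx e]] := h x (VU x Vx).
rewrite -[LHS](mulmxK (nmx_unit hc cx)) (torsionE cn oV VU Vx vX vY hc cx).
rewrite -(rsubmx_tcoord (X x) hc cx) -(rsubmx_tcoord (Y x) hc cx).
by rewrite (cmx_lcmx nabla (X x) hc cx) (cmx_lcmx nabla (Y x) hc cx) e subrr mul0mx.
Qed.

(** Connections form an affine space over tensors; symmetrization and the trace correction are both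
    shifts of this kind. *)
Definition shift_conn nabla (S : forall x : M, TV -> NV -> NV) : covderiv M :=
  fun x v s => nabla x v s + S x v (s x).

Lemma shift_connection nabla (U : set M) S : is_connection U nabla ->
  (forall x, U x -> forall s, linear ((S x)^~ s)) ->
  (forall x, U x -> forall v, linear (S x v)) ->
  (forall V X s, open V -> V `<=` U -> vfield V X -> nsection V s ->
     nsection V (fun x => S x (X x) (s x))) ->
  is_connection U (shift_conn nabla S).
Proof.
move=> [lin add lei sm] S1 S2 S3; split.
- move=> x s a v w Ux; rewrite /shift_conn lin // S1 //.
  by rewrite scalerDr addrACA.
- move=> V x v s t oV VU Vx ss st; rewrite /shift_conn (add V) //.
  have := S2 x (VU x Vx) v 1 (s x) (t x); rewrite !scale1r => ->.
  by rewrite addrACA.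
- move=> V x v f s oV VU Vx sf ss; rewrite /shift_conn (lei V) //.
  have S0 : S x v 0 = 0.
    have := S2 x (VU x Vx) v (-1) (s x) (s x).
    by rewrite !scaleN1r addNr addNr.
  have := S2 x (VU x Vx) v (f x) (s x) 0; rewrite S0 !addr0 => ->.
  by rewrite scalerDr addrA.
- move=> V X s oV VU vX ss; rewrite /shift_conn.
  exact: (nsectionD oV (sm V X s oV VU vX ss) (S3 V X s oV VU vX ss)).
Qed.

Lemma shift_adapted nabla (U : set M) S : adapted_connection U nabla ->
  is_connection U (shift_conn nabla S) ->
  (forall x v s, U x -> rsubmx v = 0 -> S x v s = 0) ->
  adapted_connection U (shift_conn nabla S).
Proof.
move=> [_ ad] cn S0; split=> // V X Y oV VU vX lY x Vx.
rewrite /shift_conn (ad V) // S0 ?addr0 //; first exact: VU.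
by case: lY => _; apply.
Qed.

Lemma mul_shift_cmx nabla S c x v w :
  (forall v, linear (S x v)) -> charts (f := M) c -> dom c x ->
  w *m cmx (shift_conn nabla S) c x v =
  w *m cmx nabla c x v + S x v (w *m invmx (nmx c x)) *m nmx c x.
Proof.
move=> S2 hc cx.
have E i : row i (cmx (shift_conn nabla S) c x v) = row i (cmx nabla c x v) +
    S x v (delta_mx 0 i *m invmx (nmx c x)) *m nmx c x.
  by rewrite !row_cmx /shift_conn mulmxDl.
rewrite [LHS]mulmx_sum_row (eq_bigr _ (fun i _ => congr1 _ (E i))).
under eq_bigr do rewrite scalerDr.
rewrite big_split /= -mulmx_sum_row; congr (_ + _).
pose LL : {linear NV -> NV} := HB.pack (S x v) (GRing.isLinear.Build _ _ _ _ _ (S2 v)).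
rewrite [w in RHS]row_sum_delta mulmx_suml -[S x v _]/(LL _) linear_sum mulmx_suml.
by apply: eq_bigr => i _; rewrite -scalemxAl linearZ -scalemxAl.
Qed.

End Connections.

Local Opaque cfield csec cmx lcmx tvec.

(** * Foliated sections and connections *)

Lemma sub_eq00 (V : zmodType) (a b : V) : a = 0 -> b = 0 -> a - b = 0.
Proof. by move=> -> ->; rewrite subrr. Qed.

Section DeriveSum.
Context {R : realType}.
Lemma derive_fsum (V W : normedModType R) (I : Type) (r : seq I) (f : I -> V -> W) x v :
  (forall i, differentiable (f i) x) ->
  'D_v (fun y => \sum_(i <- r) f i y) x = \sum_(i <- r) 'D_v (f i) x.
Proof.
move=> df.
suff [] : differentiable (fun y => \sum_(i <- r) f i y) x /\
  'D_v (fun y => \sum_(i <- r) f i y) x = \sum_(i <- r) 'D_v (f i) x by [].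
elim: r => [|i r [IH1 IH2]].
  have -> : (fun y => \sum_(i <- [::]) f i y) = fun=> 0 :> W.
    by apply/funext => y; rewrite big_nil.
  by rewrite big_nil (derive_cst (0 : W)); split=> //; exact: differentiable_cst.
have -> : (fun y => \sum_(j <- i :: r) f j y) = fun y => f i y + \sum_(j <- r) f j y.
  by apply/funext => y; rewrite big_cons.
split; first exact: (differentiableD (df i) IH1).
by rewrite (derive_fD v (df i) IH1) IH2 big_cons.
Qed.

End DeriveSum.

Section Foliated.
Context {R : realType} {p k : nat} (M : foliated_manifold R p k).
Local Notation TV := 'rV[R]_(p + k).
Local Notation NV := 'rV[R]_k.
Local Notation chartM := (chart R (pt M) (p + k)).
Implicit Types (c d e : chartM) (x y : M) (nabla : covderiv M).

Lemma derive_lcmx_app nabla (U : set M) c x (u : TV -> TV) v : is_connection U nabla ->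
  open U -> U x -> charts (f := M) c -> dom c x -> smooth_at u (cmap c x) ->
  'D_v (fun z => lcmx nabla c (u z) z) (cmap c x) =
  lcmx nabla c ('D_v u (cmap c x)) (cmap c x) + 'D_v (lcmx nabla c (u (cmap c x))) (cmap c x).
Proof.
move=> cn oU Ux hc cx su.
have sumE y w : U y -> dom c y ->
    lcmx nabla c w (cmap c y) = \sum_j w 0 j *: lcmx nabla c (delta_mx 0 j) (cmap c y).
  move=> Uy cy; have L := lcmx_linear cn Uy hc cy.
  pose LL : {linear TV -> 'M[R]_k} := HB.pack (fun u => lcmx nabla c u (cmap c y))
     (GRing.isLinear.Build _ _ _ _ _ L).
  rewrite [w in LHS]row_sum_delta -[LHS]/(LL _) linear_sum.
  by apply: eq_bigr => j _; rewrite linearZ.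
have sl j := smooth_lcmx (delta_mx 0 j) cn oU Ux hc cx.
have dl j := smooth_at_diff (sl j).
have de j : differentiable (fun z => u z 0 j : R) (cmap c x).
  exact: smooth_at_diff (smooth_at_entry 0 j su).
have E (f : TV -> TV) : \forall z \near cmap c x, \sum_j f z 0 j *: lcmx nabla c (delta_mx 0 j) z =
    lcmx nabla c (f z) z.
  apply: filterS (near_chart cx (open_nbhs_nbhs (conj oU Ux))) => _ [y [-> cy Uy]].
  by rewrite -(sumE y _ Uy cy).
apply: etrans (esym (near_eq_derive v (E u))) _.
have E2 := near_eq_derive v (E (fun=> u (cmap c x))).
apply: etrans _ (congr1 (fun A => lcmx nabla c ('D_v u (cmap c x)) (cmap c x) + A) E2).
have Ez j := diffZ_fun (de j) (dl j).
rewrite (derive_fsum _ _ (fun j => (Ez j).1)).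
have d2 j : differentiable (fun z => u (cmap c x) 0 j *: lcmx nabla c (delta_mx 0 j) z) (cmap c x).
  exact: smooth_at_diff (smooth_at_scale (u (cmap c x) 0 j) (sl j)).
rewrite (derive_fsum _ _ d2).
rewrite (sumE x _ Ux cx) -big_split /=; apply: eq_bigr => j _.
rewrite (Ez j).2 (derive_entry v 0 j (smooth_at_diff su)); congr (_ + _).
by rewrite (derive_fZ (u (cmap c x) 0 j) v (dl j)).
Qed.

(** The bracket of X with the constant leaf field in direction a is minus the derivative of X in
    that direction. *)
Lemma foliated_field_leaf (V : set M) X c x (a : 'rV[R]_p) : open V ->
  foliated_field V X -> V x -> charts (f := M) c -> dom c x ->
  rsubmx ('D_(row_mx a 0) (tloc c X) (cmap c x)) = 0.
Proof.
move=> oV [vX fX] Vx hc cx.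
pose V' := V `&` dom c.
have oV' : open V' by apply: openI => //; exact: dom_open.
have VU : V' `<=` V by move=> y [].
have Vc : V' `<=` dom c by move=> y [].
have V'x : V' x by [].
set u : TV := row_mx a 0.
have lY : leaf_field V' (cfield c u) by apply: leaf_fieldS Vc _; exact: leaf_field_cfield.
have [_ /(_ x V'x) B] := fX V' (cfield c u) oV' VU lY.
have sX := vfield_smooth oV vX Vx hc cx.
have [vY _] := lY; have sY := vfield_smooth oV' vY V'x hc cx.
have d0 w : 'D_w (tloc c (cfield c u)) (cmap c x) = 0.
  by rewrite (near_eq_derive w (near_tloc_cfield u hc cx)) derive_cst.
have e := nbhs_singleton (near_tloc_cfield u hc cx).
have := rsubmx_tcoord (bracket X (cfield c u) x) hc cx.
rewrite B mul0mx (tcoord_bracket hc cx sX sY) => h0.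
have : vbracket (tloc c X) (tloc c (cfield c u)) (cmap c x) = - 'D_u (tloc c X) (cmap c x).
  by apply: etrans (congr2 (fun a b => a - b) (d0 _) (congr1 (fun w => 'D_w (tloc c X) (cmap c x)) e)) _; rewrite sub0r.
move=> h1; move: h0; rewrite h1 linearN /= => /eqP; rewrite oppr_eq0 => /eqP; exact.
Qed.

(** In [X, Y] = D_X Y - D_Y X the first term is tangent to the leaves because Y is so on a
    neighbourhood, the second by the hypothesis on X. *)
Lemma foliated_fieldI (V : set M) X : open V -> vfield V X ->
  (forall x, V x -> exists c, [/\ charts (f := M) c, dom c x &
     forall a : 'rV[R]_p, rsubmx ('D_(row_mx a 0) (tloc c X) (cmap c x)) = 0]) ->
  foliated_field V X.
Proof.
move=> oV vX h; split=> // W Y oW WV [vY lY]; have vXW := vfieldS WV vX.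
split; first exact: vfield_bracket.
move=> x Wx; have [c [hc cx D]] := h x (WV x Wx).
have sX := vfield_smooth oW vXW Wx hc cx.
have sY := vfield_smooth oW vY Wx hc cx.
apply/(leaf_rsubmx_tcoord _ hc cx); rewrite (tcoord_bracket hc cx sX sY) /vbracket.
have l0 : \forall z \near cmap c x, rsubmx (tloc c Y z) = 0.
  apply: filterS (near_chart cx (open_nbhs_nbhs (conj oW Wx))) => _ [y [-> cy Wy]].
  by rewrite (tlocE Y cy) (rsubmx_tcoord _ hc cy) lY // mul0mx.
have -> A B : rsubmx (A - B) = rsubmx A - rsubmx B :> NV by exact: linearB.
apply: sub_eq00.
  rewrite -(derive_lin _ (@rsubmx_linear _ _ _ _) (smooth_at_diff sY)).
  by rewrite (near_eq_derive _ l0) derive_cst.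
by rewrite (row_mx_leaf (nbhs_singleton l0)) D.
Qed.

Lemma foliated_section_leaf (V : set M) s c x (a : 'rV[R]_p) :
  foliated_section V s -> V x -> charts (f := M) c -> dom c x ->
  smooth_at (nloc c s) (cmap c x) /\ 'D_(row_mx a 0) (nloc c s) (cmap c x) = 0.
Proof.
move=> fs Vx hc cx; have [W [X [oW Wx WV fX e]]] := fs x Vx.
have [vX _] := fX; have sX := vfield_smooth oW vX Wx hc cx.
have E : \forall z \near cmap c x, rsubmx (tloc c X z) = nloc c s z.
  apply: filterS (near_chart cx (open_nbhs_nbhs (conj oW Wx))) => _ [y [-> cy Wy]].
  by rewrite (nlocE s cy) (e y Wy) (tlocE X cy) (rsubmx_tcoord _ hc cy).
split.
  by apply: smooth_at_eq E _; apply: smooth_at_lin; first exact: rsubmx_linear.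
rewrite -(near_eq_derive _ E) (derive_lin _ (@rsubmx_linear _ _ _ _) (smooth_at_diff sX)).
exact: foliated_field_leaf fX Wx hc cx.
Qed.

Lemma foliated_sectionI (V : set M) s c : open V -> V `<=` dom c ->
  charts (f := M) c -> nsection V s ->
  (forall x, V x -> forall a : 'rV[R]_p, 'D_(row_mx a 0) (nloc c s) (cmap c x) = 0) ->
  foliated_section V s.
Proof.
move=> oV Vc hc ss D x Vx.
(* The lift of s whose leaf components in c are 0. *)
pose X y := tvec c y (row_mx 0 (s y *m nmx c y)).
have E y : V y -> \forall z \near cmap c y, row_mx 0 (nloc c s z) = tloc c X z.
  move=> Vy; apply: filterS (near_chart (Vc y Vy) (open_nbhs_nbhs (conj oV Vy))) => _ [u [-> cu Vu]].
  by rewrite (tlocE X cu) (nlocE s cu) /X (tvecK hc cu).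
have sn y (Vy : V y) := nsection_smooth oV ss Vy hc (Vc y Vy).
exists V, X; split=> //.
  apply: foliated_fieldI => //.
    apply/vfieldP => // y Vy; exists c; split; [exact: hc|exact: Vc|].
    apply: smooth_at_eq (E y Vy) _; apply: smooth_at_lin (sn y Vy).
    exact: row_mx0_linear.
  move=> y Vy; exists c; split; [exact: hc|exact: Vc|move=> a].
  rewrite -(near_eq_derive _ (E y Vy)).
  rewrite (derive_lin _ (@row_mx0_linear _ _ _ _) (smooth_at_diff (sn y Vy))) D //.
  by rewrite row_mxKr.
by move=> y Vy; rewrite /piN /X (rsubmx_tvec _ hc (Vc y Vy)) row_mxKr mulmxK // nmx_unit //; exact: Vc.
Qed.

Lemma foliated_cfield c u : charts (f := M) c -> foliated_field (dom c) (cfield c u).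
Proof.
move=> hc; have oc := dom_open c.
apply: foliated_fieldI => //; first exact: vfield_cfield.
move=> x cx; exists c; split=> // a.
by rewrite (near_eq_derive _ (near_tloc_cfield u hc cx)) derive_cst linear0.
Qed.

Lemma foliated_fieldS (U V : set M) X : V `<=` U -> foliated_field U X -> foliated_field V X.
Proof.
move=> VU [vX fX]; split; first exact: vfieldS vX.
by move=> W Y oW WV; apply: fX => // y /WV /VU.
Qed.

(** Constant fields and constant frame sections are foliated, and the derivatives of the latter
    along the former are the rows of G. *)
Lemma foliated_connection_leaf nabla (U : set M) c x u (a : 'rV[R]_p) :
  foliated_connection U nabla -> open U -> U x -> charts (f := M) c -> dom c x ->
  'D_(row_mx a 0) (lcmx nabla c u) (cmap c x) = 0.
Proof.
move=> [[cn _] fc] oU Ux hc cx.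
pose V := U `&` dom c.
have oV : open V by apply: openI => //; exact: dom_open.
have VU : V `<=` U by move=> y [].
have Vc : V `<=` dom c by move=> y [].
have Vx : V x by [].
have fX : foliated_field V (cfield c u) by apply: foliated_fieldS Vc _; exact: foliated_cfield.
have sl := smooth_at_diff (smooth_lcmx u cn oU Ux hc cx).
apply/row_matrixP => i; rewrite row0.
have lr : linear (fun A : 'M[R]_k => row i A) by move=> b A B; rewrite linearP.
rewrite -(derive_lin _ lr sl).
have ss : nsection V (csec c (delta_mx 0 i)) by apply: nsectionS Vc _; exact: nsection_csec.
have fs : foliated_section V (csec c (delta_mx 0 i)).
  apply: (foliated_sectionI oV Vc hc ss) => y [_ cy] b.
  by rewrite (near_eq_derive _ (near_nloc_csec (delta_mx 0 i) hc cy)) derive_cst.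
have [_ D] := foliated_section_leaf a (fc V _ _ oV VU fX fs) Vx hc cx.
rewrite -[RHS]D; apply: near_eq_derive.
apply: filterS (near_chart cx (near_dom cx)) => _ [y [-> cy _]].
by rewrite (lcmxE nabla u cy) (nlocE _ cy) row_cmx.
Qed.

(** Take the leaf derivative of D_X s + s G(X). Second derivatives of s commute and s is leafwise
    constant, while the leaf derivative of X is tangent to the leaves and so is killed both by ds
    and by G. Only the leaf derivative of G remains. *)
Lemma foliated_connectionI nabla (U : set M) c : adapted_connection U nabla -> open U ->
  charts (f := M) c -> U `<=` dom c ->
  (forall x, U x -> forall u (a : 'rV[R]_p), 'D_(row_mx a 0) (lcmx nabla c u) (cmap c x) = 0) ->
  foliated_connection U nabla.
Proof.
move=> ad oU hc Uc D; split=> // V X s oV VU fX fs.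
have [cn _] := ad; have [_ _ _ sm] := cn; have [vX _] := fX.
have Vc : V `<=` dom c by move=> y /VU /Uc.
have ss : nsection V s.
  apply/nsectionP => // y Vy; exists c; split; [exact: hc|exact: Vc|].
  exact: (foliated_section_leaf 0 fs Vy hc (Vc y Vy)).1.
apply: (foliated_sectionI oV Vc hc); first exact: sm.
move=> x Vx a; have cx := Vc x Vx; have Ux := VU x Vx.
have sX := vfield_smooth oV vX Vx hc cx.
have sS := nsection_smooth oV ss Vx hc cx.
have E : \forall z \near cmap c x,
    'D_(tloc c X z) (nloc c s) z + nloc c s z *m lcmx nabla c (tloc c X z) z =
    nloc c (fun x => nabla x (X x) s) z.
  apply: filterS (near_chart cx (open_nbhs_nbhs (conj oV Vx))) => _ [y [-> cy Vy]].
  rewrite [RHS](nlocE _ cy) (connectionE (X y) cn oV VU Vy ss hc cy).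
  by rewrite (tlocE X cy) (nlocE s cy) (cmx_lcmx nabla (X y) hc cy).
rewrite -(near_eq_derive _ E).
have [sd dd] := smooth_at_derive_dir sS sX.
have sl := smooth_lcmx_app cn oU Ux hc cx sX.
have n0 : \forall z \near cmap c x, 'D_(row_mx a 0) (nloc c s) z = 0.
  apply: filterS (near_chart cx (open_nbhs_nbhs (conj oV Vx))) => _ [y [-> cy Vy]].
  exact: (foliated_section_leaf a fs Vy hc cy).2.
have lX := foliated_field_leaf a oV fX Vx hc cx.
rewrite (derive_fD _ (smooth_at_diff sd) (smooth_at_diff (smooth_at_mulmx sS sl))).
rewrite dd (derive_swap _ _ sS) (near_eq_derive _ n0) derive_cst add0r.
rewrite (row_mx_leaf lX) (foliated_section_leaf _ fs Vx hc cx).2 add0r.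
rewrite (derive_mulmx _ (smooth_at_diff sS) (smooth_at_diff sl)) (nbhs_singleton n0) mul0mx add0r.
rewrite (derive_lcmx_app _ cn oU Ux hc cx sX) D // addr0.
have r0 : rsubmx ('D_(row_mx a 0) (tloc c X) (cmap c x)) = rsubmx (0 : TV) by rewrite lX linear0.
rewrite (adapted_lcmx ad oU Ux hc cx r0).
have L := lcmx_linear cn Ux hc cx.
have := L (-1) 0 0; rewrite scaleN1r oppr0 addr0 scaleN1r addNr => ->.
by rewrite mulmx0.
Qed.

Lemma lcmx0 nabla (U : set M) c x : is_connection U nabla -> U x ->
  charts (f := M) c -> dom c x -> lcmx nabla c 0 (cmap c x) = 0.
Proof.
move=> cn Ux hc cx; have L := lcmx_linear cn Ux hc cx.
by have := L (-1) 0 0; rewrite scaleN1r oppr0 addr0 scaleN1r addNr.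
Qed.

End Foliated.

(** * Symmetrization and projective normalization *)

Lemma half_sub (R : realType) (V : lmodType R) (A B : V) :
  A - 2^-1 *: (A - B) = 2^-1 *: (A + B).
Proof.
rewrite scalerBr opprB addrCA scalerDr [RHS]addrC; congr (_ + _).
by rewrite -{1}[A]scale1r -scalerBl; congr (_ *: _); lra.
Qed.

Section Modify.
Context {R : realType} {p k : nat} (M : foliated_manifold R p k).
Local Notation TV := 'rV[R]_(p + k).
Local Notation NV := 'rV[R]_k.
Local Notation chartM := (chart R (pt M) (p + k)).
Implicit Types (c d e : chartM) (x y : M) (nabla : covderiv M).

(** The torsion T(v, s') as a pointwise tensor, for the lift s' of s with zero leaf components in
    the preferred chart. For an adapted connection the value does not depend on the lift. *)
Definition skew_part nabla x (v : TV) (s : NV) : NV :=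
  s *m conn_mx nabla x v - rsubmx v *m conn_mx nabla x (row_mx 0 s).

Lemma adapted_setS nabla (U V : set M) : V `<=` U -> adapted_connection U nabla ->
  adapted_connection V nabla.
Proof.
move=> VU [[a b d e] ad]; split.
  split.
  - by move=> x s r v w /VU; exact: a.
  - by move=> W x v s t oW /subset_trans/(_ VU); exact: b.
  - by move=> W x v f s oW /subset_trans/(_ VU); exact: d.
  - by move=> W X s oW /subset_trans/(_ VU); exact: e.
by move=> W X Y oW /subset_trans/(_ VU); exact: ad.
Qed.

(** The lift of s and the matrices in [skew_part] belong to the preferred chart at x. Identifying it
    with the torsion of two constant fields, which [torsionE] evaluates in any chart, gives a
    formula in c from which smoothness can be read off. *)
Lemma skew_part_chart nabla (U : set M) c x v s : adapted_connection U nabla -> open U ->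
  U x -> charts (f := M) c -> dom c x ->
  skew_part nabla x v s *m nmx c x =
  (s *m nmx c x) *m lcmx nabla c (tcoord c x v) (cmap c x) -
  rsubmx (tcoord c x v) *m lcmx nabla c (row_mx 0 (s *m nmx c x)) (cmap c x).
Proof.
move=> ad oU Ux hc cx; have [cn _] := ad.
pose V := U `&` dom c.
have oV : open V by apply: openI => //; exact: dom_open.
have VU : V `<=` U by move=> y [].
have Vc : V `<=` dom c by move=> y [].
have Vx : V x by [].
pose w : TV := row_mx 0 s.
pose X := cfield c (tcoord c x v); pose Y := cfield c (tcoord c x w).
have vX : vfield V X by apply: vfieldS Vc _; exact: vfield_cfield.
have vY : vfield V Y by apply: vfieldS Vc _; exact: vfield_cfield.
have Xx : X x = v by exact: (tcoordK hc cx).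
have Yx : Y x = w by exact: (tcoordK hc cx).
have ha := chart_at_charts x; have ax := chart_at_dom x.
have t1 := torsionE cn oV VU Vx vX vY ha ax.
have t2 := torsionE cn oV VU Vx vX vY hc cx.
move: t1 t2; rewrite Xx Yx nmx_at !mulmx1 /w row_mxKr => t1 t2.
have e : skew_part nabla x v s = torsion nabla X Y x.
  apply: etrans _ (esym t1); rewrite /skew_part (conn_mxE nabla x v) (conn_mxE nabla x (row_mx 0 s)).
  by congr (_ - _).
rewrite e t2.
rewrite (cmx_lcmx nabla v hc cx) (cmx_lcmx nabla _ hc cx) (rsubmx_tcoord v hc cx).
have r : rsubmx (tcoord c x (row_mx 0 s)) = rsubmx (row_mx 0 (s *m nmx c x) : TV).
  by rewrite (rsubmx_tcoord _ hc cx) !row_mxKr.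
have E := adapted_lcmx ad oU Ux hc cx r.
exact: (congr1 (fun A => s *m nmx c x *m lcmx nabla c (tcoord c x v) (cmap c x) -
  rsubmx v *m nmx c x *m A) E).
Qed.

Lemma conn_mx_linear nabla (U : set M) x : is_connection U nabla -> U x ->
  linear (conn_mx nabla x).
Proof. by move=> cn Ux a u v; rewrite !conn_mxE (cmx_linear _ cn Ux). Qed.

Lemma skew_part_linear1 nabla (U : set M) x s : is_connection U nabla -> U x ->
  linear (fun v => skew_part nabla x v s).
Proof.
move=> cn Ux a u v; rewrite /skew_part (conn_mx_linear cn Ux) (@rsubmx_linear R 1 p k).
rewrite mulmxDr -scalemxAr mulmxDl -scalemxAl opprD addrACA.
by rewrite scalerBr.
Qed.

Lemma skew_part_linear2 nabla (U : set M) x v : is_connection U nabla -> U x ->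
  linear (fun s => skew_part nabla x v s).
Proof.
move=> cn Ux a s t; rewrite /skew_part (@row_mx0_linear R 1 p k) (conn_mx_linear cn Ux).
rewrite mulmxDr -scalemxAr mulmxDl -scalemxAl opprD addrACA.
by rewrite scalerBr.
Qed.

Lemma skew_part_smooth nabla (U V : set M) X s : adapted_connection U nabla -> open U ->
  open V -> V `<=` U -> vfield V X -> nsection V s ->
  nsection V (fun x => skew_part nabla x (X x) (s x)).
Proof.
move=> ad oU oV VU vX ss; have [cn _] := ad.
apply/nsectionP => // x Vx; exists (chart_at x); have Ux := VU x Vx.
have hc := chart_at_charts x; have cx := chart_at_dom x; split=> //.
set c := chart_at x.
have sX := vfield_smooth oV vX Vx hc cx; have sS := nsection_smooth oV ss Vx hc cx.
apply: (@smooth_at_eq _ _ _ (fun z => nloc c s z *m lcmx nabla c (tloc c X z) z -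
   rsubmx (tloc c X z) *m lcmx nabla c (row_mx 0 (nloc c s z)) z)).
  apply: filterS (near_chart cx (open_nbhs_nbhs (conj oU Ux))) => _ [y [-> cy Uy]].
  by rewrite [RHS](nlocE _ cy) (skew_part_chart _ _ ad oU Uy hc cy) (nlocE s cy) (tlocE X cy).
apply: smooth_atB; apply: smooth_at_mulmx.
- exact: sS.
- exact: (smooth_lcmx_app cn oU Ux hc cx sX).
- by apply: smooth_at_lin sX; exact: rsubmx_linear.
- apply: (smooth_lcmx_app cn oU Ux hc cx).
  by apply: smooth_at_lin sS; exact: row_mx0_linear.
Qed.

Lemma smooth_fun_half (V : set M) : open V -> smooth_fun V (fun=> - 2^-1).
Proof. by move=> oV; have [] := @smooth_fun_cst_near _ _ _ M V (fun=> - 2^-1) (- 2^-1) oV (fun _ _ => erefl). Qed.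

(** Half of the torsion is subtracted. Unlike the trace correction below, this is a tensor and
    refers to no chart, so the result is a global connection. *)
Definition symmetrize nabla : covderiv M :=
  shift_conn nabla (fun x v s => - 2^-1 *: skew_part nabla x v s).

Lemma symmetrize_lcmx nabla (U : set M) c x u w : adapted_connection U nabla -> open U ->
  U x -> charts (f := M) c -> dom c x ->
  w *m lcmx (symmetrize nabla) c u (cmap c x) =
  2^-1 *: (w *m lcmx nabla c u (cmap c x) +
           rsubmx u *m lcmx nabla c (row_mx 0 w) (cmap c x)).
Proof.
move=> ad oU Ux hc cx; have [cn _] := ad.
have l2 (v : TV) : linear (fun s => - 2^-1 *: skew_part nabla x v s).
  move=> a s t; rewrite (skew_part_linear2 v cn Ux) scalerDr; congr (_ + _).
  by rewrite !scalerA mulrC.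
apply: etrans (congr1 (mulmx w) (lcmxE (symmetrize nabla) u cx)) _.
apply: etrans (mul_shift_cmx nabla (tvec c x u) w l2 hc cx) _.
rewrite -(lcmxE nabla u cx).
rewrite -scalemxAl (skew_part_chart _ _ ad oU Ux hc cx) mulmxKV ?nmx_unit // (tvecK hc cx).
rewrite scaleNr; exact: half_sub.
Qed.

Lemma symmetrize_connection nabla : adapted_connection [set: M] nabla ->
  adapted_connection [set: M] (symmetrize nabla) /\
  torsionless [set: M] (symmetrize nabla).
Proof.
move=> ad; have [cn _] := ad; have oT : open [set: M] by exact: openT.
have cn' : is_connection [set: M] (symmetrize nabla).
  apply: (shift_connection cn).
  - move=> x _ s a u v; rewrite (skew_part_linear1 s cn I) scalerDr; congr (_ + _).
    by rewrite !scalerA mulrC.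
  - move=> x _ v a s t; rewrite (skew_part_linear2 v cn I) scalerDr; congr (_ + _).
    by rewrite !scalerA mulrC.
  - move=> V X s oV _ vX ss; apply: nsectionZ => //; first exact: smooth_fun_half.
    exact: (skew_part_smooth ad oT oV (fun _ _ => I) vX ss).
split.
  apply: (shift_adapted ad cn') => x v s _ v0.
  rewrite /skew_part conn_mxE (adapted_cmx ad oT I (chart_at_charts x) (chart_at_dom x) v0).
  by rewrite mulmx0 v0 mul0mx subrr scaler0.
apply: (lcmx_torsionless cn' oT) => x _; exists (chart_at x).
have hc := chart_at_charts x; have cx := chart_at_dom x.
split; [exact: hc|exact: cx|move=> u v].
apply: etrans (symmetrize_lcmx u (rsubmx v) ad oT I hc cx) _.
apply: etrans _ (esym (symmetrize_lcmx v (rsubmx u) ad oT I hc cx)).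
have e w : lcmx nabla (chart_at x) (row_mx 0 (rsubmx w)) (cmap (chart_at x) x) =
    lcmx nabla (chart_at x) w (cmap (chart_at x) x).
  by apply: (adapted_lcmx ad oT I hc cx); rewrite row_mxKr.
move: (e u) (e v) => -> ->; exact: (congr1 _ (addrC _ _)).
Qed.

(** The trace of a connection matrix is not a tensor, so the form depends on the chart c. A
    projective change by a form t adds (k + 1) t to the trace, which fixes the factor. *)
Definition trace_form nabla c x (v : TV) : R := - k.+1%:R^-1 * \tr (cmx nabla c x v).

Definition trace_shift nabla c x (v : TV) (s : NV) : NV :=
  trace_form nabla c x v *: s + trace_form nabla c x (row_mx 0 s) *: rsubmx v.

(** The projective parameters of T. Y. Thomas: a projective change of [nabla] that makes its matrix
    in the chart c trace free when [nabla] is adapted. *)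
Definition thomas nabla c : covderiv M := shift_conn nabla (trace_shift nabla c).

Lemma trace_form_linear nabla c x : is_connection [set: M] nabla ->
  linear (trace_form nabla c x : TV -> R).
Proof.
move=> cn a u v; rewrite /trace_form (cmx_linear c cn I) linearP /=.
by rewrite mulrDr -[a *: _]/(a * _) -[X in _ = X + _]/(a * _) mulrCA.
Qed.

Lemma trace_form_adapted nabla c x u v : adapted_connection [set: M] nabla ->
  charts (f := M) c -> dom c x -> rsubmx u = rsubmx v ->
  trace_form nabla c x u = trace_form nabla c x v.
Proof.
move=> ad hc cx e; rewrite /trace_form !(cmx_lcmx _ _ hc cx).
have r : rsubmx (tcoord c x u) = rsubmx (tcoord c x v) by rewrite !(rsubmx_tcoord _ hc cx) e.
exact: (congr1 (fun A => - k.+1%:R^-1 * \tr A) (adapted_lcmx ad openT I hc cx r)).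
Qed.

Lemma trace_shift_linear1 nabla c x s : is_connection [set: M] nabla ->
  linear (fun v => trace_shift nabla c x v s).
Proof.
move=> cn a u v; rewrite /trace_shift (trace_form_linear c x cn) (@rsubmx_linear R 1 p k).
rewrite scalerDl -[(a *: trace_form _ _ _ _) *: s]scalerA.
rewrite [_ *: (a *: _ + _)]scalerDr [_ *: (a *: _)]scalerA [_ * a]mulrC -[(a * _) *: _]scalerA.
by rewrite scalerDr addrACA.
Qed.

Lemma trace_shift_linear2 nabla c x v : is_connection [set: M] nabla ->
  linear (trace_shift nabla c x v).
Proof.
move=> cn a s t; rewrite /trace_shift (@row_mx0_linear R 1 p k) (trace_form_linear c x cn).
rewrite [_ *: (a *: _ + _)]scalerDr [_ *: (a *: _)]scalerA [_ * a]mulrC -[(a * _) *: s]scalerA.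
rewrite [(_ + _) *: _]scalerDl -[(a *: trace_form _ _ _ _) *: _]scalerA.
by rewrite scalerDr addrACA.
Qed.

Lemma trace_shift_chart nabla c x v s : adapted_connection [set: M] nabla ->
  charts (f := M) c -> dom c x ->
  trace_shift nabla c x v s *m nmx c x =
  (- k.+1%:R^-1 * \tr (lcmx nabla c (tcoord c x v) (cmap c x))) *: (s *m nmx c x) +
  (- k.+1%:R^-1 * \tr (lcmx nabla c (row_mx 0 (s *m nmx c x)) (cmap c x))) *:
    rsubmx (tcoord c x v).
Proof.
move=> ad hc cx; rewrite /trace_shift mulmxDl -!scalemxAl (rsubmx_tcoord v hc cx).
rewrite /trace_form (cmx_lcmx nabla v hc cx) (cmx_lcmx nabla _ hc cx).
have r : rsubmx (tcoord c x (row_mx 0 s)) = rsubmx (row_mx 0 (s *m nmx c x) : TV).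
  by rewrite (rsubmx_tcoord _ hc cx) !row_mxKr.
have E := adapted_lcmx ad openT I hc cx r.
exact: (congr1 (fun A => (- k.+1%:R^-1 * \tr (lcmx nabla c (tcoord c x v) (cmap c x))) *: (s *m nmx c x)
  + (- k.+1%:R^-1 * \tr A) *: (rsubmx v *m nmx c x)) E).
Qed.

Lemma smooth_trace_lcmx nabla c x (u : TV -> TV) : is_connection [set: M] nabla ->
  charts (f := M) c -> dom c x -> smooth_at u (cmap c x) ->
  smooth_at (fun z => - k.+1%:R^-1 * \tr (lcmx nabla c (u z) z)) (cmap c x).
Proof.
move=> cn hc cx su; apply: smooth_atM; first exact: smooth_at_cst.
have lt : linear (fun A : 'M[R]_k => \tr A : R) by move=> a A B; rewrite linearP.
apply: (smooth_at_lin (L := fun A : 'M[R]_k => \tr A : R) lt).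
exact: (smooth_lcmx_app cn openT I hc cx su).
Qed.

Lemma trace_shift_smooth nabla c (V : set M) X s : adapted_connection [set: M] nabla ->
  charts (f := M) c -> open V -> V `<=` dom c -> vfield V X -> nsection V s ->
  nsection V (fun x => trace_shift nabla c x (X x) (s x)).
Proof.
move=> ad hc oV Vc vX ss; have [cn _] := ad.
apply/nsectionP => // x Vx; exists c; have cx := Vc x Vx; split=> //.
have sX := vfield_smooth oV vX Vx hc cx; have sS := nsection_smooth oV ss Vx hc cx.
apply: (@smooth_at_eq _ _ _ (fun z =>
  (- k.+1%:R^-1 * \tr (lcmx nabla c (tloc c X z) z)) *: nloc c s z +
  (- k.+1%:R^-1 * \tr (lcmx nabla c (row_mx 0 (nloc c s z)) z)) *: rsubmx (tloc c X z))).
  apply: filterS (near_chart cx (near_dom cx)) => _ [y [-> cy _]].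
  by rewrite [RHS](nlocE _ cy) (trace_shift_chart _ _ ad hc cy) (nlocE s cy) (tlocE X cy).
apply: smooth_atD; apply: smooth_atZ.
- exact: (smooth_trace_lcmx cn hc cx sX).
- exact: sS.
- apply: (smooth_trace_lcmx cn hc cx).
  by apply: smooth_at_lin sS; exact: row_mx0_linear.
- by apply: smooth_at_lin sX; exact: rsubmx_linear.
Qed.

Lemma thomas_lcmx nabla c x u w : adapted_connection [set: M] nabla ->
  charts (f := M) c -> dom c x ->
  w *m lcmx (thomas nabla c) c u (cmap c x) =
  w *m lcmx nabla c u (cmap c x) +
  ((- k.+1%:R^-1 * \tr (lcmx nabla c u (cmap c x))) *: w +
   (- k.+1%:R^-1 * \tr (lcmx nabla c (row_mx 0 w) (cmap c x))) *: rsubmx u).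
Proof.
move=> ad hc cx; have [cn _] := ad.
have l2 (v : TV) : linear (trace_shift nabla c x v) by exact: trace_shift_linear2.
apply: etrans (congr1 (mulmx w) (lcmxE (thomas nabla c) u cx)) _.
apply: etrans (mul_shift_cmx nabla (tvec c x u) w l2 hc cx) _.
rewrite -(lcmxE nabla u cx).
by rewrite (trace_shift_chart _ _ ad hc cx) mulmxKV ?nmx_unit // (tvecK hc cx).
Qed.

Lemma thomas_connection nabla c : adapted_connection [set: M] nabla ->
  torsionless [set: M] nabla -> charts (f := M) c ->
  adapted_connection (dom c) (thomas nabla c) /\ torsionless (dom c) (thomas nabla c).
Proof.
move=> ad tl hc; have [cn _] := ad; have oc := dom_open c.
have oT : open [set: M] by exact: openT.
have adc : adapted_connection (dom c) nabla by exact: adapted_setS ad.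
have [cnc _] := adc.
have cn' : is_connection (dom c) (thomas nabla c).
  apply: (shift_connection cnc).
  - by move=> x _ s; exact: trace_shift_linear1.
  - by move=> x _ v; exact: trace_shift_linear2.
  - by move=> V X s oV Vc vX ss; exact: trace_shift_smooth.
split.
  apply: (shift_adapted adc cn') => x v s cx v0.
  have v0' : rsubmx v = rsubmx (0 : TV) by rewrite v0 linear0.
  rewrite /trace_shift (trace_form_adapted ad hc cx v0') v0 scaler0 addr0.
  have L := trace_form_linear c x cn.
  have := L (-1) 0 0; rewrite scaleN1r oppr0 addr0 scaleN1r addNr => ->.
  by rewrite scale0r.
apply: (lcmx_torsionless cn' oc) => x cx; exists c; split; [exact: hc|exact: cx|move=> u v].
apply: etrans (thomas_lcmx u (rsubmx v) ad hc cx) _.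
apply: etrans _ (esym (thomas_lcmx v (rsubmx u) ad hc cx)).
rewrite (torsionless_lcmx u v cn oT I hc cx tl); apply: (congr1 (fun A => _ + A)).
have e w : lcmx nabla c (row_mx 0 (rsubmx w)) (cmap c x) = lcmx nabla c w (cmap c x).
  by apply: (adapted_lcmx ad oT I hc cx); rewrite row_mxKr.
move: (e u) (e v) => -> ->; exact: addrC.
Qed.

End Modify.

(** * Charts of the twistor space *)

Lemma invmx_mulmx (R : comUnitRingType) n (A B : 'M[R]_n) :
  A \in unitmx -> B \in unitmx -> invmx (A *m B) = invmx B *m invmx A.
Proof.
move=> uA uB.
have e : invmx B *m invmx A *m (A *m B) = 1%:M by rewrite mulmxA mulmxKV // mulVmx.
have uAB : A *m B \in unitmx by rewrite unitmx_mul uA uB.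
by rewrite -[LHS]mul1mx -e mulmxK.
Qed.

Section TwistorCharts.
Context {R : realType} {p k : nat} (M : foliated_manifold R p k).
Local Notation TV := 'rV[R]_(p + k).
Local Notation NV := 'rV[R]_k.
Local Notation chartM := (chart R (pt M) (p + k)).
Local Notation EN := (pt M * 'M[R]_k)%type.
Local Notation TE := ('rV[R]_(p + k) * 'M[R]_k)%type.
Implicit Types (c d e : chartM) (x : M) (nabla : covderiv M) (z : EN).

Lemma etransE c d (w : TE) :
  Defs.etrans c d w = (trans c d w.1, invmx (tjac c d w.1) *m w.2 *m tjac c d w.1).
Proof. by []. Qed.

Lemma echartE c z : charts (f := M) c -> dom c z.1 ->
  echart c z = (cmap c z.1, invmx (nmx c z.1) *m z.2 *m nmx c z.1).
Proof.
move=> hc cz; rewrite /echart etransE /ebase /=.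
by rewrite -/(base z.1) /base (transE c (chart_at_dom z.1)) nmxE.
Qed.

Lemma echart_at z : echart (chart_at z.1) z = ebase z.
Proof.
rewrite (echartE (chart_at_charts _) (chart_at_dom _)) nmx_at invmx1 mul1mx mulmx1.
by [].
Qed.

Lemma einvE c (w : TE) x : dom c x -> w.1 = cmap c x ->
  einv c w = (x, nmx c x *m w.2 *m invmx (nmx c x)).
Proof. by move=> cx e; rewrite /einv e (cinvK cx). Qed.

Lemma echartK c z : charts (f := M) c -> dom c z.1 -> einv c (echart c z) = z.
Proof.
move=> hc cz; rewrite (echartE hc cz) (@einvE c _ z.1 cz) //= !mulmxA.
rewrite mulmxV ?nmx_unit // mul1mx mulmxK ?nmx_unit //.
by case: z {cz}.
Qed.

Lemma einvK c (w : TE) x : charts (f := M) c -> dom c x -> w.1 = cmap c x ->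
  echart c (einv c w) = w.
Proof.
move=> hc cx e; rewrite (einvE cx e) (echartE hc) //= !mulmxA mulVmx ?nmx_unit // mul1mx.
by rewrite mulmxKV ?nmx_unit // -e; case: w {e}.
Qed.

Lemma etrans_echart c d z : charts (f := M) c -> charts (f := M) d ->
  dom c z.1 -> dom d z.1 -> Defs.etrans c d (echart c z) = echart d z.
Proof.
move=> hc hd cz dz; rewrite etransE (echartE hc cz) (echartE hd dz) /=.
have [ut it] := tjacV hc hd cz dz.
rewrite (transE d cz) (nmx_trans hc hd cz dz); congr pair.
rewrite (invmx_mulmx (nmx_unit hc cz) ut).
by rewrite !mulmxA.
Qed.

Lemma near_edom c z (P : M -> Prop) : charts (f := M) c -> dom c z.1 ->
  (\forall y \near z.1, P y) ->
  \forall w \near echart c z, exists y : EN, [/\ w = echart c y, dom c y.1 & P y.1].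
Proof.
move=> hc cz nP.
have n1 : \forall w \near echart c z, exists y, [/\ w.1 = cmap c y, dom c y & P y].
  have cf : {for echart c z, continuous (fst : TE -> TV)} by exact: cvg_fst.
  have nz := near_chart cz nP.
  have nz' : \forall w1 \near (echart c z).1, exists y, [/\ w1 = cmap c y, dom c y & P y].
    by rewrite (echartE hc cz).
  exact: (cf _ nz').
apply: filterS n1 => w [y [e cy Py]]; exists (einv c w).
by rewrite (einvK hc cy e) (einvE cy e).
Qed.

Lemma near_echart c z (O : set EN) : eopen O -> O z -> charts (f := M) c -> dom c z.1 ->
  \forall w \near echart c z, exists y : EN, [/\ w = echart c y, dom c y.1 & O y].
Proof.
move=> oO Oz hc cz.
have n1 : \forall w \near echart c z, (echart c @` [set y | O y /\ dom c y.1]) w.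
  by apply: open_nbhs_nbhs; split; [exact: oO|exists z].
by apply: filterS n1 => _ [y [Oy cy] <-]; exists y.
Qed.

Lemma smooth_etrans c d z : charts (f := M) c -> charts (f := M) d ->
  dom c z.1 -> dom d z.1 -> smooth_at (Defs.etrans c d) (echart c z).
Proof.
move=> hc hd cz dz.
have e1 : (echart c z).1 = cmap c z.1 by rewrite (echartE hc cz).
have s1 : smooth_at (fun w : TE => w.1) (echart c z) by apply: smooth_at_fst; exact: smooth_at_id.
have s2 : smooth_at (fun w : TE => w.2) (echart c z) by apply: smooth_at_snd; exact: smooth_at_id.
have st : smooth_at (fun w : TE => trans c d w.1) (echart c z).
  by apply: (smooth_at_comp s1); rewrite e1; exact: smooth_trans.
have sj : smooth_at (fun w : TE => tjac c d w.1) (echart c z).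
  by apply: (smooth_at_comp s1); rewrite e1; exact: smooth_tjac.
have sp : smooth_at (fun w : TE => (trans c d w.1, invmx (tjac c d w.1) *m w.2 *m tjac c d w.1)) (echart c z).
  apply: (smooth_at_pair st); apply: (smooth_at_mulmx _ sj); apply: (smooth_at_mulmx _ s2).
  by apply: (smooth_at_invmx sj); rewrite e1; case: (tjacV hc hd cz dz).
exact: sp.
Qed.

Local Opaque echart Defs.etrans.

Lemma eopen_chart c (W : set TE) (O : set EN) : charts (f := M) c -> open W -> eopen O ->
  eopen [set z | [/\ O z, dom c z.1 & W (echart c z)]].
Proof.
move=> hc oW oO d hd; rewrite openE => _ [z [[Oz cz Wz] dz] <-].
have n1 := near_echart oO Oz hd dz.
have n2 := near_edom hd dz (near_dom cz).
have n3 : \forall w \near echart d z, W (Defs.etrans d c w).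
  have ct := smooth_at_cont (smooth_etrans hd hc dz cz).
  by apply: ct; rewrite (etrans_echart hd hc dz cz); exact: open_nbhs_nbhs.
apply: filterS3 n1 n2 n3 => w [y [ey dy Oy]] [y' [ey' dy' cy']] Ww.
have yy : y = y' by rewrite -(echartK hd dy) -ey ey' (echartK hd dy').
have cy : dom c y.1 by rewrite yy.
rewrite ey (etrans_echart hd hc dy cy) in Ww.
by exists y; [|exact: (esym ey)].
Qed.

Lemma eopen_dom c : charts (f := M) c -> eopen [set z : EN | dom c z.1].
Proof.
move=> hc d hd; rewrite openE => _ [z [cz dz] <-].
apply: filterS (near_edom hd dz (near_dom cz)) => w [y [-> dy cy]].
by exists y.
Qed.

Definition evec c z (U : TE) : TE := 'D_U (Defs.etrans c (chart_at z.1)) (echart c z).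

Lemma evecE c z U : evec c z U = 'D_U (Defs.etrans c (chart_at z.1)) (echart c z).
Proof. by []. Qed.

Lemma ecoordE c z u : ecoord c z u = 'D_u (Defs.etrans (chart_at z.1) c) (echart (chart_at z.1) z).
Proof. by rewrite echart_at. Qed.

Lemma near_etrans c d e z : charts (f := M) c -> charts (f := M) d -> charts (f := M) e ->
  dom c z.1 -> dom d z.1 -> dom e z.1 ->
  \forall w \near echart c z, Defs.etrans d e (Defs.etrans c d w) = Defs.etrans c e w.
Proof.
move=> hc hd he cz dz ez.
have n1 := near_edom hc cz (near_dom dz); have n2 := near_edom hc cz (near_dom ez).
apply: filterS2 n1 n2 => _ [y [-> cy dy]] [y' [ey cy' ey']].
have yy : y' = y by rewrite -(echartK hc cy') -ey (echartK hc cy).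
rewrite yy in ey'.
rewrite (etrans_echart hc hd cy dy).
exact: (etrans (etrans_echart hd he dy ey') (esym (etrans_echart hc he cy ey'))).
Qed.

Lemma derive_etrans_comp c d e z u : charts (f := M) c -> charts (f := M) d ->
  charts (f := M) e -> dom c z.1 -> dom d z.1 -> dom e z.1 ->
  'D_('D_u (Defs.etrans c d) (echart c z)) (Defs.etrans d e) (echart d z) =
  'D_u (Defs.etrans c e) (echart c z).
Proof.
move=> hc hd he cz dz ez.
have s1 := smooth_at_diff (smooth_etrans hc hd cz dz).
have s2 := smooth_at_diff (smooth_etrans hd he dz ez).
have e1 := etrans_echart hc hd cz dz.
apply: etrans _ (near_eq_derive u (near_etrans hc hd he cz dz ez)).
rewrite -e1 in s2 *.
exact: (esym (derive_comp u s1 s2)).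
Qed.

Lemma derive_etrans_id c z u : charts (f := M) c -> dom c z.1 ->
  'D_u (Defs.etrans c c) (echart c z) = u.
Proof.
move=> hc cz.
have n : \forall w \near echart c z, Defs.etrans c c w = w.
  by apply: filterS (near_edom hc cz (near_dom cz)) => _ [y [-> cy _]]; exact: etrans_echart.
by rewrite (near_eq_derive u n) derive_id.
Qed.

Lemma ecoord_trans c d z u : charts (f := M) c -> charts (f := M) d ->
  dom c z.1 -> dom d z.1 ->
  'D_(ecoord c z u) (Defs.etrans c d) (echart c z) = ecoord d z u.
Proof.
move=> hc hd cz dz; rewrite !ecoordE.
exact: (derive_etrans_comp u (chart_at_charts _) hc hd (chart_at_dom _) cz dz).
Qed.

Lemma ecoord_at z u : ecoord (chart_at z.1) z u = u.
Proof. by rewrite ecoordE; exact: (derive_etrans_id u (chart_at_charts _) (chart_at_dom _)). Qed.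

Lemma evecK c z : charts (f := M) c -> dom c z.1 -> cancel (evec c z) (ecoord c z).
Proof.
move=> hc cz u; rewrite ecoordE.
apply: etrans (derive_etrans_comp u hc (chart_at_charts _) hc cz (chart_at_dom _) cz) _.
exact: derive_etrans_id.
Qed.

Lemma elocE c (X : EN -> TE) z : charts (f := M) c -> dom c z.1 ->
  eloc c X (echart c z) = ecoord c z (X z).
Proof. by move=> hc cz; rewrite /eloc (echartK hc cz). Qed.

Lemma eloc_trans c d X z : charts (f := M) c -> charts (f := M) d -> dom c z.1 -> dom d z.1 ->
  \forall w \near echart c z, eloc d X (Defs.etrans c d w) = 'D_(eloc c X w) (Defs.etrans c d) w.
Proof.
move=> hc hd cz dz; apply: filterS (near_edom hc cz (near_dom dz)) => _ [y [-> cy dy]].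
rewrite (etrans_echart hc hd cy dy) (elocE X hc cy) (elocE X hd dy).
exact: (esym (ecoord_trans _ hc hd cy dy)).
Qed.

Lemma smooth_eloc c d X z : charts (f := M) c -> charts (f := M) d -> dom c z.1 -> dom d z.1 ->
  smooth_at (eloc c X) (echart c z) -> smooth_at (eloc d X) (echart d z).
Proof.
move=> hc hd cz dz sX.
have st := smooth_etrans hd hc dz cz.
have e := etrans_echart hd hc dz cz.
apply: (@smooth_at_eq _ _ _ (fun w => (fun v => 'D_(eloc c X v) (Defs.etrans c d) v) (Defs.etrans d c w))).
  apply: filterS (near_edom hd dz (near_dom cz)) => _ [y [-> dy cy]].
  rewrite (etrans_echart hd hc dy cy) (elocE X hc cy) (elocE X hd dy).
  exact: ecoord_trans.
apply: (smooth_at_comp (g := fun v => 'D_(eloc c X v) (Defs.etrans c d) v) st).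
by rewrite e; apply: (smooth_at_derive_dir _ sX).1; exact: smooth_etrans.
Qed.

Lemma ecoord_bracket c X Y z : charts (f := M) c -> dom c z.1 ->
  smooth_at (eloc c X) (echart c z) -> smooth_at (eloc c Y) (echart c z) ->
  ecoord c z (ebracket X Y z) = vbracket (eloc c X) (eloc c Y) (echart c z).
Proof.
move=> hc cz sX sY; set a := chart_at z.1.
have ha : charts (f := M) a by exact: chart_at_charts.
have az : dom a z.1 by exact: chart_at_dom.
have saX : smooth_at (eloc a X) (echart a z) by exact: (smooth_eloc hc ha cz az sX).
have saY : smooth_at (eloc a Y) (echart a z) by exact: (smooth_eloc hc ha cz az sY).
have e := etrans_echart ha hc az cz.
rewrite ecoordE /ebracket -(echart_at z) -/a -[in RHS]e.
apply/esym; apply: vbracket_push.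
- exact: smooth_etrans.
- exact: saX.
- exact: saY.
- by rewrite e.
- by rewrite e.
- exact: eloc_trans.
- exact: eloc_trans.
Qed.

Lemma smooth_on_echart (O : set EN) c (F : TE -> TE) : eopen O -> charts (f := M) c ->
  smooth_on (echart c @` [set z | O z /\ dom c z.1]) F <->
  forall z, O z -> dom c z.1 -> smooth_at F (echart c z).
Proof.
move=> oO hc; rewrite smooth_onP; last exact: oO.
split=> [h z Oz cz|h _ [z [Oz cz] <-]]; last exact: h.
by apply: h; exists z.
Qed.

Lemma zfieldP (O : set EN) X : eopen O ->
  zfield O X <->
  (forall z, O z -> exists c, [/\ charts (f := M) c, dom c z.1 &
     smooth_at (eloc c X) (echart c z)]) /\
  (forall z, O z -> twistor z -> vertical z.2 (X z).2).
Proof.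
move=> oO; split=> [[s v]|[s v]]; split=> //.
  move=> z Oz; exists (chart_at z.1); split; [exact: chart_at_charts|exact: chart_at_dom|].
  by move/(smooth_on_echart _ oO (chart_at_charts _)): (s _ (chart_at_charts z.1)); apply; [|exact: chart_at_dom].
move=> c hc; apply/smooth_on_echart => // z Oz cz; have [d [hd dz sd]] := s z Oz.
exact: (smooth_eloc hd hc dz cz sd).
Qed.

Lemma zfield_smooth (O : set EN) X c z : eopen O -> zfield O X -> O z ->
  charts (f := M) c -> dom c z.1 -> smooth_at (eloc c X) (echart c z).
Proof. by move=> oO [s _] Oz hc cz; move/(smooth_on_echart _ oO hc): (s c hc); apply. Qed.

(** The gauge transformation rule: in the frame of the preferred chart, the frame of c has as matrix
    the inverse of the transverse Jacobian. *)
Lemma cmx_trans nabla c x v : is_connection [set: M] nabla -> charts (f := M) c -> dom c x ->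
  cmx nabla c x v =
  ('D_v (fun w => invmx (tjac (chart_at x) c w)) (base x) +
   invmx (nmx c x) *m conn_mx nabla x v) *m nmx c x.
Proof.
move=> cn hc cx; set a := chart_at x.
have ha : charts (f := M) a by exact: chart_at_charts.
have ax : dom a x by exact: chart_at_dom.
have oT : open [set: M] by exact: openT.
apply/row_matrixP => i; rewrite row_cmx [RHS]row_mul; apply: (congr1 (mulmx^~ _)).
have ss : nsection (dom c) (csec c (delta_mx 0 i)) by exact: nsection_csec.
have := connectionE v cn (dom_open c) (fun _ _ => I) cx ss ha ax.
rewrite nmx_at !mulmx1 (tcoord_at x v) -conn_mxE => ->.
rewrite linearD /= row_mul; apply: (congr2 (fun A B : NV => A + B)); last first.
  by rewrite csecE -rowE.
have sj := smooth_tjac ha hc ax cx.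
have [uj _] := tjacV ha hc ax cx.
have si := smooth_at_invmx sj uj.
rewrite [RHS]rowE.
have E : \forall w \near cmap a x, delta_mx 0 i *m invmx (tjac a c w) = nloc a (csec c (delta_mx 0 i)) w.
  apply: filterS (near_chart ax (near_dom cx)) => _ [y [-> ay cy]].
  have [uy _] := tjacV ha hc ay cy.
  rewrite (nlocE _ ay) csecE (nmx_trans ha hc ay cy) (invmx_mulmx (nmx_unit ha ay) uy) mulmxA.
  by rewrite (mulmxKV (nmx_unit ha ay)).
apply: etrans (esym (near_eq_derive v E)) _.
exact: (derive_lin v (@mulmx_linear2 R 1 k k (delta_mx 0 i)) (smooth_at_diff si)).
Qed.

(** The vertical component of U, that is the covariant derivative of K along U: the fibre component
    plus the commutator [K, G]. [vpart] is the same in the preferred chart. *)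
Definition vert nabla c (w U : TE) : 'M[R]_k :=
  U.2 + w.2 *m lcmx nabla c U.1 w.1 - lcmx nabla c U.1 w.1 *m w.2.

Definition vpart nabla z (u : TE) : 'M[R]_k :=
  u.2 + z.2 *m conn_mx nabla z.1 u.1 - conn_mx nabla z.1 u.1 *m z.2.

Lemma derive_etransE c d z (u : TE) : charts (f := M) c -> charts (f := M) d ->
  dom c z.1 -> dom d z.1 ->
  let T := tjac c d (cmap c z.1) in let K := (echart c z).2 in
  'D_u (Defs.etrans c d) (echart c z) =
  ('D_(u.1) (trans c d) (cmap c z.1),
   'D_(u.1) (fun w => invmx (tjac c d w)) (cmap c z.1) *m K *m T +
   invmx T *m u.2 *m T + invmx T *m K *m 'D_(u.1) (tjac c d) (cmap c z.1)).
Proof.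
move=> hc hd cz dz T K; have e1 : (echart c z).1 = cmap c z.1 by rewrite (echartE hc cz).
set w0 := echart c z in K e1 *.
have s1 : smooth_at (fun w : TE => w.1) w0 by apply: smooth_at_fst; exact: smooth_at_id.
have s2 : smooth_at (fun w : TE => w.2) w0 by apply: smooth_at_snd; exact: smooth_at_id.
have d1 : 'D_u (fun w : TE => w.1) w0 = u.1 by apply: derive_self; exact: fst_linear.
have d2 : 'D_u (fun w : TE => w.2) w0 = u.2 by apply: derive_self; exact: snd_linear.
have str : smooth_at (trans c d) w0.1 by rewrite e1; exact: smooth_trans.
have sjr : smooth_at (tjac c d) w0.1 by rewrite e1; exact: smooth_tjac.
have uj : tjac c d w0.1 \in unitmx by rewrite e1; case: (tjacV hc hd cz dz).
have sir := smooth_at_invmx sjr uj.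
have st : differentiable (fun w : TE => trans c d w.1) w0.
  by apply: smooth_at_diff; apply: (smooth_at_comp s1).
have sj : differentiable (fun w : TE => tjac c d w.1) w0.
  by apply: smooth_at_diff; apply: (smooth_at_comp s1).
have si : differentiable (fun w : TE => invmx (tjac c d w.1)) w0.
  apply: smooth_at_diff.
  exact: (smooth_at_comp (g := fun y => invmx (tjac c d y)) s1 sir).
have C (W : normedModType R) (f : TV -> W) : differentiable f w0.1 ->
    'D_u (fun w : TE => f w.1) w0 = 'D_(u.1) f w0.1.
  by move=> df; apply: etrans (derive_comp u (smooth_at_diff s1) df) _; rewrite d1.
have q1 : differentiable (fun w : TE => invmx (tjac c d w.1) *m w.2) w0.
  exact: smooth_at_diff (smooth_at_mulmx (smooth_at_comp s1 sir) s2).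
have q2 : differentiable (fun w : TE => invmx (tjac c d w.1) *m w.2 *m tjac c d w.1) w0.
  exact: smooth_at_diff (smooth_at_mulmx (smooth_at_mulmx (smooth_at_comp s1 sir) s2) (smooth_at_comp s1 sjr)).
have E : Defs.etrans c d = (fun w : TE => (trans c d w.1, invmx (tjac c d w.1) *m w.2 *m tjac c d w.1)).
  by apply/funext => w; exact: etransE.
rewrite E (derive_pair u st q2) (derive_mulmx u q1 sj) (derive_mulmx u si (smooth_at_diff s2)) d2.
rewrite (C _ _ (smooth_at_diff str)) (C _ _ (smooth_at_diff sjr)) (C _ _ (smooth_at_diff sir)).
by rewrite e1 mulmxDl.
Qed.

Lemma ecoord1 c z u : charts (f := M) c -> dom c z.1 -> (ecoord c z u).1 = tcoord c z.1 u.1.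
Proof.
move=> hc cz; rewrite ecoordE tcoordE.
by rewrite (derive_etransE u (chart_at_charts _) hc (chart_at_dom _) cz).
Qed.

(** With S inverse to T, the terms that come from differentiating S J T cancel the inhomogeneous
    term of the gauge rule for G. So the vertical component is merely conjugated under a change of
    charts. *)
Lemma vert_algebra n (S T J K DS DT U W G : 'M[R]_n) :
  T *m S = 1%:M -> DS = - (S *m DT *m S) -> K = S *m J *m T ->
  G = (DS + S *m W) *m T ->
  DS *m J *m T + S *m U *m T + S *m J *m DT + K *m G - G *m K =
  S *m (U + J *m W - W *m J) *m T.
Proof.
move=> TS eS -> ->.
have ST : S *m T = 1%:M by exact: mulmx1C.
have h1 : S *m J *m T *m ((DS + S *m W) *m T) = - (S *m J *m DT) + S *m J *m W *m T.
  rewrite mulmxDl mulmxDr eS mulNmx mulmxN; congr (- _ + _).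
    by rewrite !mulmxA -[S *m J *m T *m S]mulmxA TS mulmx1 -mulmxA ST mulmx1.
  by rewrite !mulmxA -[S *m J *m T *m S]mulmxA TS mulmx1.
have h2 : (DS + S *m W) *m T *m (S *m J *m T) = DS *m J *m T + S *m W *m J *m T.
  rewrite !mulmxA -[_ *m T *m S]mulmxA TS mulmx1 !mulmxDl; congr (_ + _).
rewrite h1 h2 mulmxBr mulmxDr mulmxBl mulmxDl !mulmxA.
rewrite opprD addrA; set a := DS *m J *m T; set b := S *m U *m T; set c := S *m J *m DT.
set d := S *m J *m W *m T; set f := S *m W *m J *m T.
rewrite addrA addrK [a + b]addrC -[b + a + d]addrAC addrK.
by [].
Qed.

Lemma vertE nabla c z u : is_connection [set: M] nabla -> charts (f := M) c -> dom c z.1 ->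
  vert nabla c (echart c z) (ecoord c z u) =
  invmx (nmx c z.1) *m vpart nabla z u *m nmx c z.1.
Proof.
move=> cn hc cz; set a := chart_at z.1; set x := z.1 in cz *.
have ha : charts (f := M) a by exact: chart_at_charts.
have ax : dom a x by exact: chart_at_dom.
have e1 : (echart c z).1 = cmap c x by rewrite (echartE hc cz).
have e2 : (echart c z).2 = invmx (nmx c x) *m z.2 *m nmx c x by rewrite (echartE hc cz).
have ea : (echart a z).2 = z.2 by rewrite echart_at.
rewrite /vert (ecoord1 u hc cz) e1 -(cmx_lcmx nabla u.1 hc cz).
have eu : (ecoord c z u).2 =
    'D_(u.1) (fun w => invmx (tjac a c w)) (cmap a x) *m z.2 *m nmx c x +
    invmx (nmx c x) *m u.2 *m nmx c x + invmx (nmx c x) *m z.2 *m 'D_(u.1) (tjac a c) (cmap a x).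
  rewrite ecoordE; apply: etrans (congr1 snd (derive_etransE u ha hc ax cz)) _.
  rewrite /= ea; exact: erefl.
rewrite eu.
have sj := smooth_tjac ha hc ax cz.
have [uj _] := tjacV ha hc ax cz.
apply: vert_algebra.
- by rewrite mulmxV // nmx_unit.
- exact: (derive_invmx u.1 sj uj).
- exact: e2.
- exact: (cmx_trans u.1 cn hc cz).
Qed.

Lemma vert_at nabla z u : is_connection [set: M] nabla ->
  vert nabla (chart_at z.1) (ebase z) u = vpart nabla z u.
Proof.
move=> cn; have := vertE u cn (chart_at_charts z.1) (chart_at_dom z.1).
by rewrite echart_at ecoord_at nmx_at invmx1 mul1mx mulmx1.
Qed.

End TwistorCharts.

Local Opaque echart Defs.etrans ecoord eloc evec conn_mx.

(** * Horizontal vectors and the lifted foliation *)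

(** Reduces the equation J' = [W, J] of a parallel endomorphism to the linear equation P' = W P.
    Conjugation moreover preserves the condition J^2 = -1. *)
Lemma derive_conj (R : realType) n (P : R -> 'M[R]_n) (A W : 'M[R]_n) (t : R) :
  smooth_at P t -> P t \in unitmx -> 'D_1 P t = W *m P t ->
  let J t := P t *m A *m invmx (P t) in
  smooth_at J t /\ 'D_1 J t = W *m J t - J t *m W.
Proof.
move=> sP uP dP J.
have si := smooth_at_invmx sP uP.
have sA : smooth_at (fun s => P s *m A) t by apply: (smooth_at_mulmx sP); exact: smooth_at_cst.
split; first exact: (smooth_at_mulmx sA si).
have dA : 'D_1 (fun s => P s *m A) t = W *m P t *m A.
  by rewrite (derive_lin (1 : R) (@mulmx_linear1 R n n n A) (smooth_at_diff sP)) dP.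
apply: etrans (derive_mulmx (1 : R) (smooth_at_diff sA) (smooth_at_diff si)) _.
rewrite (derive_invmx (1 : R) sP uP) dA dP /J !mulmxN !mulmxA; congr (_ - _).
by rewrite -[_ *m P t *m invmx (P t)]mulmxA mulmxV // mulmx1.
Qed.

Lemma vertical_commutator (R : realType) n (K G : 'M[R]_n) : K *m K = - 1%:M ->
  vertical K (K *m G - G *m K).
Proof.
move=> KK; rewrite /vertical mulmxBl mulmxBr !mulmxA KK mulNmx mul1mx.
by rewrite -[G *m K *m K]mulmxA KK mulmxN mulmx1 opprK addrC addrA subrK addNr.
Qed.

Lemma verticalD (R : realType) n (K A B : 'M[R]_n) :
  vertical K A -> vertical K B -> vertical K (A + B).
Proof. by rewrite /vertical mulmxDl mulmxDr addrACA => -> ->; rewrite addr0. Qed.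

Lemma verticalB (R : realType) n (K A B : 'M[R]_n) :
  vertical K A -> vertical K B -> vertical K (A - B).
Proof.
move=> hA hB; apply: (verticalD hA); move: hB; rewrite /vertical => hB.
by rewrite mulNmx mulmxN -opprD hB oppr0.
Qed.

Lemma vertical_mulr (R : realType) n (K A : 'M[R]_n) : vertical K A -> vertical K (A *m K).
Proof. by rewrite /vertical => h; rewrite mulmxA -mulmxDl h mul0mx. Qed.

Lemma vertical_conj (R : realType) n (K A S T : 'M[R]_n) : T *m S = 1%:M ->
  vertical K A -> vertical (S *m K *m T) (S *m A *m T).
Proof.
move=> TS h; rewrite /vertical !mulmxA -[S *m A *m T *m S]mulmxA TS mulmx1.
rewrite -[S *m K *m T *m S]mulmxA TS mulmx1 -mulmxDl -!mulmxA -mulmxDr.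
by rewrite (h : A *m K + K *m A = 0) mulmx0 mul0mx.
Qed.

Lemma conj_inj (R : realType) n (T A B : 'M[R]_n) : T \in unitmx ->
  invmx T *m A *m T = invmx T *m B *m T -> A = B.
Proof.
move=> u /(congr1 (fun C => T *m C *m invmx T)).
by rewrite -!mulmxA (mulmxV u) !mulmx1 !mulmxA (mulmxV u) !mul1mx.
Qed.

Lemma conj_eq0 (R : realType) n (T A : 'M[R]_n) : T \in unitmx ->
  invmx T *m A *m T = 0 -> A = 0.
Proof. by move=> u h; apply: (conj_inj u); rewrite h mulmx0 mul0mx. Qed.

Section TwistorFields.
Context {R : realType} {p k : nat} (M : foliated_manifold R p k).
Local Notation TV := 'rV[R]_(p + k).
Local Notation NV := 'rV[R]_k.
Local Notation chartM := (chart R (pt M) (p + k)).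
Local Notation EN := (pt M * 'M[R]_k)%type.
Local Notation TE := ('rV[R]_(p + k) * 'M[R]_k)%type.
Implicit Types (c d e : chartM) (x : M) (nabla : covderiv M) (z : EN).

Lemma echart1 c z : charts (f := M) c -> dom c z.1 -> (echart c z).1 = cmap c z.1.
Proof. by move=> hc cz; rewrite (echartE hc cz). Qed.

Lemma echart2 c z : charts (f := M) c -> dom c z.1 ->
  (echart c z).2 = invmx (nmx c z.1) *m z.2 *m nmx c z.1.
Proof. by move=> hc cz; rewrite (echartE hc cz). Qed.

Lemma twistor_echart c z : charts (f := M) c -> dom c z.1 ->
  twistor z <-> (echart c z).2 *m (echart c z).2 = - 1%:M.
Proof.
move=> hc cz; have u := nmx_unit hc cz; rewrite (echart2 hc cz) /twistor /=.
rewrite !mulmxA -[_ *m nmx c z.1 *m invmx _]mulmxA (mulmxV u) mulmx1.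
rewrite -[_ *m z.2 *m z.2]mulmxA; split=> [->|h].
  by rewrite mulmxN mulmx1 mulNmx (mulVmx u).
have : nmx c z.1 *m (invmx (nmx c z.1) *m (z.2 *m z.2) *m nmx c z.1) *m invmx (nmx c z.1) = - 1%:M.
  by rewrite h mulmxN mulmx1 mulNmx (mulmxV u).
by rewrite -!mulmxA (mulmxV u) mulmx1 !mulmxA (mulmxV u) mul1mx.
Qed.

(** Over a straight line of the chart, conjugation by a fundamental solution P is parallel
    transport. The curve is written in the fixed chart c, whereas [velocity] uses the preferred
    chart of each of its points; [evec] translates between them. *)
Lemma chart_curve_parallel nabla c (b v : TV) (P : R -> 'M[R]_k) (J0 : 'M[R]_k) (e : R) :
  is_connection [set: M] nabla -> charts (f := M) c -> J0 *m J0 = - 1%:M ->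
  (forall t : R, `|t| < e -> exists y, b + t *: v = cmap c y /\ dom c y) ->
  (forall t : R, `|t| < e -> [/\ P t \in unitmx, smooth_at P t &
     'D_1 P t = lcmx nabla c v (b + t *: v) *m P t]) ->
  let G t : TE := (b + t *: v, P t *m J0 *m invmx (P t)) in
  let g t := einv c (G t) in
  parallel_curve nabla e g /\
  forall t : R, `|t| < e -> velocity g t = evec c (g t)
    (v, lcmx nabla c v (b + t *: v) *m (G t).2 - (G t).2 *m lcmx nabla c v (b + t *: v)).
Proof.
move=> cn hc J00 hB hP G g.
have gc t : `|t| < e -> dom c (g t).1 /\ echart c (g t) = G t.
  move=> /hB[y [ey cy]]; have E : (G t).1 = cmap c y by exact: ey.
  split; last exact: (einvK hc cy E).
  by rewrite /g (einvE cy E).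
have sG t : `|t| < e -> smooth_at G t /\ 'D_1 G t =
    (v, lcmx nabla c v (b + t *: v) *m (G t).2 - (G t).2 *m lcmx nabla c v (b + t *: v)).
  move=> /hP[uP sP dP]; have [sJ dJ] := derive_conj J0 sP uP dP.
  have sl : smooth_at (fun s : R => b + s *: v) t.
    apply: smooth_atD; first exact: smooth_at_cst.
    by apply: smooth_atZ; [exact: smooth_at_id|exact: smooth_at_cst].
  split; first exact: (smooth_at_pair sl sJ).
  apply: etrans (derive_pair (1 : R) (smooth_at_diff sl) (smooth_at_diff sJ)) _.
  rewrite dJ; apply: (congr1 (pair^~ _)).
  have di : differentiable (fun y : TV => y) (b + t *: v) by exact: smooth_at_diff (smooth_at_id _).
  by case: (smooth_at_line di) => _; rewrite derive_id.
have near_I (t : R) : `|t| < e -> \forall s \near t, `|s| < e.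
  by move=> te; apply: (cvgr_norm_lt (F := nbhs t) (f := id)) te; exact: cvg_id.
have sE t d : `|t| < e -> charts (f := M) d -> dom d (g t).1 ->
    [/\ \forall s \near t, `|s| < e /\ dom d (g s).1,
        smooth_at (fun s => echart d (g s)) t &
        'D_1 (fun s => echart d (g s)) t = 'D_('D_1 G t) (Defs.etrans c d) (echart c (g t))].
  move=> te hd dt; have [ct et] := gc t te; have [sGt _] := sG t te.
  have nd : \forall s \near t, `|s| < e /\ dom d (g s).1.
    have n1 := near_edom hc ct (near_dom dt).
    have n2 : \forall s \near t, exists y : EN, [/\ G s = echart c y, dom c y.1 & dom d y.1].
      have n1' : \forall w \near G t, exists y : EN, [/\ w = echart c y, dom c y.1 & dom d y.1].
        by rewrite -et.
      exact: (smooth_at_cont sGt n1').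
    apply: filterS2 (near_I t te) n2 => s se [y [Gy cy dy]]; split; first exact: se.
    by rewrite /g Gy (echartK hc cy).
  have E : \forall s \near t, Defs.etrans c d (G s) = echart d (g s).
    apply: filterS nd => s [se ds]; have [cs es] := gc s se.
    by rewrite -es (etrans_echart hc hd cs ds).
  have st := smooth_etrans hc hd ct dt.
  have st' : smooth_at (Defs.etrans c d) (G t) by rewrite -et.
  split; first exact: nd.
    exact: (smooth_at_eq E (smooth_at_comp sGt st')).
  rewrite -(near_eq_derive (1 : R) E) et.
  exact: (derive_comp (1 : R) (smooth_at_diff sGt) (smooth_at_diff st')).
have vE t : `|t| < e -> velocity g t = evec c (g t)
    (v, lcmx nabla c v (b + t *: v) *m (G t).2 - (G t).2 *m lcmx nabla c v (b + t *: v)).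
  move=> te; have [_ _ E] := sE t _ te (chart_at_charts (g t).1) (chart_at_dom (g t).1).
  rewrite /velocity; apply: etrans E _.
  apply: etrans (congr1 (fun U => 'D_U (Defs.etrans c (chart_at (g t).1)) (echart c (g t))) (sG t te).2) _.
  exact: (esym (evecE c (g t) _)).
split; last exact: vE.
split=> [t te|d hd O|t te].
- have [ct et] := gc t te; apply/(twistor_echart hc ct); rewrite et /G /=.
  have [uP _ _] := hP t te.
  rewrite !mulmxA -[_ *m invmx (P t) *m P t]mulmxA (mulVmx uP) mulmx1.
  by rewrite -[P t *m J0 *m J0]mulmxA J00 mulmxN mulmx1 mulNmx (mulmxV uP).
- have oO : open O.
    rewrite openE => t [te dt]; have [n _ _] := sE t d te hd dt; exact: n.
  split; first exact: oO.
  by apply/(smooth_onP _ oO) => t [te dt]; have [_ s _] := sE t d te hd dt.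
- have [ct et] := gc t te; have u := nmx_unit hc ct.
  rewrite -/(vpart nabla (g t) (velocity g t)).
  apply: (conj_eq0 u).
  rewrite -(vertE (velocity g t) cn hc ct) (vE t te) (evecK hc ct) et /vert /=.
  by rewrite subrK subrr.
Qed.

(** One direction is the parallel equation at time 0. For the other, [linear_ode] produces a
    parallel curve over the line through z with velocity u.1, and the vanishing of [vpart] says that
    u.2 is its fibre velocity. *)
Lemma horizontalP nabla z u : is_connection [set: M] nabla ->
  horizontal nabla z u <-> twistor z /\ vpart nabla z u = 0.
Proof.
move=> cn; split=> [[e [g [e0 [tw _ eq] g0 v0]]]|[tz vz]].
  have I0 : `|0 : R| < e by rewrite normr0.
  have h := eq 0 I0; rewrite v0 g0 in h.
  by split; [rewrite -g0; exact: tw|exact: h].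
set c := chart_at z.1; set b := cmap c z.1; set v := u.1.
have hc : charts (f := M) c by exact: chart_at_charts.
have cz : dom c z.1 by exact: chart_at_dom.
have cl : {for (0 : R), continuous (fun t : R => b + t *: v)}.
  apply: smooth_at_cont; apply: smooth_atD; first exact: smooth_at_cst.
  by apply: smooth_atZ; [exact: smooth_at_id|exact: smooth_at_cst].
have n0 : \forall t \near (0 : R), exists y, [/\ b + t *: v = cmap c y, dom c y & dom c y].
  have n1 : \forall w \near b + 0 *: v, exists y, [/\ w = cmap c y, dom c y & dom c y].
    by rewrite scale0r addr0; exact: (near_chart cz (near_dom cz)).
  exact: (cl _ n1).
have [e0 e00 B] := (nbhs_ballP _ _).1 n0; rewrite /= in e00.
have hB t : `|t| < e0 -> exists y, b + t *: v = cmap c y /\ dom c y.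
  move=> te; have [|y [ey cy _]] := B t; last by exists y.
  by rewrite -ball_normE /= sub0r normrN.
have sw t : `|t| < e0 -> smooth_at (fun t : R => lcmx nabla c v (b + t *: v)) t.
  move=> /hB[y [ey cy]]; apply: (smooth_at_comp (g := lcmx nabla c v)).
    apply: smooth_atD; first exact: smooth_at_cst.
    by apply: smooth_atZ; [exact: smooth_at_id|exact: smooth_at_cst].
  by rewrite ey; exact: (smooth_lcmx v cn openT I hc cy).
have [e [P [e1 ee0 P0 hP]]] := linear_ode e00 sw.
have hBe t : `|t| < e -> exists y, b + t *: v = cmap c y /\ dom c y.
  by move=> te; apply: hB; exact: lt_le_trans te ee0.
have [pc vE] := chart_curve_parallel cn hc tz hBe hP.
set g := fun t => _ in pc vE.
have z0 : z = g 0.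
  rewrite /g P0 invmx1 mul1mx mulmx1 scale0r addr0.
  by rewrite -[LHS](echartK hc cz) echart_at.
exists e, g; split; [exact: e1|exact: pc|exact: (esym z0)|].
have I0 : `|0 : R| < e by rewrite normr0.
rewrite (vE 0 I0) -[einv c _]/(g 0) -z0 /= P0 invmx1 mul1mx mulmx1 scale0r addr0.
rewrite evecE (derive_etrans_id _ hc cz).
move: vz; rewrite /vpart conn_mxE (cmx_lcmx nabla _ hc cz) tcoord_at -/v => vz.
rewrite [RHS]surjective_pairing; apply: (congr1 (pair _)).
by move: vz => /eqP; rewrite -addrA addr_eq0 => /eqP ->; rewrite opprB.
Qed.

Lemma vert_leaf nabla c z (U : TE) : adapted_connection [set: M] nabla ->
  charts (f := M) c -> dom c z.1 -> rsubmx U.1 = 0 -> vert nabla c (echart c z) U = U.2.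
Proof.
move=> ad hc cz U0; have [cn _] := ad.
have r : rsubmx U.1 = rsubmx (0 : TV) by rewrite U0 linear0.
rewrite /vert (echart1 hc cz) (adapted_lcmx ad openT I hc cz r) (lcmx0 cn I hc cz).
by rewrite mulmx0 mul0mx addr0 subr0.
Qed.

Lemma vpart_leaf nabla z (u : TE) : adapted_connection [set: M] nabla ->
  rsubmx u.1 = 0 -> vpart nabla z u = u.2.
Proof.
move=> ad u0; have [cn _] := ad; rewrite -(vert_at z u cn) -echart_at.
exact: (vert_leaf ad (chart_at_charts _) (chart_at_dom _) u0).
Qed.

(** An adapted G vanishes in leaf directions, so the horizontal lift of a leaf vector has no fibre
    component. This is the independence of the lifted foliation from the adapted connection. *)
Lemma lifted_leafP nabla z u : adapted_connection [set: M] nabla ->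
  lifted_leaf nabla z u <-> [/\ twistor z, rsubmx u.1 = 0 & u.2 = 0].
Proof.
move=> ad; have [cn _] := ad; split=> [[/(horizontalP z u cn)[tz v0] u0]|[tz u0 u2]].
  by split; [exact: tz|exact: u0|rewrite -v0 (vpart_leaf z ad u0)].
by split; [apply/(horizontalP z u cn); split; [exact: tz|rewrite (vpart_leaf z ad u0)]|exact: u0].
Qed.

Lemma lifted_leaf_chart nabla c z u : adapted_connection [set: M] nabla ->
  charts (f := M) c -> dom c z.1 -> twistor z ->
  lifted_leaf nabla z u <-> rsubmx (ecoord c z u).1 = 0 /\ (ecoord c z u).2 = 0.
Proof.
move=> ad hc cz tz; have [cn _] := ad; have un := nmx_unit hc cz.
have E := vertE u cn hc cz.
split=> [/(lifted_leafP z u ad)[_ u0 u2]|[U0 U2]].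
  have U0 : rsubmx (ecoord c z u).1 = 0 by rewrite (ecoord1 u hc cz); apply/leaf_rsubmx_tcoord.
  split; first exact: U0.
  by move: E; rewrite (vert_leaf ad hc cz U0) (vpart_leaf z ad u0) u2 mulmx0 mul0mx.
have u0 : rsubmx u.1 = 0 by move: U0; rewrite (ecoord1 u hc cz) => /(leaf_rsubmx_tcoord _ hc cz).
apply/(lifted_leafP z u ad); split; [exact: tz|exact: u0|].
by apply: (conj_eq0 un); move: E; rewrite (vert_leaf ad hc cz U0) (vpart_leaf z ad u0) U2.
Qed.

Lemma vertical_vpart nabla z u : twistor z -> vertical z.2 u.2 <-> vertical z.2 (vpart nabla z u).
Proof.
move=> tz; have h := vertical_commutator (conn_mx nabla z.1 u.1) tz.
rewrite /vpart -addrA; split=> [v|v]; first exact: verticalD v h.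
by rewrite -[u.2](addrK (z.2 *m conn_mx nabla z.1 u.1 - conn_mx nabla z.1 u.1 *m z.2)); exact: verticalB v h.
Qed.

Lemma vertical_vert nabla c (w U : TE) : w.2 *m w.2 = - 1%:M ->
  vertical w.2 U.2 <-> vertical w.2 (vert nabla c w U).
Proof.
move=> tz; have h := vertical_commutator (lcmx nabla c U.1 w.1) tz.
rewrite /vert -addrA; split=> [v|v]; first exact: verticalD v h.
by rewrite -[U.2](addrK (w.2 *m lcmx nabla c U.1 w.1 - lcmx nabla c U.1 w.1 *m w.2)); exact: verticalB v h.
Qed.

Lemma vertical_chart_conj c z A : charts (f := M) c -> dom c z.1 ->
  vertical z.2 A <-> vertical (echart c z).2 (invmx (nmx c z.1) *m A *m nmx c z.1).
Proof.
move=> hc cz; have un := nmx_unit hc cz; rewrite (echart2 hc cz); split.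
  by apply: vertical_conj; exact: mulmxV un.
move=> /(vertical_conj (mulVmx un)).
by rewrite !mulmxA !(mulmxV un) !mul1mx -![_ *m nmx c z.1 *m _]mulmxA !(mulmxV un) !mulmx1.
Qed.

Lemma vertical_ecoord nabla c z u : is_connection [set: M] nabla ->
  charts (f := M) c -> dom c z.1 -> twistor z ->
  vertical z.2 u.2 <-> vertical (echart c z).2 (ecoord c z u).2.
Proof.
move=> cn hc cz tz; have tc := (twistor_echart hc cz).1 tz.
have E := vertE u cn hc cz; split.
  move/(vertical_vpart nabla u tz)/(vertical_chart_conj _ hc cz); rewrite -E.
  by move/(vertical_vert nabla c (ecoord c z u) tc).
move/(vertical_vert nabla c (ecoord c z u) tc); rewrite E.
by move/(vertical_chart_conj _ hc cz)/(vertical_vpart nabla u tz).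
Qed.

(** Subtracting a fibre vector changes [vpart] by that vector, so horizontality of the remainder
    determines the vertical component. *)
Lemma zprojP nabla z (u : TE) (s : NV * 'M[R]_k) : is_connection [set: M] nabla -> twistor z ->
  zproj nabla z u s <-> [/\ s.1 = rsubmx u.1, vertical z.2 s.2 & s.2 = vpart nabla z u].
Proof.
move=> cn tz.
have E : vpart nabla z (u.1, u.2 - s.2) = vpart nabla z u - s.2.
  by rewrite /vpart /= -!addrA; congr (_ + _); rewrite addrC -!addrA.
split=> [[e v /(horizontalP z _ cn)[_]]|[e v h]].
  by rewrite E => /eqP; rewrite subr_eq0 => /eqP h; split.
split=> //; apply/(horizontalP z _ cn); split; first exact: tz.
by rewrite E -h subrr.
Qed.

Lemma zproj_chart nabla c z (u : TE) (s : NV * 'M[R]_k) : is_connection [set: M] nabla ->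
  charts (f := M) c -> dom c z.1 -> twistor z ->
  zproj nabla z u s <->
  [/\ rsubmx (ecoord c z u).1 = s.1 *m nmx c z.1, vertical (echart c z).2 (ecoord c z u).2 &
      vert nabla c (echart c z) (ecoord c z u) = invmx (nmx c z.1) *m s.2 *m nmx c z.1].
Proof.
move=> cn hc cz tz; have un := nmx_unit hc cz.
rewrite (ecoord1 u hc cz) (rsubmx_tcoord _ hc cz) (vertE u cn hc cz).
split=> [/(zprojP u s cn tz)[e v h]|[e v h]].
  rewrite -e -h; split=> //; apply/(vertical_ecoord u cn hc cz tz).
  by apply/(vertical_vpart nabla u tz); rewrite -h.
have h' := conj_inj un h; apply/(zprojP u s cn tz); split; last exact: (esym h').
  by rewrite -[RHS](mulmxK un) e mulmxK.
by rewrite -h'; apply/(vertical_vpart nabla u tz)/(vertical_ecoord u cn hc cz tz).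
Qed.

End TwistorFields.

(** * Foliated fields on the twistor space *)

Lemma derive_pair_cst (R : realType) (V W Z : normedModType R) {bV : fin_basis V} {bW : fin_basis W}
    (F : V * W -> Z) (x a : V) (K : W) : differentiable F (x, K) ->
  'D_a (fun y => F (y, K)) x = 'D_(a, 0) F (x, K).
Proof.
move=> dF; have s1 : smooth_at (fun y : V => (y, K)) x.
  by apply: smooth_at_pair; [exact: smooth_at_id|exact: smooth_at_cst].
apply: etrans (derive_comp a (smooth_at_diff s1) dF) _.
rewrite (derive_pair a (smooth_at_diff (smooth_at_id x)) (smooth_at_diff (smooth_at_cst K x))).
by rewrite derive_id derive_cst.
Qed.

Lemma smooth_pair_cst (R : realType) (V W Z : normedModType R) {bV : fin_basis V} {bW : fin_basis W}
    (F : V * W -> Z) (x : V) (K : W) : smooth_at F (x, K) -> smooth_at (fun y => F (y, K)) x.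
Proof.
move=> sF; apply: (smooth_at_comp (g := F) _ sF).
by apply: smooth_at_pair; [exact: smooth_at_id|exact: smooth_at_cst].
Qed.

Lemma vbracket_cst (R : realType) (V : normedModType R) (X Y : V -> V) (z U : V) :
  (\forall w \near z, Y w = U) -> vbracket X Y z = - 'D_U X z.
Proof.
move=> n; rewrite /vbracket (nbhs_singleton n) (near_eq_derive _ n).
by rewrite (derive_cst U) sub0r.
Qed.

Lemma leaf_vecB (R : realType) p k n (D D' : 'rV[R]_(p + k) * 'M[R]_n) :
  rsubmx D.1 = 0 /\ D.2 = 0 -> rsubmx D'.1 = 0 /\ D'.2 = 0 ->
  rsubmx (D - D').1 = 0 /\ (D - D').2 = 0.
Proof. by case: D D' => a b [c d] /= [h ->] [h' ->]; rewrite subrr linearB /= h h' subrr. Qed.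

Lemma leaf_vecN (R : realType) p k n (D : 'rV[R]_(p + k) * 'M[R]_n) :
  rsubmx (- D).1 = 0 /\ (- D).2 = 0 -> rsubmx D.1 = 0 /\ D.2 = 0.
Proof.
case: D => a b /= [h h']; rewrite -[a]opprK -[b]opprK h' oppr0; split=> //.
by rewrite linearN /= h oppr0.
Qed.

(* A tangent vector of the quadric K^2 = -1 is the velocity of the conjugates
   of K by 1 + t B, where B = K A / 2. *)
Lemma conj_curve (R : realType) n (K A : 'M[R]_n) : K *m K = - 1%:M -> vertical K A ->
  exists J : R -> 'M[R]_n, [/\ J 0 = K, smooth_at J 0, 'D_1 J 0 = A &
    \forall t \near (0 : R), J t *m J t = - 1%:M].
Proof.
move=> KK vA; pose B := 2^-1 *: (K *m A).
pose P (t : R) := 1%:M + t *: B : 'M[R]_n.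
have sP : smooth_at P 0.
  apply: smooth_atD; first exact: smooth_at_cst.
  by apply: smooth_atZ; [exact: smooth_at_id|exact: smooth_at_cst].
have P0 : P 0 = 1%:M by rewrite /P scale0r addr0.
have uP0 : P 0 \in unitmx by rewrite P0 unitmx1.
have dP : 'D_1 P 0 = B *m P 0.
  rewrite P0 mulmx1.
  rewrite (derive_fD (1 : R) (smooth_at_diff (smooth_at_cst (1%:M : 'M[R]_n) (0 : R)))
     (smooth_at_diff (smooth_atZ (smooth_at_id (0 : R)) (smooth_at_cst B (0 : R))))).
  rewrite derive_cst add0r.
  rewrite (diffZ_fun (smooth_at_diff (smooth_at_id (0 : R))) (smooth_at_diff (smooth_at_cst B (0 : R)))).2.
  by rewrite derive_id derive_cst scaler0 addr0 scale1r.
have [sJ dJ] := derive_conj K sP uP0 dP.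
exists (fun t => P t *m K *m invmx (P t)); split.
- by rewrite P0 invmx1 mul1mx mulmx1.
- exact: sJ.
- rewrite dJ P0 invmx1 mul1mx mulmx1 /B -scalemxAl -scalemxAr -mulmxA.
  have AK : A *m K = - (K *m A) by apply/eqP; rewrite -addr_eq0; apply/eqP.
  have KAK : K *m (A *m K) = A by rewrite AK mulmxN mulmxA KK mulNmx mul1mx opprK.
  rewrite KAK mulmxA KK mulNmx mul1mx scalerN opprK -scalerDl.
  by rewrite -[RHS]scale1r; congr (_ *: _); lra.
- apply: filterS (near_unitmx (smooth_at_cont sP) uP0) => t ut.
  rewrite !mulmxA -[_ *m invmx (P t) *m P t]mulmxA (mulVmx ut) mulmx1.
  by rewrite -[P t *m K *m K]mulmxA KK mulmxN mulmx1 mulNmx (mulmxV ut).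
Qed.

Section Projectable.
Context {R : realType} {p k : nat} (M : foliated_manifold R p k).
Local Notation TV := 'rV[R]_(p + k).
Local Notation NV := 'rV[R]_k.
Local Notation chartM := (chart R (pt M) (p + k)).
Local Notation EN := (pt M * 'M[R]_k)%type.
Local Notation TE := ('rV[R]_(p + k) * 'M[R]_k)%type.
Implicit Types (c d e : chartM) (x : M) (nabla : covderiv M) (z : EN).

Lemma smooth_lcmx_fun nabla (V : normedModType R) c x (g u : V -> TV) (v : V) :
  is_connection [set: M] nabla -> charts (f := M) c -> dom c x -> g v = cmap c x ->
  smooth_at g v -> smooth_at u v -> smooth_at (fun y => lcmx nabla c (u y) (g y)) v.
Proof.
move=> cn hc cx e sg su.
pose h y := \sum_j u y 0 j *: lcmx nabla c (delta_mx 0 j) (g y).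
apply: (@smooth_at_eq _ _ _ h).
  have n1 : \forall z \near g v, exists y, [/\ z = cmap c y, dom c y & dom c y].
    by rewrite e; exact: (near_chart cx (near_dom cx)).
  have n2 : \forall w \near v, exists y, [/\ g w = cmap c y, dom c y & dom c y].
    exact: (smooth_at_cont sg n1).
  apply: filterS n2 => w [y [ey cy _]].
  rewrite /h [u _ in RHS]row_sum_delta ey.
  have L := lcmx_linear cn (I : [set: M] y) hc cy.
  pose LL : {linear TV -> 'M[R]_k} := HB.pack (fun u => lcmx nabla c u (cmap c y))
     (GRing.isLinear.Build _ _ _ _ _ L).
  rewrite -[RHS]/(LL (\sum_j u w 0 j *: delta_mx 0 j)) linear_sum.
  by apply: eq_bigr => j _; rewrite linearZ.
apply: smooth_at_sum => j _; apply: smooth_atZ; first exact: smooth_at_entry.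
apply: (smooth_at_comp (g := lcmx nabla c (delta_mx 0 j)) sg).
by rewrite e; exact: (smooth_lcmx _ cn openT I hc cx).
Qed.

(** In the chart the lifted leaves are given by constant transverse coordinates and constant K. The
    condition is constancy along them modulo their tangent space, at the point w. *)
Definition leafwise_constant c (X : EN -> TE) (w : TE) : Prop := forall a : 'rV[R]_p,
  rsubmx ('D_(row_mx a 0, 0) (eloc c X) w).1 = 0 /\ ('D_(row_mx a 0, 0) (eloc c X) w).2 = 0.

Lemma near_eloc_cst c z (U : TE) : charts (f := M) c -> dom c z.1 ->
  \forall w \near echart c z, eloc c (fun y => evec c y U) w = U.
Proof.
move=> hc cz; apply: filterS (near_edom hc cz (near_dom cz)) => _ [y [-> cy _]].
by rewrite (elocE _ hc cy) (evecK hc cy).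
Qed.

Lemma eopenI_dom c (O : set EN) : charts (f := M) c -> eopen O ->
  eopen [set z | O z /\ dom c z.1].
Proof.
move=> hc oO; have := eopen_chart hc openT oO.
have -> : [set z | [/\ O z, dom c z.1 & [set: TE] (echart c z)]] = [set z | O z /\ dom c z.1].
  by apply/seteqP; split=> z /=; [case|case=> ? ?; split].
exact.
Qed.

(** The field equal to (a, 0) in the chart is tangent to the lifted leaves, and the bracket of X
    with it is minus the derivative of X in this direction. *)
Lemma zfoliated_field_leaf nabla (O : set EN) X c z : adapted_connection [set: M] nabla ->
  eopen O -> zfoliated_field nabla O X -> O z -> twistor z ->
  charts (f := M) c -> dom c z.1 -> leafwise_constant c X (echart c z).
Proof.
move=> ad oO [zX fX] Oz tz hc cz a; have [cn _] := ad.
set U : TE := (row_mx a 0, 0).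
pose O' := [set y | O y /\ dom c y.1]; pose Y y := evec c y U.
have oO' : eopen O' by exact: eopenI_dom.
have lY y : O' y -> twistor y -> lifted_leaf nabla y (Y y).
  move=> [_ cy] ty; apply/(lifted_leaf_chart _ ad hc cy ty).
  by rewrite (evecK hc cy); split; [exact: row_mxKr|].
have zY : zleaf_field nabla O' Y.
  split; last exact: lY.
  apply/(zfieldP _ oO'); split.
    move=> y [_ cy]; exists c; split; [exact: hc|exact: cy|].
    apply: smooth_at_eq (smooth_at_cst U _).
    by apply: filterS (near_eloc_cst U hc cy) => w ->.
  move=> y O'y ty; have /(lifted_leafP _ _ ad)[_ _ ->] := lY y O'y ty.
  by rewrite /vertical mul0mx mulmx0 addr0.
have sX := zfield_smooth oO zX Oz hc cz.
have nY := near_eloc_cst U hc cz.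
have sY : smooth_at (eloc c Y) (echart c z).
  by apply: smooth_at_eq (smooth_at_cst U _); apply: filterS nY => w ->.
have O'z : O' z by [].
have := fX O' Y oO' (fun y (h : O' y) => h.1) zY z O'z tz.
move/(lifted_leaf_chart _ ad hc cz tz); rewrite (ecoord_bracket hc cz sX sY).
by rewrite (vbracket_cst (eloc c X) nY) => /leaf_vecN.
Qed.

(** A leaf field is constrained only along the twistor space, so its transverse and fibre components
    are known to be 0 only there. They are differentiated along a curve inside it with velocity U: a
    line in the base, the curve of [conj_curve] in the fibre. *)
Lemma derive_leaf_part nabla (O : set EN) Y c z (U : TE) : adapted_connection [set: M] nabla ->
  eopen O -> zleaf_field nabla O Y -> O z -> twistor z -> charts (f := M) c -> dom c z.1 ->
  vertical (echart c z).2 U.2 ->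
  rsubmx ('D_U (eloc c Y) (echart c z)).1 = 0 /\ ('D_U (eloc c Y) (echart c z)).2 = 0.
Proof.
move=> ad oO [zY lY] Oz tz hc cz vU.
have sY := zfield_smooth oO zY Oz hc cz.
have KK := (twistor_echart hc cz).1 tz.
have [J [J0 sJ dJ nJ]] := conj_curve KK vU.
pose G (t : R) : TE := ((echart c z).1 + t *: U.1, J t).
have sl : smooth_at (fun t : R => (echart c z).1 + t *: U.1) 0.
  apply: smooth_atD; first exact: smooth_at_cst.
  by apply: smooth_atZ; [exact: smooth_at_id|exact: smooth_at_cst].
have sG : smooth_at G 0 by exact: (smooth_at_pair sl sJ).
have G0 : G 0 = echart c z by rewrite /G J0 scale0r addr0 -surjective_pairing.
have dG : 'D_1 G 0 = U.
  apply: etrans (derive_pair (1 : R) (smooth_at_diff sl) (smooth_at_diff sJ)) _.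
  rewrite dJ [RHS]surjective_pairing; apply: (congr1 (pair^~ _)).
  have di : differentiable (fun y : TV => y) ((echart c z).1 + (0 : R) *: U.1).
    exact: smooth_at_diff (smooth_at_id _).
  by case: (smooth_at_line di) => _; rewrite derive_id.
have n1 : \forall w \near G 0, exists y : EN, [/\ w = echart c y, dom c y.1 & O y].
  by rewrite G0; exact: near_echart.
have n2 := smooth_at_cont sG n1.
have n3 : \forall t \near (0 : R), rsubmx (eloc c Y (G t)).1 = 0 /\ (eloc c Y (G t)).2 = 0.
  apply: filterS2 nJ n2 => t JJ [y [Gy cy Oy]].
  have ty : twistor y by apply/(twistor_echart hc cy); rewrite -Gy.
  rewrite Gy (elocE _ hc cy); apply/(lifted_leaf_chart _ ad hc cy ty).
  exact: lY.
have dY : differentiable (eloc c Y) (G 0) by rewrite G0; exact: smooth_at_diff.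
have dYG : differentiable (fun t => eloc c Y (G t)) 0 by exact: (differentiable_comp (smooth_at_diff sG) dY).
have E : 'D_U (eloc c Y) (echart c z) = 'D_1 (fun t => eloc c Y (G t)) (0 : R).
  apply/esym; apply: etrans (derive_comp (1 : R) (smooth_at_diff sG) dY) _.
  by rewrite dG G0.
have l1 : linear (fun w : TE => rsubmx w.1) by move=> r u v; rewrite -(@rsubmx_linear R 1 p k).
rewrite E; split.
  rewrite -(derive_lin (1 : R) l1 dYG).
  have n4 : \forall t \near (0 : R), rsubmx (eloc c Y (G t)).1 = 0 by apply: filterS n3 => t [].
  by rewrite (near_eq_derive _ n4) derive_cst.
rewrite -(derive_lin (1 : R) (@snd_linear R _ _) dYG).
have n4 : \forall t \near (0 : R), (eloc c Y (G t)).2 = 0 by apply: filterS n3 => t [].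
by rewrite (near_eq_derive _ n4) derive_cst.
Qed.

(** As for [foliated_fieldI], with one change: D_X Y is controlled by [derive_leaf_part], which
    applies because X is tangent to the twistor space. *)
Lemma zfoliated_fieldI nabla (O : set EN) X : adapted_connection [set: M] nabla ->
  eopen O -> zfield O X ->
  (forall z, O z -> twistor z -> exists c, [/\ charts (f := M) c, dom c z.1 &
     leafwise_constant c X (echart c z)]) ->
  zfoliated_field nabla O X.
Proof.
move=> ad oO zX h; split; first exact: zX.
have [cn _] := ad; move=> O' Y oO' O'O zY z O'z tz.
have Oz := O'O z O'z; have [c [hc cz lc]] := h z Oz tz.
have sX := zfield_smooth oO zX Oz hc cz.
have [zfY lY] := zY; have sY := zfield_smooth oO' zfY O'z hc cz.
apply/(lifted_leaf_chart _ ad hc cz tz); rewrite (ecoord_bracket hc cz sX sY) /vbracket.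
have [_ vX] := zX.
have vU : vertical (echart c z).2 (eloc c X (echart c z)).2.
  by rewrite (elocE _ hc cz); apply/(vertical_ecoord _ cn hc cz tz); exact: vX.
have [a1 a2] := derive_leaf_part ad oO' zY O'z tz hc cz vU.
have [b1 b2] : rsubmx ('D_(eloc c Y (echart c z)) (eloc c X) (echart c z)).1 = 0 /\
    ('D_(eloc c Y (echart c z)) (eloc c X) (echart c z)).2 = 0.
  have [r1 r2] : rsubmx (eloc c Y (echart c z)).1 = 0 /\ (eloc c Y (echart c z)).2 = 0.
    by rewrite (elocE _ hc cz); apply/(lifted_leaf_chart _ ad hc cz tz); exact: lY.
  have -> : eloc c Y (echart c z) = (row_mx (lsubmx (eloc c Y (echart c z)).1) 0, 0).
    by rewrite [LHS]surjective_pairing r2 -(row_mx_leaf r1).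
  exact: lc.
exact: (leaf_vecB (conj a1 a2) (conj b1 b2)).
Qed.

End Projectable.

(** * Projectability of I_1 in terms of the connection *)

Lemma derive_twisted (R : realType) (V : normedModType R) n (f g h : V -> 'M[R]_n) (K : 'M[R]_n) x v :
  smooth_at f x -> smooth_at g x -> smooth_at h x ->
  'D_v (fun y => (f y + K *m g y - g y *m K) *m K - (K *m h y - h y *m K)) x =
  ('D_v f x + K *m 'D_v g x - 'D_v g x *m K) *m K - (K *m 'D_v h x - 'D_v h x *m K).
Proof.
move=> sf sg sh.
have l1 := @mulmx_linear1 R n n n K; have l2 := @mulmx_linear2 R n n n K.
have s1 (q : V -> 'M[R]_n) : smooth_at q x -> smooth_at (fun y => q y *m K) x.
  by move=> sq; exact: (smooth_at_lin l1 sq).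
have s2 (q : V -> 'M[R]_n) : smooth_at q x -> smooth_at (fun y => K *m q y) x.
  by move=> sq; exact: (smooth_at_lin l2 sq).
have d1 (q : V -> 'M[R]_n) : smooth_at q x -> 'D_v (fun y => q y *m K) x = 'D_v q x *m K.
  by move=> sq; exact: (derive_lin v l1 (smooth_at_diff sq)).
have d2 (q : V -> 'M[R]_n) : smooth_at q x -> 'D_v (fun y => K *m q y) x = K *m 'D_v q x.
  by move=> sq; exact: (derive_lin v l2 (smooth_at_diff sq)).
have sa := smooth_atB (smooth_atD sf (s2 _ sg)) (s1 _ sg).
rewrite (derive_fB v (smooth_at_diff (s1 _ sa)) (smooth_at_diff (smooth_atB (s2 _ sh) (s1 _ sh)))).
rewrite (d1 _ sa) (derive_fB v (smooth_at_diff (smooth_atD sf (s2 _ sg))) (smooth_at_diff (s1 _ sg))).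
rewrite (derive_fD v (smooth_at_diff sf) (smooth_at_diff (s2 _ sg))).
rewrite (derive_fB v (smooth_at_diff (s2 _ sh)) (smooth_at_diff (s1 _ sh))).
by rewrite (d1 _ sg) (d2 _ sg) (d1 _ sh) (d2 _ sh).
Qed.

Lemma commutator_eq (R : realType) n (K A B A' B' : 'M[R]_n) : A = A' -> B = B' ->
  (K *m A' - A' *m K) *m K = K *m B' - B' *m K ->
  (K *m A - A *m K) *m K - (K *m B - B *m K) = 0.
Proof. by move=> -> -> ->; rewrite subrr. Qed.

Section ProjectableCriterion.
Context {R : realType} {p k : nat} (M : foliated_manifold R p k).
Local Notation TV := 'rV[R]_(p + k).
Local Notation NV := 'rV[R]_k.
Local Notation chartM := (chart R (pt M) (p + k)).
Local Notation EN := (pt M * 'M[R]_k)%type.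
Local Notation TE := ('rV[R]_(p + k) * 'M[R]_k)%type.
Implicit Types (c d e : chartM) (x : M) (nabla : covderiv M) (z : EN).

(** Passing to the chart conjugates J and the vertical components by the same matrix [nmx c z.1], so
    I_1 remains right multiplication by the matrix K of J. *)
Lemma zproj_I1 nabla c z (u u' : TE) (s : NV * 'M[R]_k) : is_connection [set: M] nabla ->
  charts (f := M) c -> dom c z.1 -> twistor z -> zproj nabla z u s ->
  let K := (echart c z).2 in let U := ecoord c z u in let U' := ecoord c z u' in
  zproj nabla z u' (I1 z s) <->
  [/\ rsubmx U'.1 = rsubmx U.1 *m K, vertical K U'.2 &
      vert nabla c (echart c z) U' = vert nabla c (echart c z) U *m K].
Proof.
move=> cn hc cz tz /(zproj_chart _ _ cn hc cz tz)[e1 e2 e3] K U U'.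
have un := nmx_unit hc cz.
have E1 : (I1 z s).1 *m nmx c z.1 = rsubmx U.1 *m K.
  by rewrite /U e1 /K (echart2 hc cz) !mulmxA (mulmxK un).
have E2 : invmx (nmx c z.1) *m (I1 z s).2 *m nmx c z.1 = vert nabla c (echart c z) U *m K.
  by rewrite /U e3 /K (echart2 hc cz) !mulmxA (mulmxK un).
split=> [/(zproj_chart _ _ cn hc cz tz)[f1 f2 f3]|[f1 f2 f3]].
  by split; [rewrite -E1|exact: f2|rewrite -E2].
by apply/(zproj_chart _ _ cn hc cz tz); split; [rewrite E1|exact: f2|rewrite E2].
Qed.

Definition leafwise_criterion nabla : Prop :=
  forall c x (a : 'rV[R]_p) (w : NV) (K : 'M[R]_k), charts (f := M) c -> dom c x ->
  K *m K = - 1%:M ->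
  let Om v := 'D_(row_mx a 0) (lcmx nabla c (row_mx 0 v)) (cmap c x) in
  (K *m Om w - Om w *m K) *m K = K *m Om (w *m K) - Om (w *m K) *m K.

Lemma zproj_self nabla z (u : TE) : is_connection [set: M] nabla -> twistor z ->
  vertical z.2 u.2 -> zproj nabla z u (rsubmx u.1, vpart nabla z u).
Proof.
move=> cn tz v; apply/(zprojP _ _ cn tz); split; [by []| |by []].
exact/(vertical_vpart nabla u tz).
Qed.

(** The test section is the class of the field constantly equal to (w, 0) in the chart. A foliated
    representative X' of its image under I_1 has transverse part w K and vertical part [K, G(w)] K,
    which determines its fibre component. *)
Lemma projectable_criterion nabla : adapted_connection [set: M] nabla ->
  I1_projectable nabla -> leafwise_criterion nabla.
Proof.
move=> ad pr c x a w K hc cx KK Om; have [cn _] := ad.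
pose O := [set z : EN | dom c z.1].
have oO : eopen O by exact: eopen_dom.
pose U : TE := (row_mx 0 w, 0); pose X y := evec c y U.
have vX y : O y -> twistor y -> vertical y.2 (X y).2.
  move=> cy ty; apply/(vertical_ecoord _ cn hc cy ty); rewrite (evecK hc cy).
  by rewrite /vertical mul0mx mulmx0 addr0.
have zX : zfield O X.
  apply/(zfieldP _ oO); split; last exact: vX.
  move=> y cy; exists c; split; [exact: hc|exact: cy|].
  apply: smooth_at_eq (smooth_at_cst U _).
  by apply: filterS (near_eloc_cst U hc cy) => u ->.
have fX : zfoliated_field nabla O X.
  apply: (zfoliated_fieldI ad oO zX) => y cy ty; exists c; split; [exact: hc|exact: cy|].
  move=> b; rewrite (near_eq_derive _ (near_eloc_cst U hc cy)) (derive_cst U).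
  by split; [exact: linear0|].
pose s y := (rsubmx (X y).1, vpart nabla y (X y)).
have ps y : O y -> twistor y -> zproj nabla y (X y) (s y).
  by move=> cy ty; apply: (zproj_self cn ty); exact: vX.
have fs : zfoliated_section nabla O s by move=> y cy ty; exists O, X; split.
pose z := einv c (cmap c x, K).
have z1 : z.1 = x by rewrite /z (@einvE _ _ _ _ c (cmap c x, K) x cx erefl).
have ez : echart c z = (cmap c x, K) := @einvK _ _ _ _ c (cmap c x, K) x hc cx erefl.
have cz : dom c z.1 by rewrite z1.
have tz : twistor z by apply/(twistor_echart hc cz); rewrite ez.
have [Q [X' [oO' O'z O'O fX' pX']]] := pr O _ oO fs z cz tz.
pose A v y : 'M[R]_k := lcmx nabla c (row_mx 0 v) y.
(* Moving y while the matrix K in the chart is kept stays in the twistor space. So the fibre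
   component of X' is known on a whole neighbourhood and may be differentiated along the leaf. *)
have nF : \forall y \near cmap c x,
    (0 + K *m A w y - A w y *m K) *m K - (K *m A (w *m K) y - A (w *m K) y *m K) =
    (eloc c X' (y, K)).2.
  have n1 := near_echart oO' O'z hc cz; rewrite ez in n1.
  have sp : smooth_at (fun y : TV => (y, K)) (cmap c x).
    by apply: smooth_at_pair; [exact: smooth_at_id|exact: smooth_at_cst].
  have n2 : \forall y \near cmap c x, exists u, [/\ (y, K) = echart c u, dom c u.1 & Q u].
    exact: (smooth_at_cont sp n1).
  apply: filterS n2 => y [u [eu cu O'u]].
  have e1 : y = cmap c u.1 by rewrite -(echart1 hc cu) -eu.
  have e2 : (echart c u).2 = K by rewrite -eu.
  have tu : twistor u by apply/(twistor_echart hc cu); rewrite e2.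
  have /(zproj_I1 _ cn hc cu tu (ps u cu tu)) := pX' u O'u tu.
  rewrite (evecK hc cu) e2 => -[f1 _ f3].
  rewrite eu (elocE _ hc cu); move: f1 f3; rewrite -eu /vert /= row_mxKr.
  set U' := ecoord c u (X' u) => f1 f3.
  have f4 : lcmx nabla c U'.1 y = A (w *m K) y.
    rewrite e1; apply: (adapted_lcmx ad openT I hc cu); rewrite f1; exact: (esym (row_mxKr _ _)).
  rewrite f4 in f3; rewrite -[X in X - _]f3.
  by rewrite -[X in X - _]addrA addrK.
have [_ l2] := zfoliated_field_leaf ad oO' fX' O'z tz hc cz a; rewrite ez in l2.
have [zX' _] := fX'.
have sX' := zfield_smooth oO' zX' O'z hc cz; rewrite ez in sX'.
have dF : 'D_(row_mx a 0) (fun y : TV => (eloc c X' (y, K)).2) (cmap c x) = 0.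
  apply: etrans (derive_lin (row_mx a 0) (@snd_linear R TV 'M[R]_k) (smooth_at_diff (smooth_pair_cst sX'))) _.
  by rewrite (derive_pair_cst (row_mx a 0) (smooth_at_diff sX')).
have sA v : smooth_at (A v) (cmap c x) by exact: (smooth_lcmx _ cn openT I hc cx).
have := derive_twisted K (row_mx a 0) (smooth_at_cst (0 : 'M[R]_k) (cmap c x)) (sA w) (sA (w *m K)).
rewrite (near_eq_derive _ nF) dF derive_cst add0r => /esym /eqP.
by rewrite subr_eq0 => /eqP.
Qed.

(* Represents I_1 applied to the class of U in the normal bundle of the lifted
   foliation. *)
Definition twist nabla c (w U : TE) : TE :=
  let v := row_mx 0 (rsubmx U.1 *m w.2) in
  (v, vert nabla c w U *m w.2 - (w.2 *m lcmx nabla c v w.1 - lcmx nabla c v w.1 *m w.2)).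

Lemma vert_twist nabla c w U : vert nabla c w (twist nabla c w U) = vert nabla c w U *m w.2.
Proof. by rewrite {1}/vert /twist /= -addrA subrK. Qed.

Lemma smooth_twist nabla c z (E : TE -> TE) : is_connection [set: M] nabla ->
  charts (f := M) c -> dom c z.1 -> smooth_at E (echart c z) ->
  smooth_at (fun w => twist nabla c w (E w)) (echart c z).
Proof.
move=> cn hc cz sE; have e1 := echart1 hc cz.
have s1 : smooth_at (fun w : TE => w.1) (echart c z) by apply: smooth_at_fst; exact: smooth_at_id.
have s2 : smooth_at (fun w : TE => w.2) (echart c z) by apply: smooth_at_snd; exact: smooth_at_id.
have sE1 : smooth_at (fun w => (E w).1) (echart c z) by exact: (smooth_at_fst sE).
have sE2 : smooth_at (fun w => (E w).2) (echart c z) by exact: (smooth_at_snd sE).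
have sr : smooth_at (fun w : TE => rsubmx (E w).1 *m w.2) (echart c z).
  exact: (smooth_at_mulmx (smooth_at_lin (@rsubmx_linear R 1 p k) sE1) s2).
have sv : smooth_at (fun w : TE => row_mx 0 (rsubmx (E w).1 *m w.2) : TV) (echart c z).
  exact: (smooth_at_lin (@row_mx0_linear R 1 p k) sr).
have sG := smooth_lcmx_fun cn hc cz e1 s1 sv.
have sA := smooth_lcmx_fun cn hc cz e1 s1 sE1.
have sV : smooth_at (fun w : TE => vert nabla c w (E w)) (echart c z).
  apply: smooth_atB (smooth_at_mulmx sA s2); apply: smooth_atD sE2 _.
  exact: (smooth_at_mulmx s2 sA).
apply: (smooth_at_pair sv); apply: smooth_atB (smooth_at_mulmx sV s2) _.
exact: (smooth_atB (smooth_at_mulmx s2 sG) (smooth_at_mulmx sG s2)).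
Qed.

Lemma derive_lcmx_leaf nabla c x (a : 'rV[R]_p) (u : TV -> TV) : adapted_connection [set: M] nabla ->
  charts (f := M) c -> dom c x -> smooth_at u (cmap c x) ->
  rsubmx ('D_(row_mx a 0) u (cmap c x)) = 0 ->
  'D_(row_mx a 0) (fun y => lcmx nabla c (u y) y) (cmap c x) =
  'D_(row_mx a 0) (lcmx nabla c (row_mx 0 (rsubmx (u (cmap c x))))) (cmap c x).
Proof.
move=> ad hc cx su r0; have [cn _] := ad.
apply: etrans (derive_lcmx_app (row_mx a 0) cn openT I hc cx su) _.
have r : rsubmx ('D_(row_mx a 0) u (cmap c x)) = rsubmx (0 : TV) by rewrite r0 linear0.
rewrite (adapted_lcmx ad openT I hc cx r) (lcmx0 cn I hc cx) add0r.
apply: near_eq_derive; apply: filterS (near_chart cx (near_dom cx)) => _ [y [-> cy _]].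
by apply: (adapted_lcmx ad openT I hc cy); exact: (esym (row_mxKr _ _)).
Qed.

(** At fixed K the components of X that enter [twist] have zero leaf derivative modulo leaf
    directions, which G ignores. Only the leaf derivative of G survives, and it does so in the
    combination that the criterion makes vanish. *)
Lemma twist_leafwise_constant nabla c z X : adapted_connection [set: M] nabla ->
  leafwise_criterion nabla -> charts (f := M) c -> dom c z.1 -> twistor z ->
  smooth_at (eloc c X) (echart c z) -> leafwise_constant c X (echart c z) ->
  leafwise_constant c (fun y => evec c y (twist nabla c (echart c y) (ecoord c y (X y)))) (echart c z).
Proof.
move=> ad cr hc cz tz sX lX a; have [cn _] := ad; have [lX1 lX2] := lX a.
have nX : \forall w \near echart c z, twist nabla c w (eloc c X w) =
    eloc c (fun y => evec c y (twist nabla c (echart c y) (ecoord c y (X y)))) w.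
  apply: filterS (near_edom hc cz (near_dom cz)) => _ [y [-> cy _]].
  by rewrite !(elocE _ hc cy) (evecK hc cy).
rewrite -(near_eq_derive _ nX).
have KK := (twistor_echart hc cz).1 tz.
have sH := smooth_twist cn hc cz sX.
set K := (echart c z).2 in KK; set x := z.1 in cz.
have ez : echart c z = (cmap c x, K) by rewrite [LHS]surjective_pairing (echart1 hc cz).
rewrite ez in sX sH lX1 lX2 *.
rewrite -(derive_pair_cst (row_mx a 0) (smooth_at_diff sH)).
pose E y := eloc c X (y, K).
have sE : smooth_at E (cmap c x) by exact: (smooth_pair_cst sX).
have dE : 'D_(row_mx a 0) E (cmap c x) = 'D_(row_mx a 0, 0) (eloc c X) (cmap c x, K).
  exact: (derive_pair_cst (row_mx a 0) (smooth_at_diff sX)).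
rewrite -dE in lX1 lX2.
have sE1 : smooth_at (fun y => (E y).1) (cmap c x) by exact: (smooth_at_fst sE).
have sE2 : smooth_at (fun y => (E y).2) (cmap c x) by exact: (smooth_at_snd sE).
have dE1 : rsubmx ('D_(row_mx a 0) (fun y => (E y).1) (cmap c x)) = 0.
  by rewrite (derive_lin (row_mx a 0) (@fst_linear R TV 'M[R]_k) (smooth_at_diff sE)).
have dE2 : 'D_(row_mx a 0) (fun y => (E y).2) (cmap c x) = 0.
  by rewrite (derive_lin (row_mx a 0) (@snd_linear R TV 'M[R]_k) (smooth_at_diff sE)).
pose L (v : TV) : TV := row_mx 0 (rsubmx v *m K).
have lL : linear L.
  by move=> r u v; rewrite /L (@rsubmx_linear R 1 p k) mulmxDl -scalemxAl (@row_mx0_linear R 1 p k).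
have sv : smooth_at (fun y => L (E y).1) (cmap c x) by exact: (smooth_at_lin lL sE1).
have dv : 'D_(row_mx a 0) (fun y => L (E y).1) (cmap c x) = 0.
  by rewrite (derive_lin (row_mx a 0) lL (smooth_at_diff sE1)) /L dE1 mul0mx row_mx0.
pose A y := lcmx nabla c (E y).1 y; pose B y := lcmx nabla c (L (E y).1) y.
have sA : smooth_at A (cmap c x) by exact: (smooth_lcmx_app cn openT I hc cz sE1).
have sB : smooth_at B (cmap c x) by exact: (smooth_lcmx_app cn openT I hc cz sv).
pose V y := ((E y).2 + K *m A y - A y *m K) *m K - (K *m B y - B y *m K).
have E' : (fun y => twist nabla c (y, K) (eloc c X (y, K))) = (fun y => (L (E y).1, V y)) by [].
have sV : smooth_at V (cmap c x) by exact: (smooth_at_snd (smooth_pair_cst sH)).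
rewrite E' (derive_pair (row_mx a 0) (smooth_at_diff sv) (smooth_at_diff sV)) /= dv.
split; first exact: linear0.
rewrite (derive_twisted K (row_mx a 0) sE2 sA sB) dE2 add0r.
have r0 : rsubmx ('D_(row_mx a 0) (fun y => L (E y).1) (cmap c x)) = 0 by rewrite dv linear0.
pose w := rsubmx (E (cmap c x)).1.
have dA : 'D_(row_mx a 0) A (cmap c x) = 'D_(row_mx a 0) (lcmx nabla c (row_mx 0 w)) (cmap c x).
  exact: (derive_lcmx_leaf ad hc cz sE1 dE1).
have rL : rsubmx (L (E (cmap c x)).1) = w *m K by exact: row_mxKr.
have dB : 'D_(row_mx a 0) B (cmap c x) =
    'D_(row_mx a 0) (lcmx nabla c (row_mx 0 (w *m K))) (cmap c x).
  by rewrite -rL; exact: (derive_lcmx_leaf ad hc cz sv r0).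
exact: (commutator_eq dA dB (cr c x a w K hc cz KK)).
Qed.

Lemma criterion_projectable nabla : adapted_connection [set: M] nabla ->
  leafwise_criterion nabla -> I1_projectable nabla.
Proof.
move=> ad cr Q s oQ fs z Qz tz; have [cn _] := ad.
have [Q1 [X [oQ1 Q1z Q1Q fX pX]]] := fs z Qz tz; have [zX _] := fX; have [_ vX] := zX.
set c := chart_at z.1.
have hc : charts (f := M) c by exact: chart_at_charts.
have cz : dom c z.1 by exact: chart_at_dom.
pose Q2 := [set y | Q1 y /\ dom c y.1].
have oQ2 : eopen Q2 by exact: eopenI_dom.
(* The chart c of z is kept for all y, which makes X' smooth. *)
pose X' y := evec c y (twist nabla c (echart c y) (ecoord c y (X y))).
have sX y : Q2 y -> smooth_at (eloc c X) (echart c y).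
  by move=> [Q1y cy]; exact: (zfield_smooth oQ1 zX Q1y hc cy).
have pX' y : Q2 y -> twistor y -> zproj nabla y (X' y) (I1 y (s y)).
  move=> [Q1y cy] ty; have KK := (twistor_echart hc cy).1 ty.
  apply/(zproj_I1 _ cn hc cy ty (pX y Q1y ty)); rewrite (evecK hc cy).
  split; [exact: row_mxKr| |exact: vert_twist].
  apply/(vertical_vert nabla c _ KK); rewrite vert_twist; apply: vertical_mulr.
  by apply/(vertical_vert nabla c _ KK)/(vertical_ecoord _ cn hc cy ty); exact: vX.
have zX' : zfield Q2 X'.
  apply/(zfieldP _ oQ2); split=> [y Q2y|y Q2y ty].
    have [_ cy] := Q2y; exists c; split; [exact: hc|exact: cy|].
    apply: smooth_at_eq (smooth_twist cn hc cy (sX y Q2y)).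
    apply: filterS (near_edom hc cy (near_dom cy)) => _ [u [-> cu _]].
    by rewrite !(elocE _ hc cu) (evecK hc cu).
  have [_ cy] := Q2y; apply/(vertical_ecoord _ cn hc cy ty).
  by case/(zproj_chart _ _ cn hc cy ty): (pX' y Q2y ty).
exists Q2, X'; split; [exact: oQ2|by []|by move=> y [/Q1Q]| |exact: pX'].
apply: (zfoliated_fieldI ad oQ2 zX') => y Q2y ty; have [Q1y cy] := Q2y.
exists c; split; [exact: hc|exact: cy|].
apply: (twist_leafwise_constant ad cr hc cy ty (sX y Q2y)).
exact: (zfoliated_field_leaf ad oQ1 fX Q1y ty hc cy).
Qed.

End ProjectableCriterion.

(** * The algebraic condition on the leafwise derivative *)

Section PureTrace.
Context {R : realType}.

Lemma linear_delta_eq0 k (W : lmodType R) (f : 'rV[R]_k -> W) : linear f ->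
  (forall i, f (delta_mx 0 i) = 0) -> forall v, f v = 0.
Proof.
move=> lf f0 v; pose g : {linear 'rV[R]_k -> W} := HB.pack f (GRing.isLinear.Build _ _ _ _ _ lf).
rewrite -[f v]/(g v) [v]row_sum_delta linear_sum big1 // => i _.
by rewrite linearZ /= f0 scaler0.
Qed.

(** Exchanges 2m and 2m + 1. Even codimension enters here: the indices are to be paired off without
    a fixed point. *)
Definition ord_flip_val (n : nat) : nat := if odd n then n.-1 else n.+1.

Lemma ord_flip_subproof q (x : 'I_q.*2) : (ord_flip_val x < q.*2)%N.
Proof.
rewrite /ord_flip_val; case: ifP => o; first by apply: leq_ltn_trans (leq_pred _) _.
have := ltn_ord x; rewrite leq_eqVlt => /orP[/eqP e|//].
by move: (congr1 odd e); rewrite /= o odd_double.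
Qed.

Definition ord_flip q (x : 'I_q.*2) : 'I_q.*2 := Ordinal (ord_flip_subproof x).

Lemma ord_flipK q : involutive (@ord_flip q).
Proof.
move=> x; apply: val_inj; rewrite /= /ord_flip_val.
case: x => -[|n] lt_n //=.
case: (boolP (odd n)) => o /=; first by rewrite o.
by rewrite (negbTE o).
Qed.

Lemma ord_flip_neq q (x : 'I_q.*2) : ord_flip x != x.
Proof.
rewrite -val_eqE /= /ord_flip_val; case: x => -[|n] lt_n //=.
by case: ifP => _ /=; [rewrite ltn_eqF|rewrite gtn_eqF].
Qed.

(** Conjugate the standard flip by the transposition of [ord_flip i] and j, which leaves i fixed. *)
Lemma free_involution q (i j : 'I_q.*2) : i != j ->
  exists s : 'I_q.*2 -> 'I_q.*2, [/\ involutive s, forall x, s x != x & s i = j].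
Proof.
move=> ij; pose t := tperm (ord_flip i) j.
exists (fun x => t (ord_flip (t x))); split.
- by move=> x; rewrite /t tpermK ord_flipK tpermK.
- move=> x; apply/eqP => h; have := ord_flip_neq (t x).
  by rewrite -{2}h /t tpermK eqxx.
- have -> : t i = i by rewrite /t tpermD // ?ord_flip_neq // eq_sym.
  by rewrite /t tpermL.
Qed.

(** Monomial matrices are sparse enough for the commutator identity to be read entry by entry, and
    the weights e leave room for free parameters. *)
Definition involution_mx k (s : 'I_k -> 'I_k) (e : 'I_k -> R) : 'M[R]_k :=
  \matrix_x (e x *: delta_mx 0 (s x)).

Lemma mul_involution_mx k (s : 'I_k -> 'I_k) e x :
  (delta_mx 0 x : 'rV[R]_k) *m involution_mx s e = e x *: delta_mx 0 (s x).
Proof. by rewrite -rowE rowK. Qed.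

Lemma involution_mx_entry k (s : 'I_k -> 'I_k) e (v : 'rV[R]_k) y : involutive s ->
  (v *m involution_mx s e) 0 y = v 0 (s y) * e (s y).
Proof.
move=> sK; rewrite mxE (bigD1 (s y)) //= !mxE sK !eqxx mulr1 big1 ?addr0 // => x xy.
rewrite !mxE eqxx /= (_ : (y == s x) = false) ?mulr0 //.
by apply/negP => /eqP yx; move: xy; rewrite yx sK eqxx.
Qed.

Lemma involution_mx_sqr k (s : 'I_k -> 'I_k) e : involutive s ->
  (forall x, e x * e (s x) = -1) -> involution_mx s e *m involution_mx s e = - 1%:M.
Proof.
move=> sK se; apply/row_matrixP => x; rewrite !rowE mulmxA mul_involution_mx -scalemxAl.
by rewrite mul_involution_mx scalerA se sK scaleN1r mulmxN mulmx1.
Qed.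

(* Feed the commutator identity with the complex structures exchanging e_i and
   e_j, up to a factor t, and any sign on the other pairs: comparing signs
   kills the components off e_i and e_j, comparing t = 1 with t = 2 the rest. *)
Lemma twist_basis q (Om : 'rV[R]_q.*2 -> 'M[R]_q.*2) (i j : 'I_q.*2) : linear Om ->
  (forall w K, K *m K = - 1%:M ->
     (K *m Om w - Om w *m K) *m K = K *m Om (w *m K) - Om (w *m K) *m K) ->
  i != j ->
  let ei : 'rV[R]_q.*2 := delta_mx 0 i in let ej : 'rV[R]_q.*2 := delta_mx 0 j in
  ei *m Om ei = (ei *m Om ei) 0 i *: ei /\
  ei *m Om ej + ej *m Om ei = (ei *m Om ei) 0 i *: ej + (ej *m Om ej) 0 j *: ei.
Proof.
move=> lO cr ij ei ej; have [s [sK sn sij]] := free_involution ij.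
have sji : s j = i by rewrite -sij sK.
pose LO : {linear 'rV[R]_q.*2 -> 'M[R]_q.*2} := HB.pack Om (GRing.isLinear.Build _ _ _ _ _ lO).
pose A := ei *m Om ei; pose C := ej *m Om ej; pose S := ei *m Om ej + ej *m Om ei.
pose sg (x : 'I_q.*2) : R := if (x < s x)%N then 1 else -1.
have sgs x : sg x * sg (s x) = -1.
  rewrite /sg sK; case: (ltngtP x (s x)) => [| |/val_inj h]; rewrite ?mul1r ?mulr1 //.
  by have := sn x; rewrite -h eqxx.
have sg0 x : sg x != 0 by rewrite /sg; case: ifP; rewrite ?oppr_eq0 oner_eq0.
(* The two weights of each pair have product -1. The scale t lives on the pair i, j, the common sign
   d on all other pairs. *)
pose e (t d : R) (x : 'I_q.*2) := if x == i then t else if x == j then - t^-1 else d * sg x.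
(* Row i of the commutator identity for w = e_i: since e_i K = t e_j, it becomes (A - t^2 C) K = t
   S. *)
have key (t d : R) y : t != 0 -> d * d = 1 -> t * S 0 y = (A - t ^+ 2 *: C) 0 (s y) * e t d (s y).
  move=> t0 dd; set K := involution_mx s (e t d).
  have KK : K *m K = - 1%:M.
    apply: involution_mx_sqr => // x; rewrite /e.
    have [->|xi] := eqVneq x i; first by rewrite sij eqxx eq_sym (negbTE ij) mulrN divff.
    have [->|xj] := eqVneq x j; first by rewrite sji eqxx mulNr mulVf.
    have -> : (s x == i) = false by apply/negP => /eqP h; move: xj; rewrite -sij -h sK eqxx.
    have -> : (s x == j) = false by apply/negP => /eqP h; move: xi; rewrite -sji -h sK eqxx.
    by rewrite mulrACA dd mul1r sgs.
  have eK : ei *m K = t *: ej by rewrite mul_involution_mx /e eqxx sij.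
  have OZ : Om (t *: ej) = t *: Om ej by rewrite -[LHS]/(LO _) linearZ.
  have h := congr1 (mulmx ei) (cr ei K KK).
  have l : ei *m ((K *m Om ei - Om ei *m K) *m K) = (t *: (ej *m Om ei) - A *m K) *m K.
    by rewrite mulmxA mulmxBr !mulmxA eK -scalemxAl.
  have r : ei *m (K *m Om (ei *m K) - Om (ei *m K) *m K) =
      t *: (t *: C) - t *: (ei *m Om ej) *m K.
    by rewrite eK OZ mulmxBr !mulmxA eK -!scalemxAr -!scalemxAl.
  rewrite l r in h; rewrite -(involution_mx_entry (e t d) _ y sK) -/K.
  suff -> : (A - t ^+ 2 *: C) *m K = t *: S by rewrite [RHS]mxE.
  have h' : t *: (t *: C) = A + t *: (S *m K).
    rewrite -[LHS](subrK (t *: (ei *m Om ej) *m K)) -h mulmxBl -[A *m K *m K]mulmxA KK.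
    rewrite mulmxN mulmx1 opprK /S mulmxDl scalerDr -!scalemxAl addrAC addrC.
    by congr (_ + _); exact: addrC.
  rewrite expr2 -scalerA h' opprD addrA subrr sub0r mulNmx -scalemxAl -mulmxA KK.
  by rewrite mulmxN mulmx1 scalerN opprK.
have ent (a c : 'rV[R]_q.*2) r x : (a - r *: c) 0 x = a 0 x - r * c 0 x by rewrite !mxE.
have off x : x != i -> x != j -> A 0 x = 0 /\ S 0 (s x) = 0.
  move=> xi xj.
  have ex t d : e t d x = d * sg x by rewrite /e (negbTE xi) (negbTE xj).
  have := key 1 1 (s x) (oner_neq0 _) (mulr1 _).
  have N1 : (-1 : R) * -1 = 1 by rewrite mulrNN mulr1.
  have n2 : (2 : R) != 0 by rewrite pnatr_eq0.
  have := key 1 (-1) (s x) (oner_neq0 _) N1.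
  have := key 2 1 (s x) n2 (mulr1 _).
  rewrite !sK !ex !ent => k1 k2 k3.
  have Ag : A 0 x * sg x = 0 by lra.
  split; last by lra.
  by move/eqP: Ag; rewrite mulf_eq0 (negbTE (sg0 x)) orbF => /eqP.
have n2 : (2 : R) != 0 by rewrite pnatr_eq0.
have ei_ t d : e t d i = t by rewrite /e eqxx.
have ej_ t d : e t d j = - t^-1 by rewrite /e eq_sym (negbTE ij) eqxx.
have Aj : A 0 j = 0 /\ S 0 i = C 0 j.
  have := key 1 1 i (oner_neq0 _) (mulr1 _); have := key 2 1 i n2 (mulr1 _).
  rewrite !sij !ej_ !ent invr1 => k1 k2; split; lra.
have Sj : S 0 j = A 0 i.
  have := key 1 1 j (oner_neq0 _) (mulr1 _); have := key 2 1 j n2 (mulr1 _).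
  rewrite !sji !ei_ !ent => k1 k2; lra.
have ei0 x : ei 0 x = (x == i)%:R by rewrite mxE eqxx.
have ej0 x : ej 0 x = (x == j)%:R by rewrite mxE eqxx.
clear key; rewrite -/A -/C -/S; clearbody A C S; case: Aj => Aj Si.
split; apply/rowP => x.
  rewrite mxE ei0; have [->|xi] := eqVneq x i; first by rewrite mulr1.
  rewrite mulr0; have [->|xj] := eqVneq x j; first exact: Aj.
  by case: (off x xi xj).
have -> : (A 0 i *: ej + C 0 j *: ei) 0 x = A 0 i * (x == j)%:R + C 0 j * (x == i)%:R.
  by rewrite [LHS]mxE [X in X + _]mxE [X in _ + X]mxE ei0 ej0.
have [->|xi] := eqVneq x i; first by rewrite (negbTE ij) mulr0 add0r mulr1.
rewrite mulr0 addr0; have [->|xj] := eqVneq x j; first by rewrite mulr1.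
have six : s x != i by apply/eqP => h; move: xj; rewrite -sij -h sK eqxx.
have sjx : s x != j by apply/eqP => h; move: xi; rewrite -sji -h sK eqxx.
by have [_] := off _ six sjx; rewrite sK mulr0.
Qed.

(** Both sides are bilinear and symmetric in v and w, so basis vectors suffice; h is read off from
    the diagonal values on them. Only the symmetrization of Om is determined in this way. *)
Lemma twist_pure_trace q (Om : 'rV[R]_q.*2 -> 'M[R]_q.*2) : linear Om ->
  (forall w K, K *m K = - 1%:M ->
     (K *m Om w - Om w *m K) *m K = K *m Om (w *m K) - Om (w *m K) *m K) ->
  exists h : 'cV[R]_q.*2, forall v w : 'rV[R]_q.*2,
    v *m Om w + w *m Om v = (v *m h) 0 0 *: w + (w *m h) 0 0 *: v.
Proof.
move=> lO cr; pose hh i : R := ((delta_mx 0 i : 'rV[R]_q.*2) *m Om (delta_mx 0 i)) 0 i.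
pose h : 'cV[R]_q.*2 := \col_i hh i.
have hE i : ((delta_mx 0 i : 'rV[R]_q.*2) *m h) 0 0 = hh i by rewrite -rowE !mxE.
exists h => v w.
pose T (v w : 'rV[R]_q.*2) := v *m Om w + w *m Om v - ((v *m h) 0 0 *: w + (w *m h) 0 0 *: v).
have lO' (a : R) (v1 v2 : 'rV[R]_q.*2) : Om (a *: v1 + v2) = a *: Om v1 + Om v2 :> 'M[R]_q.*2 by exact: lO.
have lT (w' : 'rV[R]_q.*2) (a : R) (v1 v2 : 'rV[R]_q.*2) :
    T (a *: v1 + v2) w' = a *: T v1 w' + T v2 w' :> 'rV[R]_q.*2.
  have q1 : (a *: v1 + v2) *m Om w' = a *: (v1 *m Om w') + v2 *m Om w'.
    by rewrite mulmxDl -scalemxAl.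
  have q2 : w' *m Om (a *: v1 + v2) = a *: (w' *m Om v1) + w' *m Om v2.
    by rewrite lO' mulmxDr -scalemxAr.
  have q3 : ((a *: v1 + v2) *m h) 0 0 = a * (v1 *m h) 0 0 + (v2 *m h) 0 0.
    by rewrite mulmxDl -scalemxAl [LHS]mxE [X in X + _]mxE.
  rewrite /T q1 q2 q3.
  generalize (v1 *m Om w') (v2 *m Om w') (w' *m Om v1) (w' *m Om v2) ((v1 *m h) 0 0)
    ((v2 *m h) 0 0) ((w' *m h) 0 0) => ? ? ? ? ? ? ?.
  by apply/rowP => x; rewrite !mxE; ring.
have sT a b : T a b = T b a by rewrite /T; congr (_ - _); exact: addrC.
suff : T v w = 0 by move/eqP; rewrite subr_eq0 => /eqP.
move: v; apply: (linear_delta_eq0 (lT w)) => i; rewrite sT; move: w; apply: (linear_delta_eq0 (lT _)) => j.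
rewrite /T !hE; apply/eqP; rewrite subr_eq0; apply/eqP; rewrite /hh.
have [->|ij] := eqVneq i j.
  (* The diagonal case needs a second index merely as a partner for j. *)
  have nj : j != ord_flip j by rewrite eq_sym ord_flip_neq.
  by have [e _] := twist_basis lO cr nj; rewrite -e.
by have [_ e] := twist_basis lO cr ij; rewrite addrC [RHS]addrC.
Qed.

Definition pure_trace k (Om : 'rV[R]_k -> 'M[R]_k) (h : 'cV[R]_k) : Prop :=
  forall v w : 'rV[R]_k, v *m Om w = (v *m h) 0 0 *: w + (w *m h) 0 0 *: v.

Lemma pure_traceE k (Om : 'rV[R]_k -> 'M[R]_k) h w : pure_trace Om h ->
  Om w = h *m w + ((w *m h) 0 0)%:M.
Proof.
move=> e; apply/row_matrixP => i; rewrite !rowE e mulmxDr mul_mx_scalar mulmxA.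
by rewrite [_ *m h in RHS]mx11_scalar mul_scalar_mx.
Qed.

(** The scalar part of Om commutes with K and drops out. The rank-one part h w contains w as its
    right factor, so multiplying by K on the right is the same as replacing w by w K. *)
Lemma pure_trace_twist k (Om : 'rV[R]_k -> 'M[R]_k) h w K : pure_trace Om h ->
  K *m K = - 1%:M ->
  (K *m Om w - Om w *m K) *m K = K *m Om (w *m K) - Om (w *m K) *m K.
Proof.
move=> e KK; have c v : K *m Om v - Om v *m K = K *m h *m v - h *m v *m K.
  rewrite (pure_traceE v e) mulmxDr mulmxDl scalar_mxC mulmxA.
  by rewrite opprD addrACA subrr addr0.
by rewrite !c mulmxBl !mulmxA -[h *m w *m K *m K]mulmxA KK !mulmxN.
Qed.

Lemma pure_trace_tr k (Om : 'rV[R]_k -> 'M[R]_k) h w : pure_trace Om h ->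
  \tr (Om w) = k.+1%:R * (w *m h) 0 0.
Proof.
move=> e; rewrite (pure_traceE w e) linearD /= mxtrace_mulC mxtrace_scalar.
by rewrite /mxtrace big_ord1 -natr1 mulrDl mul1r addrC mulr_natl.
Qed.

Lemma symmetric_pure_trace q (Om : 'rV[R]_q.*2 -> 'M[R]_q.*2) : linear Om ->
  (forall v w, v *m Om w = w *m Om v) ->
  (forall w K, K *m K = - 1%:M ->
     (K *m Om w - Om w *m K) *m K = K *m Om (w *m K) - Om (w *m K) *m K) ->
  exists h, pure_trace Om h.
Proof.
move=> lO sO cr; have [h e] := twist_pure_trace lO cr.
exists (2^-1 *: h) => v w; have := e v w; rewrite -(sO v w) => e'.
have hE (u : 'rV[R]_q.*2) : (u *m (2^-1 *: h)) 0 0 = 2^-1 * (u *m h) 0 0.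
  by rewrite -scalemxAr mxE.
rewrite !hE -!scalerA -scalerDr -e'; generalize (v *m Om w) => A.
by apply/rowP => x; rewrite !mxE; lra.
Qed.

End PureTrace.

(** * Transversal projectivity *)

(** Recovers the form of a projective change from the trace of the difference of two connection
    matrices: there a = f r, and the trace is (k + 1) f r. *)
Lemma trace_projective (R : realType) k (D : 'M[R]_k) (a : R) (f : 'rV[R]_k -> R) (r : 'rV[R]_k) :
  (forall (b : R) v w, f (b *: v + w) = b * f v + f w) ->
  (forall w : 'rV[R]_k, w *m D = a *: w + f w *: r) -> \tr D = k%:R * a + f r.
Proof.
move=> lf e; have d i : D i i = a + f (delta_mx 0 i) * r 0 i.
  by have := congr1 (fun v : 'rV[R]_k => v 0 i) (e (delta_mx 0 i)); rewrite -rowE !mxE !eqxx mulr1.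
rewrite /mxtrace (eq_bigr _ (fun i _ => d i)) big_split /= sumr_const card_ord mulr_natl.
congr (_ + _).
have f0 : f 0 = 0 by have := lf (-1) 0 0; rewrite scaleN1r oppr0 addr0 mulN1r addNr.
rewrite [r in RHS]row_sum_delta.
elim/big_rec2: _ => [|i x y _ ->]; first by rewrite f0.
by rewrite lf mulrC.
Qed.

(** Balls of the maximum norm are boxes. So the segment from z to the point with the leaf
    coordinates of the centre and the transverse coordinates of z stays in the ball, and G is
    constant along it. *)
Lemma box_factor (R : realType) (W : normedModType R) {bW : fin_basis W} p k
    (G : 'rV[R]_(p + k) -> W) (z0 : 'rV[R]_(p + k)) (d : R) :
  (forall z, ball z0 d z -> differentiable G z /\ forall a : 'rV[R]_p, 'D_(row_mx a 0) G z = 0) ->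
  forall z, ball z0 d z -> ball z0 d (row_mx (lsubmx z0) (rsubmx z)) /\
    G z = G (row_mx (lsubmx z0) (rsubmx z)).
Proof.
move=> H z zB; set y := row_mx (lsubmx z0) (rsubmx z); set a := lsubmx z - lsubmx z0.
have zy : z = y + row_mx a 0.
  by rewrite /y /a add_row_mx addr0 addrC subrK hsubmxK.
have yB s : 0 <= s <= 1 -> ball z0 d (y + s *: row_mx a 0).
  move=> /andP[s0 s1]; move: zB; rewrite -!ball_normE /= => zB.
  apply: le_lt_trans zB; apply: mx_norm_leP => [|i j]; first exact: normr_ge0.
  have -> : z0 - (y + s *: row_mx a 0) = row_mx (- (s *: a)) (rsubmx z0 - rsubmx z).
    rewrite -{1}[z0]hsubmxK /y scale_row_mx add_row_mx opp_row_mx add_row_mx scaler0 addr0.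
    by rewrite opprD addrA subrr add0r.
  have e : z0 - z = row_mx (- a) (rsubmx z0 - rsubmx z).
    by rewrite -{1}[z0]hsubmxK -{1}[z]hsubmxK opp_row_mx add_row_mx /a opprB.
  apply: le_trans (mx_norm_entry (z0 - z) i j); rewrite e !mxE; case: splitP => l _ //.
  rewrite !mxE !normrN normrM ger0_norm //.
  by rewrite ler_piMl.
split; first by have := yB 0; rewrite scale0r addr0; apply; rewrite lexx ler01.
rewrite {1}zy; apply: derive0_line_eq => s sI.
by have [dG D] := H _ (yB s sI); split; [exact: dG|exact: D].
Qed.

Lemma derive_affine (R : realType) (V W : normedModType R) (f : V -> W) (s t : V -> R) x v (w r : W) :
  differentiable f x -> differentiable s x -> differentiable t x ->
  'D_v (fun y => f y + (s y *: w + t y *: r)) x = 'D_v f x + ('D_v s x *: w + 'D_v t x *: r).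
Proof.
move=> df ds dt.
have [d1 e1] := diffZ_fun ds (differentiable_cst w x).
have [d2 e2] := diffZ_fun dt (differentiable_cst r x).
rewrite (derive_fD v df (differentiableD d1 d2)) (derive_fD v d1 d2) e1 e2.
by rewrite (derive_cst w) (derive_cst r) !scaler0 !addr0.
Qed.

Section Projective.
Context {R : realType} {p k : nat} (M : foliated_manifold R p k).
Local Notation TV := 'rV[R]_(p + k).
Local Notation NV := 'rV[R]_k.
Local Notation chartM := (chart R (pt M) (p + k)).
Implicit Types (c d e : chartM) (x y : M) (nabla : covderiv M).

Definition leaf_rate nabla c x (a : 'rV[R]_p) (w : NV) : 'M[R]_k :=
  'D_(row_mx a 0) (lcmx nabla c (row_mx 0 w)) (cmap c x).

Lemma leaf_rate_mul nabla (U : set M) c x a (v w : NV) : is_connection U nabla -> open U ->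
  U x -> charts (f := M) c -> dom c x ->
  v *m leaf_rate nabla c x a w =
  'D_(row_mx a 0) (fun z => v *m lcmx nabla c (row_mx 0 w) z) (cmap c x).
Proof.
move=> cn oU Ux hc cx; have s := smooth_lcmx (row_mx 0 w) cn oU Ux hc cx.
exact: (esym (derive_lin (row_mx a 0) (@mulmx_linear2 R 1 k k v) (smooth_at_diff s))).
Qed.

Lemma leaf_rate_linear nabla (U : set M) c x a : is_connection U nabla -> open U ->
  U x -> charts (f := M) c -> dom c x -> linear (leaf_rate nabla c x a).
Proof.
move=> cn oU Ux hc cx.
suff H (r : R) (v w : NV) : leaf_rate nabla c x a (r *: v + w) =
    r *: leaf_rate nabla c x a v + leaf_rate nabla c x a w by exact: H.
have sv := smooth_at_diff (smooth_lcmx (row_mx 0 v) cn oU Ux hc cx).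
have sw := smooth_at_diff (smooth_lcmx (row_mx 0 w) cn oU Ux hc cx).
have E : \forall z \near cmap c x,
    r *: lcmx nabla c (row_mx 0 v) z + lcmx nabla c (row_mx 0 w) z =
    lcmx nabla c (row_mx 0 (r *: v + w)) z.
  apply: filterS (near_chart cx (open_nbhs_nbhs (conj oU Ux))) => _ [y [-> cy Uy]].
  by rewrite (@row_mx0_linear R 1 p k) (lcmx_linear cn Uy hc cy).
have sv' : differentiable (fun z => r *: lcmx nabla c (row_mx 0 v) z) (cmap c x).
  exact: (smooth_at_diff (smooth_at_scale r (smooth_lcmx (row_mx 0 v) cn oU Ux hc cx))).
apply: etrans (esym (near_eq_derive (row_mx a 0) E)) _.
apply: etrans (derive_fD (row_mx a 0) sv' sw) _.
exact: (congr1 (fun A => A + leaf_rate nabla c x a w) (derive_fZ r (row_mx a 0) sv)).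
Qed.

Lemma leaf_rate_symmetrize nabla c x a (v w : NV) : adapted_connection [set: M] nabla ->
  charts (f := M) c -> dom c x ->
  v *m leaf_rate (symmetrize nabla) c x a w =
  2^-1 *: (v *m leaf_rate nabla c x a w + w *m leaf_rate nabla c x a v).
Proof.
move=> ad hc cx; have [cn _] := ad; have [[cn' _] _] := symmetrize_connection ad.
rewrite (leaf_rate_mul a v w cn' openT I hc cx).
have E : \forall z \near cmap c x,
    2^-1 *: (v *m lcmx nabla c (row_mx 0 w) z + w *m lcmx nabla c (row_mx 0 v) z) =
    v *m lcmx (symmetrize nabla) c (row_mx 0 w) z.
  apply: filterS (near_chart cx (near_dom cx)) => _ [y [-> cy _]].
  by rewrite (symmetrize_lcmx _ v ad openT I hc cy) row_mxKr.
have s (u u' : NV) : smooth_at (fun z => u *m lcmx nabla c (row_mx 0 u') z) (cmap c x).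
  exact: (smooth_at_lin (@mulmx_linear2 R 1 k k u) (smooth_lcmx _ cn openT I hc cx)).
rewrite -(near_eq_derive _ E) (derive_fZ _ _ (smooth_at_diff (smooth_atD (s v w) (s w v)))).
rewrite (derive_fD _ (smooth_at_diff (s v w)) (smooth_at_diff (s w v))).
by rewrite (leaf_rate_mul a v w cn openT I hc cx) (leaf_rate_mul a w v cn openT I hc cx).
Qed.

Lemma leaf_rate_sym nabla c x a (v w : NV) : adapted_connection [set: M] nabla ->
  torsionless [set: M] nabla -> charts (f := M) c -> dom c x ->
  v *m leaf_rate nabla c x a w = w *m leaf_rate nabla c x a v.
Proof.
move=> [cn _] tl hc cx.
rewrite (leaf_rate_mul a v w cn openT I hc cx) (leaf_rate_mul a w v cn openT I hc cx).
apply: near_eq_derive; apply: filterS (near_chart cx (near_dom cx)) => _ [y [-> cy _]].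
by have := torsionless_lcmx (row_mx 0 w) (row_mx 0 v) cn openT I hc cy tl; rewrite !row_mxKr.
Qed.

Lemma pure_trace_criterion nabla :
  (forall c x a, charts (f := M) c -> dom c x -> exists h, pure_trace (leaf_rate nabla c x a) h) ->
  leafwise_criterion nabla.
Proof.
move=> H c x a w K hc cx KK; have [h e] := H c x a hc cx.
exact: (pure_trace_twist w e KK).
Qed.

(** By [pure_trace_tr] the leaf derivative of the trace form is -h, so the correction cancels the
    leaf derivative of G, which is entirely pure trace. *)
Lemma thomas_foliated nabla c : adapted_connection [set: M] nabla ->
  torsionless [set: M] nabla ->
  (forall c x a, charts (f := M) c -> dom c x -> exists h, pure_trace (leaf_rate nabla c x a) h) ->
  charts (f := M) c -> foliated_connection (dom c) (thomas nabla c).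
Proof.
move=> ad tl H hc; have [cn _] := ad.
have [adt _] := thomas_connection ad tl hc; have [cnt _] := adt.
apply: (foliated_connectionI adt (dom_open c) hc) => // x cx u a.
have [h e] := H c x a hc cx.
set r := rsubmx u.
have st := smooth_lcmx u cnt (dom_open c) cx hc cx.
suff E (w : NV) : w *m 'D_(row_mx a 0) (lcmx (thomas nabla c) c u) (cmap c x) = 0.
  by apply/row_matrixP => i; rewrite rowE E row0.
pose t v z : R := - k.+1%:R^-1 * \tr (lcmx nabla c (row_mx 0 v) z).
have lt : linear (fun A : 'M[R]_k => - k.+1%:R^-1 * \tr A : R).
  move=> b A B; rewrite linearP /= mulrDr; congr (_ + _).
  by rewrite -[b *: _]/(b * _) -[RHS]/(b * _) mulrCA.
have sl v := smooth_lcmx (row_mx 0 v) cn openT I hc cx.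
have stv v : smooth_at (t v) (cmap c x) by exact: (smooth_at_lin lt (sl v)).
have dt v : 'D_(row_mx a 0) (t v) (cmap c x) = - (v *m h) 0 0.
  rewrite (derive_lin (row_mx a 0) lt (smooth_at_diff (sl v))).
  rewrite -/(leaf_rate nabla c x a v) (pure_trace_tr v e) mulrA mulNr mulVf ?mulN1r //.
have eq : \forall z \near cmap c x,
    w *m lcmx nabla c (row_mx 0 r) z + (t r z *: w + t w z *: r) =
    w *m lcmx (thomas nabla c) c u z.
  apply: filterS (near_chart cx (near_dom cx)) => _ [y [-> cy _]].
  rewrite (thomas_lcmx u w ad hc cy) /t.
  have -> // : lcmx nabla c (row_mx 0 r) (cmap c y) = lcmx nabla c u (cmap c y).
  by apply: (adapted_lcmx ad openT I hc cy); exact: row_mxKr.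
rewrite -(derive_lin (row_mx a 0) (@mulmx_linear2 R 1 k k w) (smooth_at_diff st)).
rewrite -(near_eq_derive _ eq).
have s1 : smooth_at (fun z => w *m lcmx nabla c (row_mx 0 r) z) (cmap c x).
  exact: (smooth_at_lin (@mulmx_linear2 R 1 k k w) (sl r)).
rewrite (derive_affine (row_mx a 0) w r (smooth_at_diff s1) (smooth_at_diff (stv r)) (smooth_at_diff (stv w))).
clear eq; clearbody t; rewrite (dt r) (dt w).
rewrite -(leaf_rate_mul a w r cn openT I hc cx) e.
by rewrite !scaleNr -opprD addrC [X in - X]addrC addNr.
Qed.

(** On constant fields of the chart no derivative of components appears, so the relation between the
    connections becomes one between their matrices. *)
Lemma lcmx_projective_diff n1 n2 (U : set M) (phi : M -> TV -> R) c x (u : TV) (w : NV) :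
  is_connection U n1 -> is_connection U n2 -> open U ->
  (forall V X Y, open V -> V `<=` U -> vfield V X -> vfield V Y -> forall x, V x ->
     n2 x (X x) (piN Y) - n1 x (X x) (piN Y) = phi x (X x) *: piN Y x + phi x (Y x) *: piN X x) ->
  U x -> charts (f := M) c -> dom c x ->
  w *m lcmx n2 c u (cmap c x) - w *m lcmx n1 c u (cmap c x) =
  phi x (tvec c x u) *: w + phi x (tvec c x (row_mx 0 w)) *: rsubmx u.
Proof.
move=> cn1 cn2 oU rel Ux hc cx.
pose V := U `&` dom c.
have oV : open V by apply: openI => //; exact: dom_open.
have VU : V `<=` U by move=> y [].
have Vc : V `<=` dom c by move=> y [].
have Vx : V x by [].
pose X := cfield c u; pose Y := cfield c (row_mx 0 w).
have vX : vfield V X by apply: vfieldS Vc _; exact: vfield_cfield.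
have vY : vfield V Y by apply: vfieldS Vc _; exact: vfield_cfield.
have nY : \forall z \near cmap c x, nloc c (piN Y) z = w.
  apply: filterS (near_chart cx (near_dom cx)) => _ [y [-> cy _]].
  by rewrite (nlocE _ cy) (piN_cfield _ hc cy) row_mxKr csecE mulmxKV ?nmx_unit.
have Xx : X x = tvec c x u by exact: cfieldE.
have Yx : Y x = tvec c x (row_mx 0 w) by exact: cfieldE.
have pX : piN X x *m nmx c x = rsubmx u.
  by rewrite (piN_cfield _ hc cx) csecE mulmxKV ?nmx_unit.
have pY : piN Y x *m nmx c x = w by rewrite -(nlocE _ cx) (nbhs_singleton nY).
have F n : is_connection U n -> n x (X x) (piN Y) *m nmx c x = w *m lcmx n c u (cmap c x).
  move=> cn; rewrite (connectionE (X x) cn oV VU Vx (nsection_piN oV vY) hc cx).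
  by rewrite (near_eq_derive _ nY) derive_cst add0r pY Xx -(lcmxE n u cx).
have := congr1 (mulmx^~ (nmx c x)) (rel V X Y oV VU vX vY x Vx).
clearbody X Y; clear nY vX vY; clear -F pX pY Xx Yx cn1 cn2.
by rewrite mulmxBl (F _ cn1) (F _ cn2) mulmxDl -!scalemxAl pX pY Xx Yx.
Qed.

Lemma foliated_connectionS nabla (U V : set M) : V `<=` U -> foliated_connection U nabla ->
  foliated_connection V nabla.
Proof.
move=> VU [ad fc]; split; first exact: adapted_setS ad.
by move=> W X s oW /subset_trans/(_ VU); exact: fc.
Qed.

(** On a box around x the components of the form depend on the transverse coordinates alone, by
    [box_factor]. The covector field g on the slice evaluates them at the leaf coordinates of x. *)
Lemma foliated_form_leaf (U : set M) (phi : M -> TV -> R) c :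
  open U -> charts (f := M) c -> U `<=` dom c ->
  (forall x, U x -> forall (b : R) u v, phi x (b *: u + v) = b * phi x u + phi x v) ->
  (forall x u v, U x -> rsubmx u = rsubmx v -> phi x u = phi x v) ->
  (forall x (w : NV), U x ->
     smooth_at (fun z => phi (cinv c z) (tvec c (cinv c z) (row_mx 0 w))) (cmap c x) /\
     forall a : 'rV[R]_p,
       'D_(row_mx a 0) (fun z => phi (cinv c z) (tvec c (cinv c z) (row_mx 0 w))) (cmap c x) = 0) ->
  foliated_form U phi.
Proof.
move=> oU hc Uc lphi rphi H x Ux; have cx := Uc x Ux.
pose G (z : TV) : 'cV[R]_k := \col_l phi (cinv c z) (tvec c (cinv c z) (row_mx 0 (delta_mx 0 l))).
have GE z l j : G z l j = phi (cinv c z) (tvec c (cinv c z) (row_mx 0 (delta_mx 0 l))) by rewrite mxE.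
have GS y : U y -> smooth_at G (cmap c y) /\ forall a : 'rV[R]_p, 'D_(row_mx a 0) G (cmap c y) = 0.
  move=> Uy; have sG : smooth_at G (cmap c y).
    apply: smooth_at_mx => l j; have [s _] := H y (delta_mx 0 l) Uy.
    by apply: smooth_at_ext s => z; rewrite GE.
  split; first exact: sG.
  move=> a; apply/matrixP => l j; rewrite mxE -(derive_entry (row_mx a 0) l j (smooth_at_diff sG)).
  have [_ D] := H y (delta_mx 0 l) Uy.
  have -> : (fun z => G z l j) = (fun z => phi (cinv c z) (tvec c (cinv c z) (row_mx 0 (delta_mx 0 l)))).
    by apply/funext => z; rewrite GE.
  exact: D.
have n0 := near_chart cx (open_nbhs_nbhs (conj oU Ux)).
have [d d0 B] := (nbhs_ballP _ _).1 n0; rewrite /= in d0.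
set z0 := cmap c x in B.
have HB z : ball z0 d z -> smooth_at G z /\ forall a : 'rV[R]_p, 'D_(row_mx a 0) G z = 0.
  by move=> /B[y [-> _ Uy]]; exact: GS.
pose l0 := lsubmx z0.
have bR z : ball z0 d z -> ball (rsubmx z0) d (rsubmx z).
  rewrite -!ball_normE /= => h; apply: le_lt_trans h.
  apply: mx_norm_leP => [|i j]; first exact: normr_ge0.
  by apply: le_trans (mx_norm_entry (z0 - z) i (rshift p j)); rewrite !mxE.
have bL (w : NV) : ball (rsubmx z0) d w -> ball z0 d (row_mx l0 w).
  rewrite -!ball_normE /= => h; apply: le_lt_trans h.
  apply: mx_norm_leP => [|i j]; first exact: normr_ge0.
  rewrite -{1}[z0]hsubmxK opp_row_mx add_row_mx subrr mxE; case: splitP => l _.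
    by rewrite mxE normr0 normr_ge0.
  exact: mx_norm_entry.
pose V := [set y | U y /\ ball z0 d (cmap c y)].
have oV : open V.
  rewrite openE => y [Uy By].
  have n1 : \forall z \near cmap c y, ball z0 d z.
    by apply: open_nbhs_nbhs; split; [exact: ball_open|exact: By].
  by apply: filterS2 (open_nbhs_nbhs (conj oU Uy)) (near_cmap (Uc y Uy) n1) => u.
have affine : forall w : NV, smooth_at (fun w : NV => row_mx l0 w : TV) w.
  move=> w; apply: (@smooth_at_ext _ _ _ (fun w : NV => (row_mx l0 0 : TV) + row_mx 0 w)).
    by move=> u; rewrite add_row_mx addr0 add0r.
  apply: smooth_atD; first exact: smooth_at_cst.
  exact: (smooth_at_lin (@row_mx0_linear R 1 p k) (smooth_at_id w)).
exists V, c, (ball (rsubmx z0) d), (fun w => G (row_mx l0 w)); split.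
  split; [exact: oV| |].
    by split; [exact: Ux|exact: ballxx].
  by move=> y [Uy _]; split; [exact: Uy|exact: Uc].
split; [exact: hc|exact: ball_open| |].
  apply/smooth_onP; first exact: ball_open.
  move=> w /bL /HB[sG _]; exact: (smooth_at_comp (g := G) (affine w) sG).
move=> y [Uy By]; split; first exact: bR.
move=> v; have cy := Uc y Uy; set r := rsubmx (tcoord c y v).
have [|_ <-] := @box_factor R _ _ p k G z0 d _ (cmap c y) By.
  by move=> z /HB[s D]; split; [exact: (smooth_at_diff s)|exact: D].
have e : phi y v = phi y (tvec c y (row_mx 0 r)).
  apply: (rphi y _ _ Uy); rewrite (rsubmx_tvec _ hc cy) row_mxKr /r (rsubmx_tcoord _ hc cy).
  by rewrite (mulmxK (nmx_unit hc cy)).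
rewrite e mxE.
have lt w1 w2 (b : R) : phi y (tvec c y (row_mx 0 (b *: w1 + w2))) =
    b * phi y (tvec c y (row_mx 0 w1)) + phi y (tvec c y (row_mx 0 w2)).
  by rewrite (@row_mx0_linear R 1 p k) (tvec_linear hc cy) (lphi y Uy).
have t0 : phi y (tvec c y (row_mx 0 0)) = 0.
  by have := lt 0 0 (-1); rewrite scaleN1r oppr0 addr0 mulN1r addNr.
rewrite [r in LHS]row_sum_delta; elim/big_rec2: _ => [|i a b _ <-]; first exact: t0.
by rewrite (lt (delta_mx 0 i) b (r 0 i)) GE (cinvK cy).
Qed.

(** The connections [thomas nabla (chart_at i)] are projective changes of the same [nabla], so any
    two of them differ by the difference of their trace forms. *)
Lemma projectable_projective_of nabla : adapted_connection [set: M] nabla ->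
  torsionless [set: M] nabla ->
  (forall c x a, charts (f := M) c -> dom c x -> exists h, pure_trace (leaf_rate nabla c x a) h) ->
  transversally_projective M.
Proof.
move=> ad tl H; have [cn _] := ad.
pose th (i : M) : covderiv M := thomas nabla (chart_at i).
pose phi (i j x : M) (v : TV) : R := trace_form nabla (chart_at j) x v - trace_form nabla (chart_at i) x v.
have hc i := chart_at_charts (i : M).
have fc i : foliated_connection (dom (chart_at i)) (th i) by exact: thomas_foliated.
have cnt i : is_connection (dom (chart_at i)) (th i) by case: (fc i) => -[].
have rel (i j : M) (U := dom (chart_at i) `&` dom (chart_at j)) :
    forall V X Y, open V -> V `<=` U -> vfield V X -> vfield V Y -> forall x, V x ->
      th j x (X x) (piN Y) - th i x (X x) (piN Y) =
      phi i j x (X x) *: piN Y x + phi i j x (Y x) *: piN X x.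
  move=> V X Y oV VU vX vY x Vx; have [ci cj] := VU x Vx.
  have r : rsubmx (row_mx 0 (piN Y x) : TV) = rsubmx (Y x) by exact: row_mxKr.
  rewrite /th /thomas /shift_conn /trace_shift /phi.
  rewrite (trace_form_adapted ad (hc i) ci r) (trace_form_adapted ad (hc j) cj r).
  generalize (trace_form nabla (chart_at i) x (X x)) (trace_form nabla (chart_at j) x (X x))
    (trace_form nabla (chart_at i) x (Y x)) (trace_form nabla (chart_at j) x (Y x))
    (nabla x (X x) (piN Y)) => b1 b2 b3 b4 n.
  rewrite -/(piN X x); generalize (piN Y x) (piN X x) => s t.
  by rewrite opprD addrACA subrr add0r opprD addrACA -!scalerBl.
exists M, (fun i => chart_at i), th, phi; split.
- exact: hc.
- by move=> x; exists x; exact: chart_at_dom.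
- by move=> i; split; [exact: fc|case: (thomas_connection ad tl (hc i))].
- move=> i j U; split; last exact: rel.
  set c := chart_at i; have oU : open U by apply: openI; exact: dom_open.
  have UI : U `<=` dom (chart_at i) by move=> x [].
  have UJ : U `<=` dom (chart_at j) by move=> x [].
  have fI : foliated_connection U (th i) := foliated_connectionS UI (fc i).
  have fJ : foliated_connection U (th j) := foliated_connectionS UJ (fc j).
  have [[cI _] _] := fI; have [[cJ _] _] := fJ.
  have lphi x (b : R) u v : phi i j x (b *: u + v) = b * phi i j x u + phi i j x v.
    rewrite /phi (trace_form_linear (chart_at j) x cn) (trace_form_linear (chart_at i) x cn).
    generalize (trace_form nabla (chart_at j) x u) (trace_form nabla (chart_at j) x v)
      (trace_form nabla (chart_at i) x u) (trace_form nabla (chart_at i) x v) => b1 b2 b3 b4.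
    by rewrite -[b *: b1]/(b * b1) -[b *: b3]/(b * b3); ring.
  apply: (foliated_form_leaf oU (hc i) UI).
  + by move=> x Ux b u v; exact: lphi.
  + move=> x u v [ci cj] r; rewrite /phi (trace_form_adapted ad (hc i) ci r).
    by rewrite (trace_form_adapted ad (hc j) cj r).
  + move=> x w Ux.
    (* Neither trace form need be foliated. Their difference is, because it is recovered from the
       matrices of the two corrected connections, which are leafwise constant. *)
    have E : \forall z \near cmap c x, k.+1%:R^-1 * \tr (lcmx (th j) c (row_mx 0 w) z - lcmx (th i) c (row_mx 0 w) z) =
        phi i j (cinv c z) (tvec c (cinv c z) (row_mx 0 w)).
      apply: filterS (near_chart (UI x Ux) (open_nbhs_nbhs (conj oU Ux))) => _ [y [-> cy Uy]].
      rewrite (cinvK cy).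
      pose f (v : NV) := phi i j y (tvec c y (row_mx 0 v)).
      have lf (b : R) v1 v2 : f (b *: v1 + v2) = b * f v1 + f v2.
        by rewrite /f (@row_mx0_linear R 1 p k) (tvec_linear (hc i) cy) lphi.
      rewrite (@trace_projective R k _ (f w) f w lf).
        by rewrite -[X in _ + X]mul1r -mulrDl natr1 mulrA mulVf ?mul1r // pnatr_eq0.
      move=> v; rewrite mulmxBr.
      by have := lcmx_projective_diff (row_mx 0 w) v cI cJ oU (rel i j) Uy (hc i) cy; rewrite row_mxKr.
    have lt : linear (fun A : 'M[R]_k => k.+1%:R^-1 * \tr A : R).
      move=> b A B; rewrite linearP /= mulrDr; congr (_ + _).
      by rewrite -[b *: _]/(b * _) -[RHS]/(b * _) mulrCA.
    have sI := smooth_lcmx (row_mx 0 w) cI oU Ux (hc i) (UI x Ux).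
    have sJ := smooth_lcmx (row_mx 0 w) cJ oU Ux (hc i) (UI x Ux).
    have sB := smooth_atB sJ sI.
    split; first exact: (smooth_at_eq E (smooth_at_lin lt sB)).
    move=> a; rewrite -(near_eq_derive _ E) (derive_lin (row_mx a 0) lt (smooth_at_diff sB)).
    rewrite (derive_fB (row_mx a 0) (smooth_at_diff sJ) (smooth_at_diff sI)).
    have DI := foliated_connection_leaf (row_mx 0 w) a fI oU Ux (hc i) (UI x Ux).
    have DJ := foliated_connection_leaf (row_mx 0 w) a fJ oU Ux (hc i) (UI x Ux).
    apply: etrans (congr2 (fun A B : 'M[R]_k => k.+1%:R^-1 * \tr (A - B)) DJ DI) _.
    by rewrite subrr linear0 mulr0.
Qed.

End Projective.

(** * Partitions of unity and gluing *)

(** Every basic open set contained in some W x selects one such x, and the sequence runs through the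
    codes of the basis; x0 is the value at numbers that code no such set. *)
Lemma countable_subcover (T : topologicalType) (W : T -> set T) (x0 : T) :
  @second_countable T -> (forall x, \forall y \near x, W x y) ->
  exists s : nat -> T, forall y, exists n, W (s n) y.
Proof.
move=> [B /countable_injP[e inj_e] [_ bB]] nW.
have ex n : exists x, (exists U, [/\ B U, e U = n & U `<=` W x]) \/
    ~ exists x U, [/\ B U, e U = n & U `<=` W x].
  have [[x h]|h] := pselect (exists x U, [/\ B U, e U = n & U `<=` W x]).
    by exists x; left.
  by exists x0; right.
have [s sP] := choice ex; exists s => y.
have [U [BU Uy] UW] := bB y _ (nW y).
exists (e U); case: (sP (e U)) => [[U' [BU' eU' U'W]]|[]]; last by exists y, U.
by apply: U'W; rewrite (inj_e U' U) ?inE.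
Qed.

Lemma sum_cut (V : nmodType) (f : nat -> V) (N N' : nat) :
  (forall n, (N <= n)%N -> f n = 0) -> (forall n, (N' <= n)%N -> f n = 0) ->
  \sum_(n < N) f n = \sum_(n < N') f n.
Proof.
wlog le : N N' / (N <= N')%N => [H|] f1 f2.
  by case: (leqP N N') => [/H|/ltnW/H] E; [exact: E|apply/esym; exact: E].
rewrite -(big_mkord xpredT f) -[RHS](big_mkord xpredT f) [RHS](big_cat_nat (n := N)) //=.
rewrite [X in _ + X]big_nat_cond [X in _ + X]big1 ?addr0 //.
by move=> n /andP[/andP[Nn _] _]; exact: f1.
Qed.

Section Partition.
Context {R : realType} {p k : nat} (M : foliated_manifold R p k).
Local Notation TV := 'rV[R]_(p + k).
Local Notation NV := 'rV[R]_k.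
Local Notation chartM := (chart R (pt M) (p + k)).
Implicit Types (c d e : chartM) (x y : M) (nabla : covderiv M) (f : M -> R).

Definition smooth_map f : Prop := forall c x, charts (f := M) c -> dom c x ->
  smooth_at (f \o cinv c) (cmap c x).

Lemma smooth_mapI f : (forall x, exists c, [/\ charts (f := M) c, dom c x &
  smooth_at (f \o cinv c) (cmap c x)]) -> smooth_map f.
Proof.
move=> h c x hc cx; have [d [hd dx sd]] := h x; exact: (smooth_floc hd hc dx cx sd).
Qed.

Lemma smooth_map_continuous f x : smooth_map f -> {for x, continuous f}.
Proof.
move=> sf U nU; have hc := chart_at_charts x; have cx := chart_at_dom x.
set c := chart_at x in hc cx.
have cf := smooth_at_cont (sf c x hc cx).
have nU' : nbhs ((f \o cinv c) (cmap c x)) U by rewrite /= (cinvK cx).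
have n1 : \forall z \near cmap c x, U (f (cinv c z)) by exact: (cf _ nU').
apply: filterS2 (near_cmap cx n1) (near_dom cx) => y Uy cy.
by rewrite (cinvK cy) in Uy.
Qed.

Lemma smooth_map_gt f x (a : R) : smooth_map f -> a < f x -> \forall y \near x, a < f y.
Proof.
move=> sf afx; have nU : nbhs (f x) [set t | a < t] by exact: lt_nbhsr.
exact: (@smooth_map_continuous f x sf _ nU).
Qed.

(** A bump of the chart extended by 0. The image K' of its compact support is closed because M is
    Hausdorff, so the extension vanishes near every point outside K', including the boundary points
    of the chart domain. *)
Lemma bump_manifold x (D : set M) : open D -> D x ->
  exists f, [/\ smooth_map f, forall y, 0 <= f y, 0 < f x &
    forall y, D y \/ \forall z \near y, f z = 0].
Proof.
move=> oD Dx; have hc := chart_at_charts x; have cx := chart_at_dom x.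
set c := chart_at x in hc cx.
have oU : open (cmap c @` (dom c `&` D)) by exact: open_chart_image.
have Ux : (cmap c @` (dom c `&` D)) (cmap c x) by exists x.
have [b [K [[sb b0 bx] [cK KU bK]]]] := bump_rV oU Ux.
pose f y := if `[< dom c y >] then b (cmap c y) else 0 : R.
have fE y : dom c y -> f y = b (cmap c y) by move=> cy; rewrite /f asboolT.
pose K' := cinv c @` K.
have cK' : closed K'.
  apply: compact_closed; first exact: fol_hausdorff.
  apply: continuous_compact cK; apply: continuous_in_subspaceT => z /set_mem /KU [y [cy _] <-].
  by apply: cinv_cont; exists y.
have nK' y : ~ K' y -> f y = 0.
  move=> nK; rewrite /f; case: asboolP => // cy; apply: bK => Ky; apply: nK.
  by exists (cmap c y); [|exact: cinvK].
have near0 y : ~ K' y -> \forall z \near y, f z = 0.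
  move=> nK; have : \forall z \near y, (~` K') z.
    by apply: open_nbhs_nbhs; split; [exact: closed_openC|].
  by apply: filterS => z; exact: nK'.
have K'D y : K' y -> dom c y /\ D y.
  by move=> [z Kz <-]; have [u [cu Du] <-] := KU z Kz; rewrite (cinvK cu).
exists f; split.
- apply: smooth_mapI => y; have [/K'D[cy _]|nK] := pselect (K' y).
    exists c; split; [exact: hc|exact: cy|]; apply: smooth_at_eq (sb (cmap c y)).
    apply: filterS (near_chart cy (near_dom cy)) => _ [u [-> cu _]].
    by rewrite /= (cinvK cu) fE.
  exists (chart_at y); split; [exact: chart_at_charts|exact: chart_at_dom|].
  apply: smooth_at_eq (smooth_at_cst (0 : R) _).
  apply: filterS (near_chart (chart_at_dom y) (near0 y nK)) => _ [u [-> cu e]].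
  by rewrite /= (cinvK cu).
- by move=> y; rewrite /f; case: asboolP.
- by rewrite fE.
- by move=> y; have [/K'D[_ Dy]|nK] := pselect (K' y); [left|right; exact: near0].
Qed.

(** The second clause puts the support of [theta n] into [D (s n)] without mentioning closures. The
    last one replaces the infinite sum by any initial part that contains all nonzero terms at the
    point. *)
Definition partition_of_unity (s : nat -> M) (D : M -> set M) (theta : nat -> M -> R) : Prop :=
  [/\ forall n, smooth_map (theta n),
      forall n x, D (s n) x \/ \forall y \near x, theta n y = 0,
      forall x, exists N, \forall y \near x, forall n, (N <= n)%N -> theta n y = 0
    & forall x N, (forall n, (N <= n)%N -> theta n x = 0) -> \sum_(n < N) theta n x = 1].

(* The weights are r_n times the product over i < n of g (1 - n r_i), with g
   vanishing on negative numbers: near a point where r_m > 0 the weights with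
   n > m large are zero, whether or not the supports are locally finite. *)
Lemma partition_exists (D : M -> set M) : (exists x : M, True) ->
  (forall x, open (D x) /\ D x x) -> exists s theta, partition_of_unity s D theta.
Proof.
move=> [x0 _] hD.
have ex x : exists f, [/\ smooth_map f, forall y, 0 <= f y, 0 < f x &
    forall y, D x y \/ \forall z \near y, f z = 0].
  by have [oD Dx] := hD x; exact: bump_manifold.
have [rho rhoP] := choice ex.
have nW x : \forall y \near x, 0 < rho x y.
  have [sr _ rx _] := rhoP x.
  exact: (smooth_map_gt sr rx).
have [s sP] := countable_subcover x0 (@fol_second_countable R p k M) nW.
pose r n := rho (s n); pose g := @flat_fun R 0.
have sr n : smooth_map (r n) by case: (rhoP (s n)).
have r0 n y : 0 <= r n y by have [_ h _ _] := rhoP (s n); exact: h.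
have rD n y : D (s n) y \/ \forall z \near y, r n z = 0.
  by have [_ _ _ h] := rhoP (s n); exact: h.
pose psi n y := r n y * \prod_(i < n) g (1 - n%:R * r i y).
have psi0 n y : 0 <= psi n y.
  by rewrite mulr_ge0 ?r0 //; apply: prodr_ge0 => i _; exact: flat_fun_ge0.
have spsi n : smooth_map (psi n).
  move=> c x hc cx; apply: smooth_atM; first exact: sr.
  apply: smooth_at_prod => i _; apply: (smooth_at_comp (g := g)); last exact: smooth_flat_fun.
  apply: smooth_atB; first exact: smooth_at_cst.
  by apply: smooth_atM; [exact: smooth_at_cst|exact: sr].
have psi_lf x : exists N, \forall y \near x, forall n, (N <= n)%N -> psi n y = 0.
  have [m rm] := sP x; pose e := r m x / 2.
  have e0 : 0 < e by rewrite divr_gt0.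
  have er : e < r m x by rewrite /e; move: rm; rewrite -/(r m x) => rm; lra.
  have n1 : \forall y \near x, e < r m y by exact: (smooth_map_gt (sr m) er).
  (* For n > m the product in [psi n] contains the factor of index m, and this vanishes once n * r m
     y >= 1, hence as soon as n >= 1/e. *)
  exists (maxn m.+1 (Num.truncn e^-1).+1); apply: filterS n1 => y ey n; rewrite geq_max => /andP[mn tn].
  rewrite /psi (bigD1 (Ordinal mn)) //= /g flat_fun0_le0 ?mul0r ?mulr0 //.
  have h1 : e^-1 <= n%:R.
    by apply: le_trans (ltW (real_truncnS_gt (num_real _))) _; rewrite ler_nat.
  rewrite subr_le0; apply: (@le_trans _ _ (e^-1 * e)); first by rewrite mulVf ?gt_eqF.
  by apply: ler_pM h1 (ltW ey); rewrite ?invr_ge0 (ltW e0).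
have psi_gt x : exists n, 0 < psi n x.
  have [m rm] : exists m, 0 < r m x := sP x.
  (* At the least n with r n x > 0 all factors of the product are g 1 > 0. *)
  have [n rn nmin] := ex_minnP (ex_intro (fun m => 0 < r m x) m rm).
  exists n; rewrite mulr_gt0 //; apply: prodr_gt0 => i _.
  have ri : r i x = 0.
    apply/eqP; rewrite eq_le r0 andbT leNgt; apply/negP => /nmin.
    by rewrite leqNgt ltn_ord.
  by rewrite /g flat_fun0_gt0 ri mulr0 subr0.
have [N NP] := choice psi_lf.
pose tot y := \sum_(n < N y) psi n y.
have totE x K : (forall n, (K <= n)%N -> psi n x = 0) -> tot x = \sum_(n < K) psi n x.
  by apply: sum_cut; exact: (nbhs_singleton (NP x)).
have tot_gt x : 0 < tot x.
  have [n pn] := psi_gt x.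
  have nN : (n < N x)%N.
    by rewrite ltnNge; apply/negP => /(nbhs_singleton (NP x)) e; rewrite e ltxx in pn.
  rewrite /tot (bigD1 (Ordinal nN)) //=; apply: ltr_pwDl => //.
  by apply: sumr_ge0 => i _.
have stot : smooth_map tot.
  move=> c x hc cx; apply: (@smooth_at_eq _ _ _ (fun z => \sum_(n < N x) (psi n \o cinv c) z)).
    apply: filterS (near_chart cx (NP x)) => _ [y [-> cy h]].
    by rewrite /= (cinvK cy) (totE _ _ h).
  by apply: smooth_at_sum => n _; exact: spsi.
exists s, (fun n y => psi n y * (tot y)^-1); split.
- move=> n c x hc cx; apply: smooth_atM; first exact: spsi.
  by apply: smooth_atV; [exact: stot|rewrite /= (cinvK cx) gt_eqF].
- move=> n x; have [Dx|e] := rD n x; first by left.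
  by right; apply: filterS e => y ry; rewrite /psi ry !mul0r.
- move=> x; exists (N x); apply: filterS (NP x) => y h n Nn.
  by rewrite h // mul0r.
- move=> x K h; rewrite -mulr_suml -(totE x K) ?mulfV ?gt_eqF // => n /h /eqP.
  by rewrite mulf_eq0 invr_eq0 (gt_eqF (tot_gt x)) orbF => /eqP.
Qed.

End Partition.

(** The alternative d i = 0 covers the weights that vanish near the point, where nothing is known
    about F i. *)
Lemma pure_trace_sum (R : realType) k (I : Type) (r : seq I) (d : I -> R)
    (F : I -> 'rV[R]_k -> 'M[R]_k) :
  (forall i, d i = 0 \/ exists h, pure_trace (F i) h) ->
  exists h, pure_trace (fun w => \sum_(i <- r) d i *: F i w) h.
Proof.
move=> H; elim: r => [|i r [h e]].
  by exists 0 => v w; rewrite big_nil !mulmx0 mxE !scale0r addr0.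
have [h' e'] : exists h', pure_trace (fun w => d i *: F i w) h'.
  have [->|[h' e']] := H i.
    by exists 0 => v w; rewrite scale0r !mulmx0 mxE !scale0r addr0.
  have ent (u : 'rV[R]_k) : (u *m (d i *: h')) 0 0 = d i * (u *m h') 0 0.
    by rewrite -scalemxAr mxE.
  by exists (d i *: h') => v w; rewrite !ent -scalemxAr e' scalerDr !scalerA.
exists (h' + h) => v w; rewrite big_cons mulmxDr e' e !mulmxDr.
have ent (a b : 'M[R]_1) : (a + b) 0 0 = a 0 0 + b 0 0 by rewrite mxE.
by rewrite !ent !scalerDl addrACA.
Qed.

(** * Gluing connections with a partition of unity *)

Section Glue.
Context {R : realType} {p k : nat} (M : foliated_manifold R p k).
Local Notation TV := 'rV[R]_(p + k).
Local Notation NV := 'rV[R]_k.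
Local Notation chartM := (chart R (pt M) (p + k)).
Implicit Types (c d e : chartM) (x y : M).
Context (D : nat -> set M) (n : nat -> covderiv M) (th : nat -> M -> R) (N : M -> nat).
Context (oD : forall i, open (D i)) (sth : forall i, smooth_map (th i))
  (supp : forall i x, D i x \/ \forall y \near x, th i y = 0)
  (lf : forall x, \forall y \near x, forall i, (N x <= i)%N -> th i y = 0)
  (sum1 : forall x K, (forall i, (K <= i)%N -> th i x = 0) -> \sum_(i < K) th i x = 1).

(** The cutoff [N x] varies with x without control. Near a point [glueE] replaces it by a fixed one,
    so that the sum can be differentiated term by term. *)
Definition glue : covderiv M := fun x v s => \sum_(i < N x) th i x *: n i x v s.

Lemma glueE x v s K : (forall i, (K <= i)%N -> th i x = 0) ->
  glue x v s = \sum_(i < K) th i x *: n i x v s.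
Proof.
move=> h; apply: (sum_cut (f := fun i => th i x *: n i x v s)) => i Ki.
  by rewrite (nbhs_singleton (lf x)) // scale0r.
by rewrite h // scale0r.
Qed.

Lemma supp_term (V : lmodType R) i x (a b : V) : (D i x -> a = b) -> th i x *: a = th i x *: b.
Proof.
by move=> h; have [/h ->//|/nbhs_singleton ->] := supp i x; rewrite !scale0r.
Qed.

Lemma sum_const (V : lmodType R) x (a : V) : \sum_(i < N x) th i x *: a = a.
Proof. by rewrite -scaler_suml sum1 ?scale1r //; exact: (nbhs_singleton (lf x)). Qed.

(** A term common to all local connections survives the gluing because the weights add up to 1; for
    the torsion this term is the bracket. *)
Lemma glue_shift x v v' s s' b : (forall i, D i x -> n i x v s = n i x v' s' + b) ->
  glue x v s = glue x v' s' + b.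
Proof.
move=> h; rewrite -[b in RHS](sum_const x) -big_split; apply: eq_bigr => i _ /=.
by rewrite -scalerDr; apply: supp_term; exact: h.
Qed.

(** Connections are stable under affine combinations only: it is the sum 1 of the weights that
    restores the df term of the Leibniz rule. Where [n i] is not a connection its weight vanishes
    nearby. *)
Lemma glue_connection : (forall i, is_connection (D i) (n i)) -> is_connection [set: M] glue.
Proof.
move=> cn.
have oVi (V : set M) i : open V -> open (V `&` D i) by move=> oV; exact: openI.
split.
- move=> x s a v w _; rewrite /glue scaler_sumr -big_split; apply: eq_bigr => i _ /=.
  rewrite scalerA mulrC -scalerA -scalerDr; apply: supp_term => Dx.
  by have [lin _ _ _] := cn i; exact: lin.
- move=> V x v s t oV _ Vx ss st; rewrite /glue -big_split; apply: eq_bigr => i _ /=.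
  rewrite -scalerDr; apply: supp_term => Dx; have [_ add _ _] := cn i.
  exact: (add _ x v s t (oVi V i oV) (@subIsetr _ _ _) (conj Vx Dx)
    (nsectionS (@subIsetl _ _ _) ss) (nsectionS (@subIsetl _ _ _) st)).
- move=> V x v f s oV _ Vx sf ss.
  rewrite -[dfun f x v *: s x](sum_const x) /glue scaler_sumr -big_split; apply: eq_bigr => i _ /=.
  rewrite [f x *: (_ *: _)]scalerA [f x * _]mulrC -[(_ * f x) *: _]scalerA -scalerDr.
  apply: supp_term => Dx; have [_ _ lei _] := cn i.
  exact: (lei _ x v f s (oVi V i oV) (@subIsetr _ _ _) (conj Vx Dx)
    (smooth_funS (@subIsetl _ _ _) sf) (nsectionS (@subIsetl _ _ _) ss)).
- move=> V X s oV _ vX ss; apply/nsectionP => // x Vx; exists (chart_at x).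
  have hc := chart_at_charts x; have cx := chart_at_dom x; split; [exact: hc|exact: cx|].
  set c := chart_at x in hc cx *.
  apply: (@smooth_at_eq _ _ _ (fun z => \sum_(i < N x) (th i \o cinv c) z *: nloc c (fun y => n i y (X y) s) z)).
    apply: filterS (near_chart cx (lf x)) => _ [y [-> cy h]].
    rewrite (nlocE _ cy) (glueE _ _ h) mulmx_suml; apply: eq_bigr => i _.
    by rewrite (nlocE _ cy) /= (cinvK cy) scalemxAl.
  apply: smooth_at_sum => i _; have [Dx|z0] := supp i x.
    apply: smooth_atZ; first exact: (sth i hc cx).
    have [_ _ _ sm] := cn i.
    have h : nsection (V `&` D i) (fun y => n i y (X y) s).
      exact: (sm _ X s (oVi V i oV) (@subIsetr _ _ _)
        (vfieldS (@subIsetl _ _ _) vX) (nsectionS (@subIsetl _ _ _) ss)).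
    exact: (nsection_smooth (oVi V i oV) h (conj Vx Dx) hc cx).
  apply: smooth_at_eq (smooth_at_cst (0 : NV) _).
  apply: filterS (near_chart cx z0) => _ [y [-> cy h]].
  by rewrite /= (cinvK cy) h scale0r.
Qed.

Lemma glue_adapted : (forall i, adapted_connection (D i) (n i)) ->
  adapted_connection [set: M] glue.
Proof.
move=> ad; split; first by apply: glue_connection => i; case: (ad i).
move=> V X Y oV _ vX lY x Vx; rewrite -[RHS](sum_const x); apply: eq_bigr => i _.
apply: supp_term => Dx; have [_ a] := ad i.
exact: (a _ X Y (openI oV (oD i)) (@subIsetr _ _ _)
  (vfieldS (@subIsetl _ _ _) vX) (leaf_fieldS (@subIsetl _ _ _) lY) x (conj Vx Dx)).
Qed.

Lemma glue_torsionless : (forall i, torsionless (D i) (n i)) -> torsionless [set: M] glue.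
Proof.
move=> tl V X Y oV _ vX vY x Vx; rewrite /torsion.
rewrite (@glue_shift x (X x) (Y x) (piN Y) (piN X) (piN (bracket X Y) x)).
  by rewrite [_ + piN _ _]addrC addrK subrr.
move=> i Dx; have := tl i (V `&` D i) X Y.
rewrite /torsion => /(_ (openI oV (oD i)) (@subIsetr _ _ _)) h.
have := h (vfieldS (@subIsetl _ _ _) vX) (vfieldS (@subIsetl _ _ _) vY) x (conj Vx Dx).
by move/eqP; rewrite subr_eq0 subr_eq addrC => /eqP.
Qed.

Lemma glue_lcmx c x u K : dom c x -> (forall i, (K <= i)%N -> th i x = 0) ->
  lcmx glue c u (cmap c x) = \sum_(i < K) th i x *: lcmx (n i) c u (cmap c x).
Proof.
move=> cx h; rewrite (lcmxE _ _ cx); apply/row_matrixP => j.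
rewrite row_cmx (glueE _ _ h) mulmx_suml linear_sum; apply: eq_bigr => i _.
by rewrite linearZ /= (lcmxE _ _ cx) row_cmx scalemxAl.
Qed.

(** The matrices of the local connections are leafwise constant, so the product rule differentiates
    only the weights. *)
Lemma glue_leaf_rate c x (a : 'rV[R]_p) (w : NV) :
  (forall i, foliated_connection (D i) (n i)) -> charts (f := M) c -> dom c x ->
  leaf_rate glue c x a w =
  \sum_(i < N x) 'D_(row_mx a 0) (th i \o cinv c) (cmap c x) *: lcmx (n i) c (row_mx 0 w) (cmap c x).
Proof.
move=> fc hc cx.
have E : \forall z \near cmap c x,
    \sum_(i < N x) (th i \o cinv c) z *: lcmx (n i) c (row_mx 0 w) z = lcmx glue c (row_mx 0 w) z.
  apply: filterS (near_chart cx (lf x)) => _ [y [-> cy h]].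
  by rewrite (glue_lcmx _ cy h); apply: eq_bigr => i _; rewrite /= (cinvK cy).
rewrite /leaf_rate -(near_eq_derive _ E).
have T i : differentiable (fun z => (th i \o cinv c) z *: lcmx (n i) c (row_mx 0 w) z) (cmap c x) /\
    'D_(row_mx a 0) (fun z => (th i \o cinv c) z *: lcmx (n i) c (row_mx 0 w) z) (cmap c x) =
    'D_(row_mx a 0) (th i \o cinv c) (cmap c x) *: lcmx (n i) c (row_mx 0 w) (cmap c x).
  have [Dx|z0] := supp i x.
    have [[cn _] _] := fc i.
    have sl := smooth_lcmx (row_mx 0 w) cn (oD i) Dx hc cx.
    have [d e] := diffZ_fun (smooth_at_diff (sth i hc cx)) (smooth_at_diff sl).
    split; first exact: d.
    apply: etrans (e (row_mx a 0)) _.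
    have F := foliated_connection_leaf (row_mx 0 w) a (fc i) (oD i) Dx hc cx.
    apply: etrans (congr1 (fun A => _ + _ *: A) F) _.
    by rewrite scaler0 addr0.
  have E0 : \forall z \near cmap c x, (0 : R) = (th i \o cinv c) z.
    by apply: filterS (near_chart cx z0) => _ [y [-> cy h]]; rewrite /= (cinvK cy) h.
  have E1 : \forall z \near cmap c x, (0 : 'M[R]_k) = (th i \o cinv c) z *: lcmx (n i) c (row_mx 0 w) z.
    by apply: filterS E0 => z <-; rewrite scale0r.
  split.
    by apply: differentiable_near E1 _; exact: differentiable_cst.
  rewrite -(near_eq_derive _ E1) -(near_eq_derive _ E0) (derive_cst (0 : R)) (derive_cst (0 : 'M[R]_k)).
  by rewrite scale0r.
apply: etrans (derive_fsum _ _ (fun i : 'I_(N x) => (T i).1)) _.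
by apply: eq_bigr => i _; exact: (T i).2.
Qed.

Lemma sum_derive_weights c x (v : TV) : charts (f := M) c -> dom c x ->
  \sum_(i < N x) 'D_v (th i \o cinv c) (cmap c x) = 0.
Proof.
move=> hc cx.
have E : \forall z \near cmap c x, \sum_(i < N x) (th i \o cinv c) z = 1.
  apply: filterS (near_chart cx (lf x)) => _ [y [-> cy h]].
  by rewrite -(sum1 h); apply: eq_bigr => i _; rewrite /= (cinvK cy).
apply: etrans (esym (derive_fsum _ v (fun i : 'I_(N x) => smooth_at_diff (sth i hc cx)))) _.
by rewrite (near_eq_derive v E) derive_cst.
Qed.

(** The derivatives of the weights add up to 0, so a common reference matrix can be subtracted from
    every term. *)
Lemma glue_pure_trace c x (a : 'rV[R]_p) (G0 : NV -> 'M[R]_k) :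
  (forall i, foliated_connection (D i) (n i)) -> charts (f := M) c -> dom c x ->
  (forall i, D i x -> exists h,
     pure_trace (fun w => lcmx (n i) c (row_mx 0 w) (cmap c x) - G0 w) h) ->
  exists h, pure_trace (leaf_rate glue c x a) h.
Proof.
move=> fc hc cx H.
pose d i := 'D_(row_mx a 0) (th i \o cinv c) (cmap c x).
have [h e] : exists h, pure_trace (fun w =>
    \sum_(i < N x) d i *: (lcmx (n i) c (row_mx 0 w) (cmap c x) - G0 w)) h.
  apply: pure_trace_sum => i; have [Dx|z0] := supp i x; [right|left]; first exact: H.
  have E0 : \forall z \near cmap c x, (th i \o cinv c) z = 0.
    by apply: filterS (near_chart cx z0) => _ [y [-> cy h]]; rewrite /= (cinvK cy) h.
  by rewrite /d (near_eq_derive _ E0) derive_cst.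
exists h => v w; rewrite -e (glue_leaf_rate a w fc hc cx); congr (_ *m _).
have Z : \sum_(i < N x) d i *: G0 w = 0.
  by rewrite -scaler_suml (sum_derive_weights (row_mx a 0) hc cx) scale0r.
apply: etrans (esym (subr0 _)) _; apply: etrans (congr1 (fun B => _ - B) (esym Z)) _.
by rewrite -sumrB; apply: eq_bigr => i _; rewrite scalerBr.
Qed.

End Glue.

(** * A global connection from a transversally projective structure *)

Section Converse.
Context {R : realType} {p k : nat} (M : foliated_manifold R p k).
Local Notation TV := 'rV[R]_(p + k).
Local Notation NV := 'rV[R]_k.
Local Notation chartM := (chart R (pt M) (p + k)).

(** The construction of a partition of unity starts from a point; without points every condition is
    vacuous. *)
Lemma empty_manifold_connection : ~ (exists x : M, True) ->
  exists nabla : covderiv M, [/\ adapted_connection [set: M] nabla,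
    torsionless [set: M] nabla & leafwise_criterion nabla].
Proof.
move=> e; have E (x : M) (P : Prop) : P by case: e; exists x.
have E' (W : normedModType R) (c : chartM) (S : set M) (F : TV -> W) :
    smooth_on (cmap c @` (dom c `&` S)) F by move=> vs z [x]; exact: E.
exists (fun _ _ _ => 0); split.
- split; first by split=> [x|V x|V x|V X s _ _ _ _ c _]; by [exact: E|exact: E'].
  by move=> V X Y _ _ _ _ x; exact: E.
- by move=> V X Y _ _ _ _ x; exact: E.
- by move=> c x; exact: E.
Qed.

Lemma foliated_form_pure (U : set M) phi c x : foliated_form U phi -> U x ->
  charts (f := M) c -> dom c x ->
  exists h : 'cV[R]_k, forall w : NV, phi x (tvec c x (row_mx 0 w)) = (w *m h) 0 0.
Proof.
move=> ff Ux hc cx; have [V [d [S [g [[oV Vx VU] [hd oS _ E]]]]]] := ff x Ux.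
have [_ e] := E x Vx; have [_ dx] := VU x Vx.
exists (invmx (nmx c x) *m nmx d x *m g (rsubmx (cmap d x))) => w.
by rewrite e (rsubmx_tcoord _ hd dx) (rsubmx_tvec _ hc cx) row_mxKr !mulmxA.
Qed.

Lemma projective_connection : transversally_projective M ->
  exists nabla : covderiv M, [/\ adapted_connection [set: M] nabla,
    torsionless [set: M] nabla & leafwise_criterion nabla].
Proof.
move=> [J [c [n [phi [hc cov fol rel]]]]].
have [ne|] := pselect (exists x : M, True); last exact: empty_manifold_connection.
have [iota cI] := choice cov.
have [s [th [sth supp lf sum1]]] : exists s th, partition_of_unity s (fun x => dom (c (iota x))) th.
  by apply: (partition_exists ne) => x; split; [exact: dom_open|exact: cI].
have [N NP] := choice lf.
pose D i := dom (c (iota (s i))); pose nn i := n (iota (s i)).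
have oD i : open (D i) by exact: dom_open.
have fc i : foliated_connection (D i) (nn i) by case: (fol (iota (s i))).
have tl i : torsionless (D i) (nn i) by case: (fol (iota (s i))).
have ad i : adapted_connection (D i) (nn i) by case: (fc i).
exists (glue nn th N); split.
- exact: (glue_adapted oD sth supp NP sum1 ad).
- exact: (glue_torsionless oD supp NP sum1 tl).
apply: pure_trace_criterion => d x a hd dx.
(* The reference is the connection of the family chosen at x itself; the other connections defined
   at x differ from it projectively. *)
pose G0 w := lcmx (n (iota x)) d (row_mx 0 w) (cmap d x).
suff H i : D i x -> exists h,
    pure_trace (fun w => lcmx (nn i) d (row_mx 0 w) (cmap d x) - G0 w) h.
  exact: (glue_pure_trace oD sth supp NP sum1 a fc hd dx H).
move=> Dx.
pose U := dom (c (iota x)) `&` D i.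
have oU : open U by apply: openI; [exact: dom_open|exact: oD].
have Ux : U x by split; [exact: cI|exact: Dx].
have [ff r] := rel (iota x) (iota (s i)).
have [h eh] := foliated_form_pure ff Ux hd dx.
have [[[cn1 _] _] _] := fol (iota x); have [[cn2 _] _] := fc i.
have cn1' : is_connection U (n (iota x)).
  have [[ad1 _] _] := fol (iota x).
  by case: (adapted_setS (@subIsetl _ _ _ : U `<=` _) ad1).
have cn2' : is_connection U (nn i).
  by case: (adapted_setS (@subIsetr _ _ _ : U `<=` _) (ad i)).
exists h => v w; rewrite mulmxBr.
have := lcmx_projective_diff (row_mx 0 w) v cn1' cn2' oU r Ux hd dx.
rewrite row_mxKr !eh => ->; exact: addrC.
Qed.

End Converse.

Lemma criterion_pure_trace (R : realType) (p q : nat) (M : foliated_manifold R p q.*2)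
    (nabla : covderiv M) : adapted_connection [set: M] nabla ->
  torsionless [set: M] nabla -> leafwise_criterion nabla ->
  forall c x a, charts (f := M) c -> dom c x -> exists h, pure_trace (leaf_rate nabla c x a) h.
Proof.
move=> ad tl cr c x a hc cx; have [cn _] := ad.
apply: symmetric_pure_trace.
- exact: (leaf_rate_linear a cn openT I hc cx).
- by move=> v w; exact: leaf_rate_sym.
- by move=> w K KK; exact: cr.
Qed.

(** [twist_pure_trace] controls only the symmetrization of Om, and half of that is the leaf
    derivative of the symmetrized connection. So the symmetrized rate is pure trace, with the form
    h/2. *)
Lemma criterion_symmetrize (R : realType) (p q : nat) (M : foliated_manifold R p q.*2)
    (nabla : covderiv M) : adapted_connection [set: M] nabla ->
  leafwise_criterion nabla -> leafwise_criterion (symmetrize nabla).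
Proof.
move=> ad cr; apply: pure_trace_criterion => c x a hc cx; have [cn _] := ad.
have cr' w K : K *m K = - 1%:M ->
    (K *m leaf_rate nabla c x a w - leaf_rate nabla c x a w *m K) *m K =
    K *m leaf_rate nabla c x a (w *m K) - leaf_rate nabla c x a (w *m K) *m K.
  by move=> KK; exact: cr.
have [h e] := twist_pure_trace (leaf_rate_linear a cn openT I hc cx) cr'.
exists (2^-1 *: h) => v w; rewrite (leaf_rate_symmetrize a v w ad hc cx) e.
have hE (u : 'rV[R]_q.*2) : (u *m (2^-1 *: h)) 0 0 = 2^-1 * (u *m h) 0 0.
  by rewrite -scalemxAr mxE.
by rewrite !hE scalerDr !scalerA.
Qed.

Theorem theorem4p3 (R : realType) (p q : nat) (hq : (0 < q)%N)
    (M : foliated_manifold R p q.*2) :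
  ((exists nabla : covderiv M,
      adapted_connection [set: M] nabla /\ I1_projectable nabla) ->
   (exists nabla : covderiv M,
      [/\ adapted_connection [set: M] nabla, torsionless [set: M] nabla &
          I1_projectable nabla])) /\
  ((exists nabla : covderiv M,
      [/\ adapted_connection [set: M] nabla, torsionless [set: M] nabla &
          I1_projectable nabla]) <->
   transversally_projective M).
Proof.
split=> [[nabla [ad pr]]|].
  have [ad' tl'] := symmetrize_connection ad; exists (symmetrize nabla); split=> //.
  apply: (criterion_projectable ad'); apply: (criterion_symmetrize ad).
  exact: projectable_criterion.
split=> [[nabla [ad tl pr]]|/projective_connection[nabla [ad tl cr]]].
  apply: (projectable_projective_of ad tl).
  by apply: (criterion_pure_trace ad tl); exact: projectable_criterion.
by exists nabla; split=> //; exact: criterion_projectable.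
Qed.
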